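(* Let $X$ be a ball Banach function space on $\mathbb R^n$ such that the Hardy--Littlewood maximal operator $\mathcal M$ is bounded on $X$ and on its associate space $X'$, and let $b\in L^1_{\rm loc}(\mathbb R^n)$. Let $\Omega\in L^\infty(\mathbb S^{n-1})$ be homogeneous of degree zero with $\int_{\mathbb S^{n-1}}\Omega\,d\sigma=0$, and suppose there exists an open set $\Lambda\subset\mathbb S^{n-1}$ such that $\Omega$ does not change sign on $\Lambda$. If $[b,T_\Omega]$ is compact on $X$, then $b\in{\rm CMO}(\mathbb R^n)$.
   Context: Ball Banach function space: let $\mathscr M(\mathbb R^n)$ be the set of all measurable functions on $\mathbb R^n$. A Banach space $X\subset\mathscr M(\mathbb R^n)$ (with $\|f\|_X=\infty$ for $f\notin X$) is a ball Banach function space if: $\|f\|_X=0$ implies $f=0$ a.e.; $|g|\le|f|$ a.e. implies $\|g\|_X\le\|f\|_X$; $0\le f_m\uparrow f$ a.e. implies $\|f_m\|_X\uparrow\|f\|_X$; $\mathbf 1_B\in X$ for every ball $B$; $\|f+g\|_X\le\|f\|_X+\|g\|_X$; and for every ball $B$ there is $C_{(B)}>0$ with $\int_B|f|\,dx\le C_{(B)}\|f\|_X$ for all $f\in X$. Associate space: $X':=\{f\in\mathscr M(\mathbb R^n):\|f\|_{X'}:=\sup_{\{g\in X:\|g\|_X=1\}}\|fg\|_{L^1(\mathbb R^n)}<\infty\}$. $\mathcal M(f)(x):=\sup_{B\ni x}\frac1{|B|}\int_B|f(y)|\,dy$, the supremum being over all balls $B$ containing $x$. $\mathbb S^{n-1}$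 is the unit sphere with area measure $d\sigma$. Homogeneous of degree zero: $\Omega(\mu x)=\Omega(x)$ for $\mu\in(0,\infty)$, $x\in\mathbb S^{n-1}$, so $\Omega$ is defined on $\mathbb R^n\setminus\{0\}$. $T_\Omega(f)(x):=\lim_{\varepsilon\to0^+}\int_{\varepsilon<|x-y|<1/\varepsilon}\frac{\Omega(x-y)}{|x-y|^n}f(y)\,dy$. The commutator is $[b,T_\Omega](f)(x):=b(x)T_\Omega(f)(x)-T_\Omega(bf)(x)$, for bounded $f$ with compact support, and by the same formula for $f\in X$; for a bounded measurable set $F$ and $x\notin\overline F$, $[b,T_\Omega](\mathbf 1_F)(x)=\int_F[b(x)-b(y)]\frac{\Omega(x-y)}{|x-y|^n}\,dy$. Compact on $X$ means that it maps bounded subsets of $X$ to relatively compact subsets of $X$. ${\rm BMO}(\mathbb R^n)$: locally integrable $f$ with $\|f\|_{{\rm BMO}(\mathbb R^n)}:=\sup_B\frac1{|B|}\int_B|f-f_B|\,dx<\infty$, sup over all balls, $f_B:=\frac1{|B|}\int_Bf$. ${\rm CMO}(\mathbb R^n)$ is the closure in ${\rm BMO}(\mathbb R^n)$ of $C_{\rm c}^\infty(\mathbb R^n)$, the infinitely differentiable functions with compact support.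
   Formalization: The open set Λ is required to be one on which Ω is not almost everywhere zero (so Λ is non-empty); otherwise Ω = 0 gives [b,T_Ω] = 0, compact on X for every locally integrable b, and the claim fails. *)

(* Defs.v *)
(* The dimension is n.+1 throughout, so that it ranges over all integers >= 1.
   The norm that 'rV[R]_n.+1 carries in the library is the maximum norm: its
   topology is the usual one, but its balls are cubes, so the Euclidean norm and
   the Euclidean balls are defined here.  All functions are real-valued. *)
From HB Require Import structures.
From mathcomp Require Import all_boot all_order all_algebra.
From mathcomp Require Import all_classical all_reals all_analysis.

Set Implicit Arguments.
Unset Strict Implicit.
Unset Printing Implicit Defensive.
Import Order.TTheory GRing.Theory Num.Theory.
Import numFieldNormedType.Exports.

Local Open Scope classical_set_scope.
Local Open Scope ring_scope.

Section box_measure.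
Variables (R : realType) (n : nat).
Local Notation E := 'rV[R]_n.+1.
Local Open Scope ereal_scope.

Definition box (p : E * E) : set E :=
  [set x | forall i, (p.1 0 i < x 0 i <= p.2 0 i)%R].

Definition box_volume (p : E * E) : \bar R :=
  (\prod_i Num.max 0 (p.2 0 i - p.1 0 i))%:E.

(* The sigma-algebra put on 'rV[R]_n.+1 below consists of the Lebesgue
   measurable sets (those satisfying Caratheodory's criterion for
   lebesgue_outer), not only of the Borel sets. *)
Definition lebesgue_outer (A : set E) : \bar R :=
  ereal_inf [set \sum_(k <oo) box_volume (p k) |
             p in [set p : nat -> E * E | A `<=` \bigcup_k box (p k)]].

Let volume_ge0 p : 0 <= box_volume p.
Proof. by rewrite lee_fin; apply: prodr_ge0 => i _; rewrite le_max lexx. Qed.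

Lemma lebesgue_outer0 : lebesgue_outer set0 = 0.
Proof.
apply/eqP; rewrite eq_le; apply/andP; split; last first.
  by apply: le_ereal_inf_tmp => _ [p _ <-]; apply: nneseries_ge0.
apply: ereal_inf_lbound; exists (fun=> (0%R, 0%R)) => //.
apply: eseries0 => k _ _.
by rewrite /box_volume big_ord_recl /= mxE subrr maxxx mul0r.
Qed.

Lemma lebesgue_outer_ge0 A : 0 <= lebesgue_outer A.
Proof. by apply: le_ereal_inf_tmp => _ [p _ <-]; apply: nneseries_ge0. Qed.

Lemma le_lebesgue_outer :
  {homo lebesgue_outer : A B / A `<=` B >-> A <= B}.
Proof.
move=> A B AB; apply: ereal_inf_le_tmp => _ [p Bp <-]; exists p => //=.
exact: subset_trans Bp.
Qed.

Lemma lebesgue_outer_sigma_subadditive : sigma_subadditive lebesgue_outer.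
Proof.
move=> A; have [[i ioo]|] := pselect (exists i, lebesgue_outer (A i) = +oo).
  rewrite (eseries_pinfty _ _ ioo) ?leey// => k _.
  by rewrite -ltNye (lt_le_trans _ (lebesgue_outer_ge0 _)).
rewrite -forallNE => Aoo.
suff add2e (e : {posnum R}) : lebesgue_outer (\bigcup_k A k) <=
    \sum_(i <oo) lebesgue_outer (A i) + e%:num%:E.
  by apply/lee_addgt0Pr => _/posnumP[].
rewrite (le_trans _ (epsilon_trick _ _ _))//; last first.
  by move=> k; exact: lebesgue_outer_ge0.
pose P k (B : nat -> E * E) := A k `<=` \bigcup_j box (B j) /\
  \sum_(j <oo) box_volume (B j) <=
  lebesgue_outer (A k) + (e%:num / (2 ^ k.+1)%:R)%:E.
have [G PG] : {G : nat -> nat -> E * E & forall k, P k (G k)}.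
  apply: (@choice _ _ P) => k; rewrite /P.
  have fA : lebesgue_outer (A k) \is a fin_num.
    rewrite ge0_fin_numE ?lebesgue_outer_ge0//.
    by rewrite ltey; apply/eqP; exact: Aoo.
  have ek : (0 < e%:num / (2 ^ k.+1)%:R)%R by [].
  have [_ [p Ap <-] pA] := lb_ereal_inf_adherent ek fA.
  by exists p; split => //; exact: ltW.
have vG_ge0 x : 0 <= (box_volume \o uncurry G) x by exact: volume_ge0.
have /card_esym/ppcard_eqP[f] := card_nat2.
apply: (@le_trans _ _ (\esum_(i in setT) (box_volume \o uncurry G) i)).
  apply: ereal_inf_lbound => /=; exists (uncurry G \o f).
    move=> t [i _ /((PG i).1) [j _ Gt]].
    by exists (f^-1%FUN (i, j)) => //=; rewrite invK ?inE.
  rewrite -(esum_pred_image (box_volume \o uncurry G) _ xpredT)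
    ?[fun=> _]set_true//.
  by rewrite image_eq.
rewrite (_ : esum _ _ = \sum_(i <oo) \sum_(j <oo) box_volume (G i j)); last first.
  pose J : nat -> set (nat * nat) := fun i => [set (i, j) | j in setT].
  rewrite (_ : setT = \bigcup_k J k); last first.
    by rewrite predeqE => -[a b]; split => // _; exists a => //; exists b.
  rewrite esum_bigcupT /=; last 2 first.
    - apply/trivIsetP => i j _ _ ij.
      rewrite predeqE => -[? m] /=; split => //= -[] [_] _ [<- _].
      by move=> [m' _] [] /esym/eqP; rewrite (negbTE ij).
    - by move=> [? m]; exact: volume_ge0.
  rewrite -(image_id [set: nat]) -fun_true esum_pred_image//; last first.
    by move=> ? _; exact: esum_ge0.
  apply: eq_eseriesr => /= j _.
  rewrite -(esum_pred_image (box_volume \o uncurry G) (pair j) predT)//=; last first.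
    by move=> ? ? _ _; exact: (@can_inj _ _ _ snd).
  by congr esum; rewrite predeqE => -[a b]; split; move=> [i _ <-]; exists i.
apply: lee_nneseries => [i _ _|i _]; first exact: nneseries_ge0.
exact: (PG i).2.
Qed.

HB.instance Definition _ := isOuterMeasure.Build R E lebesgue_outer
  lebesgue_outer0 lebesgue_outer_ge0 le_lebesgue_outer
  lebesgue_outer_sigma_subadditive.

HB.instance Definition _ :=
  Measurable.copy 'rV[R]_n.+1 (caratheodory_type lebesgue_outer).

Definition leb : set E -> \bar R := lebesgue_outer.
HB.instance Definition _ := isMeasure.Build _ E R leb
  (@caratheodory_measure0 R E lebesgue_outer)
  (@caratheodory_measure_ge0 R E lebesgue_outer)
  (@caratheodory_measure_sigma_additive R E lebesgue_outer).

End box_measure.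

Section euclidean_space.
Variables (R : realType) (n : nat).
Local Notation E := 'rV[R]_n.+1.

Definition enorm (x : E) : R := Num.sqrt (\sum_i x 0 i ^+ 2).

Definition eball (c : E) (r : R) : set E := [set x | enorm (x - c) < r].

Definition locally_integrable_rV (f : E -> R) :=
  measurable_fun setT f /\
  forall K : set E, compact K -> (\int[@leb R n]_(x in K) `|f x|%:E < +oo)%E.

Definition iter_partial (s : seq 'I_n.+1) (f : E -> R) : E -> R :=
  foldr (fun i g => 'D_(delta_mx 0 i) g) f s.

(* All iterated partial derivatives exist and are continuous. *)
Definition smooth (f : E -> R) := forall s : seq 'I_n.+1,
  continuous (iter_partial s f) /\
  forall i x, derivable (iter_partial s f) x (delta_mx 0 i).

Definition test_function (f : E -> R) :=
  smooth f /\ compact (closure [set x | f x != 0]).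

Definition ball_mean (f : E -> R) (c : E) (r : R) : R :=
  (fine (@leb R n (eball c r)))^-1 * \int[@leb R n]_(x in eball c r) f x.

Definition mean_oscillation (f : E -> R) (c : E) (r : R) : \bar R :=
  ((fine (@leb R n (eball c r)))^-1%:E *
   \int[@leb R n]_(x in eball c r) `|f x - ball_mean f c r|%:E)%E.

Definition bmo_norm (f : E -> R) : \bar R :=
  ereal_sup [set mean_oscillation f p.1 p.2 | p in [set p : E * R | 0 < p.2]].

Definition BMO (f : E -> R) :=
  locally_integrable_rV f /\ (bmo_norm f < +oo)%E.

(* The closure of the test functions for the seminorm bmo_norm. *)
Definition CMO (f : E -> R) :=
  BMO f /\
  forall e : R, 0 < e ->
    exists2 g, test_function g & (bmo_norm (f \- g)%R < e%:E)%E.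

Definition maximal (f : E -> R) (x : E) : \bar R :=
  ereal_sup [set ((fine (@leb R n (eball p.1 p.2)))^-1%:E *
                  \int[@leb R n]_(y in eball p.1 p.2) `|f y|%:E)%E
            | p in [set p : E * R | 0 < p.2 /\ eball p.1 p.2 x]].

(* maximal f takes values in [0, +oo] whereas N is defined on real-valued
   functions, hence the real-valued representative g of maximal f. *)
Definition maximal_bounded (N : (E -> R) -> \bar R) :=
  exists2 C : R, 0 < C & forall f, (N f < +oo)%E ->
    exists2 g : E -> R, {ae @leb R n, forall x, (g x)%:E = maximal f x} &
      (N g <= C%:E * N f)%E.

End euclidean_space.

Section normed_function_space.
Variables (R : realType) (n : nat).
Local Notation E := 'rV[R]_n.+1.
Local Open Scope ereal_scope.

(* A normed space X of measurable functions, given by its norm extended by +oo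
   to the functions outside X: the members of X are the f with fnorm f < +oo.
   Functions equal almost everywhere are not identified, so that element X below
   is only a pseudometric space; completeness and relative compactness are those
   of its quotient by almost everywhere equality. *)
Record normedFunctionSpace := NormedFunctionSpace {
  fnorm :> (E -> R) -> \bar R ;
  fnorm_measurable : forall f, fnorm f < +oo -> measurable_fun setT f ;
  fnorm_ge0 : forall f, 0 <= fnorm f ;
  fnorm0 : fnorm (fun=> 0%R) = 0 ;
  fnormZ : forall (a : R) f, fnorm f < +oo ->
    fnorm (fun x => a * f x)%R = `|a|%:E * fnorm f ;
  fnormD : forall f g, fnorm (f \+ g)%R <= fnorm f + fnorm g }.

Variable X : normedFunctionSpace.

Record element := Element {
  element_fun :> E -> R ;
  element_lty : fnorm X element_fun < +oo }.

HB.instance Definition _ := gen_eqMixin element.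
HB.instance Definition _ := gen_choiceMixin element.

Definition element_ball (f : element) (e : R) : set element :=
  [set g | fnorm X (f \- g)%R < e%:E].

Let ent : set_system (element * element) := entourage_ element_ball.

Let element_ball_center f (e : R) : (0 < e)%R -> element_ball f e f.
Proof.
move=> e0; rewrite /element_ball/=.
rewrite (_ : (_ \- _)%R = fun=> 0%R) ?fnorm0 ?lte_fin//.
by apply/funext => x /=; rewrite subrr.
Qed.

Let element_ball_sym f g (e : R) : element_ball f e g -> element_ball g e f.
Proof.
rewrite /element_ball/= => fg.
rewrite (_ : (g \- f)%R = fun x => -1 * (f \- g) x)%R.
  by rewrite fnormZ ?normrN1 ?mul1e// (lt_trans fg) ?ltry.
by apply/funext => x /=; rewrite mulN1r opprB.
Qed.

Let element_ball_triangle f g h (e1 e2 : R) :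
  element_ball f e1 g -> element_ball g e2 h -> element_ball f (e1 + e2) h.
Proof.
rewrite /element_ball/= => fg gh.
rewrite (_ : (f \- h)%R = (f \- g) \+ (g \- h))%R.
  by rewrite (le_lt_trans (fnormD _ _ _))// EFinD lteD.
by apply/funext => x /=; rewrite addrA subrK.
Qed.

HB.instance Definition _ := hasNbhs.Build element (nbhs_ ent).
HB.instance Definition _ := @Nbhs_isPseudoMetric.Build R element
  ent erefl element_ball element_ball_center element_ball_sym
  element_ball_triangle erefl.

(* The triangle inequality is in normedFunctionSpace. *)
Record is_ball_banach : Prop := IsBallBanach {
  ball_banach_complete : forall F : set_system element,
    ProperFilter F -> cauchy F -> exists f : element, F --> f ;
  ball_banach_eq0 : forall f, X f = 0 -> {ae @leb R n, forall x, f x = 0%R} ;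
  ball_banach_lattice : forall f g : E -> R, measurable_fun setT g ->
    {ae @leb R n, forall x, (`|g x| <= `|f x|)%R} -> X g <= X f ;
  ball_banach_fatou : forall (f_ : nat -> E -> R) (f : E -> R),
    (forall m, measurable_fun setT (f_ m)) -> measurable_fun setT f ->
    {ae @leb R n, forall x,
      (forall m, 0 <= f_ m x <= f_ m.+1 x)%R /\ f_ ^~ x @ \oo --> f x} ->
    nondecreasing_seq (fun m => X (f_ m)) /\ X (f_ m) @[m --> \oo] --> X f ;
  ball_banach_indic : forall c r, (0 < r)%R -> X \1_(eball c r) < +oo ;
  ball_banach_integral : forall c r, (0 < r)%R ->
    exists2 C : R, (0 < C)%R & forall f, X f < +oo ->
      \int[@leb R n]_(x in eball c r) `|f x|%:E <= C%:E * X f }.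

Definition associate_norm (f : E -> R) : \bar R :=
  if `[< measurable_fun setT f >] then
    ereal_sup [set 'N[@leb R n]_1[EFin \o (f \* g)%R]
              | g in [set g | X g = 1]]
  else +oo.

(* D is the domain on which the operator T is meaningful; that T acts on X
   includes that every member of X is in D. *)
Definition compact_operator (D : set (E -> R)) (T : (E -> R) -> (E -> R)) :=
  (forall f, X f < +oo -> D f /\ X (T f) < +oo) /\
  forall A : set element, (exists M : R, forall f, A f -> X f <= M%:E) ->
    precompact [set g : element |
                exists2 f, A f & element_fun g = T (element_fun f)].

End normed_function_space.

Section sphere.
Variables (R : realType) (n : nat).
Local Notation E := 'rV[R]_n.+1.
Local Open Scope ereal_scope.

Definition sphere : set E := [set x | enorm x = 1%R].

(* The area of A is n.+1 times the Lebesgue measure of the set of all t *: y with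
   0 < t <= 1 and y in A: this is the area measure of polar coordinates.  It is
   a measure on the ambient space, carried by the sphere; a set is measurable
   for it iff its trace on the sphere is area-measurable. *)
Definition cone (A : set E) : set E :=
  [set x | exists t y, [/\ (0 < t <= 1)%R, sphere y, A y & x = (t *: y)%R]].

Definition surface_outer (A : set E) : \bar R :=
  n.+1%:R%:E * lebesgue_outer (cone A).

Lemma surface_outer0 : surface_outer set0 = 0.
Proof.
rewrite /surface_outer (_ : cone set0 = set0) ?lebesgue_outer0 ?mule0//.
by rewrite predeqE => x; split => // -[t [y [_ _ []]]].
Qed.

Lemma surface_outer_ge0 A : 0 <= surface_outer A.
Proof. by apply: mule_ge0; rewrite ?lee_fin ?lebesgue_outer_ge0. Qed.

Lemma le_surface_outer :
  {homo surface_outer : A B / A `<=` B >-> A <= B}.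
Proof.
move=> A B AB; apply: lee_wpmul2l; first by rewrite lee_fin.
apply: le_lebesgue_outer => x [t [y [t01 Sy Ay ->]]].
by exists t, y; split => //; exact: AB.
Qed.

Lemma surface_outer_sigma_subadditive : sigma_subadditive surface_outer.
Proof.
move=> A; rewrite /surface_outer nneseriesZl//; last first.
  by move=> *; exact: lebesgue_outer_ge0.
apply: lee_wpmul2l; first by rewrite lee_fin.
apply: le_trans (lebesgue_outer_sigma_subadditive _).
apply: le_lebesgue_outer => x [t [y [t01 Sy [k _ Ay] ->]]].
by exists k => //; exists t, y.
Qed.

HB.instance Definition _ := isOuterMeasure.Build R E surface_outer
  surface_outer0 surface_outer_ge0 le_surface_outer
  surface_outer_sigma_subadditive.

Definition surface : set (caratheodory_type surface_outer) -> \bar R :=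
  surface_outer.
HB.instance Definition _ := isMeasure.Build _ (caratheodory_type surface_outer) R
  surface (@caratheodory_measure0 R E surface_outer)
  (@caratheodory_measure_ge0 R E surface_outer)
  (@caratheodory_measure_sigma_additive R E surface_outer).

End sphere.

Section singular_integral.
Variables (R : realType) (n : nat).
Local Notation E := 'rV[R]_n.+1.

Definition homogeneous0 (Omega : E -> R) :=
  forall (t : R) x, 0 < t -> @sphere R n x -> Omega (t *: x) = Omega x.

Definition sphere_Linfty (Omega : E -> R) :=
  (Omega : caratheodory_type (@surface_outer R n) -> R)
    \in Lfun (@surface R n) +oo%E.

Definition open_in_sphere (L : set E) :=
  exists2 U : set E, open U & L = U `&` @sphere R n.

Definition no_sign_change (Omega : E -> R) (L : set E) :=
  {ae @surface R n, forall x, L x -> 0 <= Omega x} \/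
  {ae @surface R n, forall x, L x -> Omega x <= 0}.

Definition ae_zero_on_sphere (Omega : E -> R) (L : set E) :=
  {ae @surface R n, forall x, L x -> Omega x = 0}.

Definition annulus (x : E) (e : R) : set E :=
  [set y | e < enorm (x - y) < e^-1].

Definition singular_integrand (Omega f : E -> R) (x y : E) : R :=
  Omega (x - y) / enorm (x - y) ^+ n.+1 * f y.

Definition truncated_integral (Omega f : E -> R) (x : E) (e : R) : R :=
  \int[@leb R n]_(y in annulus x e) singular_integrand Omega f x y.

(* lim has a default value where the limit does not exist; T_Omega_exists
   characterizes the points where T_Omega is meaningful. *)
Definition T_Omega (Omega f : E -> R) (x : E) : R :=
  lim (truncated_integral Omega f x e @[e --> 0^'+]).

Definition T_Omega_exists (Omega f : E -> R) (x : E) :=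
  (forall e : R, 0 < e -> (@leb R n).-integrable (annulus x e)
     (EFin \o singular_integrand Omega f x)) /\
  cvg (truncated_integral Omega f x e @[e --> 0^'+]).

Definition commutator (b Omega f : E -> R) (x : E) : R :=
  b x * T_Omega Omega f x - T_Omega Omega (b \* f) x.

Definition commutator_dom (b Omega : E -> R) : set (E -> R) :=
  [set f | {ae @leb R n, forall x,
     T_Omega_exists Omega f x /\ T_Omega_exists Omega (b \* f) x}].

End singular_integral.

(* Main.v *)
(** Rescaled to anisotropic cubes Q adapted to Omega, each Q has a companion cube P
    of the same size on which Omega(x - y) has constant sign for x in Q, y in P, up
    to a small set.  Testing [b, T] on f_Q = 1_F / ||1_P||, where F is the part of P
    above or below a median of b on P, bounds the mean oscillation of b over Q by
    the mean of |[b, T] f_Q| over Q times ||1_P||, and ||f_Q|| <= 1; hence b is in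
    BMO.  Let two cubes on which b oscillates by at least gamma be of very
    different sizes, or far apart relatively to their sizes.  The boundedness of M
    on X alone yields ||1_(2^k Q)|| <= C 2^(k d) (k + 1)^-2 ||1_Q||, and this
    logarithmic gain beats the growth k of the means of b along k doublings, so the
    images of the two test functions are at distance at least e0(gamma) in X.
    Relative compactness therefore makes the mean oscillation of b tend to 0 over
    small, large and far cubes.

    Such a b is in CMO by Uchiyama's argument: with b_a a partition of unity
    average of the means of b on the grid of step a, and chi a cutoff at scale rho,
    b - chi (b_a - c) = (1 - chi) (b - c) + chi (b - b_a) + c, and a Lipschitz
    cutoff at scale l preserves oscillations that are small up to scale l if the
    mean at scale l is small too. *)
From HB Require Import structures.
From mathcomp Require Import all_boot all_order all_algebra.
From mathcomp Require Import all_classical all_reals all_analysis measurable_realfun ess_sup_inf.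
From mathcomp Require Import ring lra.
Require Import Defs.
Set Implicit Arguments.
Unset Strict Implicit.
Unset Printing Implicit Defensive.
Import Order.TTheory GRing.Theory Num.Theory.
Import numFieldNormedType.Exports.
Local Open Scope classical_set_scope.
Local Open Scope ring_scope.

(** * Lebesgue measure and integrals *)

Section box_measure.
Variables (R : realType) (n : nat).
Local Notation E := 'rV[R]_n.+1.
Local Notation mu := (@leb R n).
Local Notation len a b := (Num.max 0 (b - a)).
Local Notation ind a b t := ((a < t <= b)%R%:R : R).

(** X carries no invariance under translations or dilations, so norms of indicators of different
    cubes are compared only through M. Write d for the dimension. Plain doubling gives ||1_(2^k Q)||
    <= C 2^(k d) ||1_Q||, which exactly cancels the decay 2^(-k d) of the kernel and leaves nothing
    against the means of b, which may move by a multiple of k. One use of the logarithmic gain only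
    balances this growth; used twice, it gives the square, and a factor 1 / (k + 1) survives.

    When two images are compared on the larger cube, the image attached to the smaller one is not
    controlled close to its own companion. A cube of relative size 2^(-q) is removed there; on it
    the other image has small mean, because the volume 2^(-q d) beats the shift, of order q, of the
    means of b.

    Omega has no continuity. The shape [s] of the cubes comes from a box almost filled by a set
    where Omega, up to a sign, exceeds a positive constant, which is why anisotropic boxes replace
    balls until the very end. That this set is Lebesgue measurable is read off the domain of the
    operator: T must make sense on indicators of balls. *)

Lemma integral_half_open (a b : R) :
  (\int[lebesgue_measure]_t (ind a b t)%:E = (len a b)%:E)%E.
Proof.
rewrite (_ : (fun t => _) = (fun t => (\1_(`]a, b]%classic : set R) t)%:E)).
  rewrite integral_indic//= setIT lebesgue_measure_itv/= lte_fin.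
  case: ltP => ab.
    by rewrite EFinN; congr _%:E; rewrite maxElt subr_gt0 ab.
  by congr _%:E; rewrite maxElt subr_gt0 ltNge ab.
apply/funext => t; rewrite indicE; congr (_%:R)%:E.
by rewrite mem_setE in_itv/=.
Qed.

(* The inequality between indicators is integrated one coordinate at a time. *)
Lemma cover_volume (l : seq 'I_n.+1) : uniq l ->
  forall (c : R) (p : E * E) (ck : nat -> R) (pk : nat -> E * E),
  0 <= c -> (forall k, 0 <= ck k) ->
  (forall x : 'I_n.+1 -> R,
    ((c * \prod_(i <- l) ind (p.1 0 i) (p.2 0 i) (x i))%:E <=
    \sum_(k <oo)
      (ck k * \prod_(i <- l) ind ((pk k).1 0 i) ((pk k).2 0 i) (x i))%:E)%E) ->
  ((c * \prod_(i <- l) len (p.1 0 i) (p.2 0 i))%:E <=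
    \sum_(k <oo)
      (ck k * \prod_(i <- l) len ((pk k).1 0 i) ((pk k).2 0 i))%:E)%E.
Proof.
elim: l => [_ c p ck pk c0 ck0 H|i l IH /= /andP[il ul] c p ck pk c0 ck0 H].
  move: (H (fun=> 0)); rewrite !big_nil => /le_trans; apply.
  by apply: lee_nneseries => k _; rewrite ?big_nil ?lee_fin ?mulr1.
have len0 (a b : R) : 0 <= len a b by rewrite le_max lexx.
have mind (a b : R) : measurable_fun setT (fun t : R => ind a b t).
  rewrite (_ : (fun t => _) = \1_(`]a, b]%classic : set R)) //.
  apply/funext => t; rewrite indicE; congr (_%:R).
  by rewrite mem_setE in_itv.
rewrite big_cons mulrA.
rewrite [leRHS](_ : _ = \sum_(k <oo) (ck k * len ((pk k).1 0 i) ((pk k).2 0 i) *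
    \prod_(j <- l) len ((pk k).1 0 j) ((pk k).2 0 j))%:E)%E; last first.
  by apply: eq_eseriesr => k _; rewrite big_cons mulrA.
apply: IH => // [|k|x]; [by rewrite mulr_ge0|by rewrite mulr_ge0|].
pose W (q : E * E) := \prod_(j <- l) ind (q.1 0 j) (q.2 0 j) (x j).
have W0 q : 0 <= W q by apply: prodr_ge0.
have int (a : R) (q : E * E) : 0 <= a ->
    ((a * len (q.1 0 i) (q.2 0 i) * W q)%:E =
    \int[lebesgue_measure]_t
      (a * (ind (q.1 0 i) (q.2 0 i) t * W q))%:E)%E.
  move=> a0; under eq_integral do rewrite mulrCA mulrC EFinM.
  rewrite ge0_integralZl//=.
  - by rewrite integral_half_open -EFinM; congr _%:E; rewrite mulrAC.
  - by apply/measurable_EFinP; exact: mind.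
  - by rewrite lee_fin mulr_ge0.
rewrite (int c p c0) (eq_eseriesr (fun k _ => int (ck k) (pk k) (ck0 k))).
rewrite -integral_nneseries//; last 2 first.
- move=> k; apply/measurable_EFinP; apply: measurable_funM => //.
  by apply: measurable_funM => //; exact: mind.
- by move=> k t _; rewrite lee_fin !mulr_ge0.
apply: ge0_le_integral => //.
- by move=> t _; rewrite lee_fin !mulr_ge0.
- apply/measurable_EFinP; apply: measurable_funM => //.
  by apply: measurable_funM => //; exact: mind.
- apply: (@ge0_emeasurable_sum _ _ _ _ _ xpredT) => k; first by move=> t _ _; rewrite lee_fin !mulr_ge0.
  move=> _; apply/measurable_EFinP; apply: measurable_funM => //.
  by apply: measurable_funM => //; exact: mind.
move=> t _.
have /= := H (fun j => if j == i then t else x j).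
have upd (q : E * E) : \prod_(j <- i :: l)
    ind (q.1 0 j) (q.2 0 j) (if j == i then t else x j) =
    ind (q.1 0 i) (q.2 0 i) t * W q.
  rewrite big_cons eqxx; congr (_ * _); rewrite /W big_seq [RHS]big_seq.
  by apply: eq_bigr => j jl; case: eqP => // ji; rewrite -ji jl in il.
by rewrite upd; under eq_eseriesr do rewrite upd.
Qed.

(** For the upper bound [p] is padded with degenerate boxes. For the lower bound, the indicators of
    a countable cover dominate that of [box p], and [cover_volume] with all coefficients equal to 1
    passes from indicators to volumes. *)
Lemma lebesgue_outer_box (p : E * E) : lebesgue_outer (box p) = box_volume p.
Proof.
apply/eqP; rewrite eq_le; apply/andP; split.
  apply: ereal_inf_lbound.
  exists (fun k => if k == 0%N then p else (0 : E, 0 : E)).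
    by move=> x px; exists 0%N.
  have v0 : box_volume (0 : E, 0 : E) = 0%E.
    by rewrite /box_volume big_ord_recl /= mxE subrr maxxx mul0r.
  have v1 q : (0 <= box_volume q :> \bar R)%E.
    by rewrite lee_fin; apply: prodr_ge0 => i _; rewrite le_max lexx.
  rewrite (nneseries_split 0 1)//=.
  rewrite add0n big_mkord big_ord1 eseries0 ?adde0// => k.
  by case: k.
apply: le_ereal_inf_tmp => _ [q pq <-].
have := @cover_volume (enum 'I_n.+1) (enum_uniq _) 1 p (fun=> 1) q.
rewrite mul1r /box_volume big_enum/= => H.
rewrite (le_trans (H ler01 (fun=> ler01) _))//; last first.
  apply: lee_nneseries => k _; last by rewrite mul1r big_enum.
  by move=> _; rewrite lee_fin mul1r; apply: prodr_ge0 => i _; rewrite le_max lexx.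
move=> x; rewrite big_enum/=.
rewrite [leRHS](_ : _ = \sum_(k <oo)
    (\prod_i ind ((q k).1 0 i) ((q k).2 0 i) (x i))%:E)%E; last first.
  by apply: eq_eseriesr => k _; rewrite mul1r big_enum.
have [xp|xp] := pselect (box p (\row_i x i)); last first.
  have [i xi] : exists i, ~ (p.1 0 i < x i <= p.2 0 i).
    by apply/existsNP => h; apply: xp => i; rewrite mxE; exact: h.
  rewrite mul1r (bigD1 i)//= (negbTE (introN idP xi)) mul0r.
  by apply: nneseries_ge0 => k _ _; rewrite lee_fin; apply: prodr_ge0.
have [k _ xk] := pq _ xp.
have in1 (r : E * E) : box r (\row_i x i) ->
    \prod_i ind (r.1 0 i) (r.2 0 i) (x i) = 1.
  by move=> xr; rewrite big1// => i _; have := xr i; rewrite mxE => ->.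
rewrite mul1r in1//.
apply: le_trans (nneseries_lim_ge k.+1 _); last first.
  by move=> j _ _; rewrite lee_fin; apply: prodr_ge0.
rewrite big_nat_recr//= in1// leeDr//.
by apply: sume_ge0 => j _; rewrite lee_fin; apply: prodr_ge0.
Qed.
End box_measure.

Section lebesgue_sets.
Variables (R : realType) (n : nat).
Local Notation E := 'rV[R]_n.+1.
Local Notation mu := (@leb R n).
Local Notation len a b := (Num.max 0 (b - a)).

Lemma box_volume_ge0 (p : E * E) : (0 <= box_volume p)%E.
Proof. by rewrite lee_fin; apply: prodr_ge0 => i _; rewrite le_max lexx. Qed.

Lemma len_split (a b c : R) :
  len a b = len a (Num.min b c) + len (Num.max a c) b.
Proof.
rewrite /Order.max /Order.min.
by case: (ltP b c) => ?; case: (ltP a c) => ?;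
  do ?[case: ltP => ?]; lra.
Qed.

(** The hyperplane cuts every box of a cover into two boxes whose volumes add up, by [len_split] in
    the coordinate [i]; taking the infimum over covers gives Caratheodory's criterion. *)
Lemma measurable_halfspace (i : 'I_n.+1) (c : R) :
  measurable ([set x | x 0 i <= c] : set E).
Proof.
apply: le_caratheodory_measurable => X.
apply: le_ereal_inf_tmp => _ [p Xp <-].
pose lo (q : E * E) : E * E :=
  (q.1, \row_j if j == i then Num.min (q.2 0 j) c else q.2 0 j).
pose hi (q : E * E) : E * E :=
  (\row_j if j == i then Num.max (q.1 0 j) c else q.1 0 j, q.2).
have vol q : box_volume q = (box_volume (lo q) + box_volume (hi q))%E.
  pose W := \prod_(j < n.+1 | j != i) len (q.1 0 j) (q.2 0 j).
  have volE (r : E * E) : (forall j, j != i -> r.1 0 j = q.1 0 j /\ r.2 0 j = q.2 0 j) ->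
      box_volume r = (len (r.1 0 i) (r.2 0 i) * W)%:E.
    move=> rq; rewrite /box_volume (bigD1 i) //=; congr (_ * _)%:E.
    by apply: eq_bigr => j /rq[-> ->].
  rewrite !volE//; try by move=> j ji; rewrite !mxE (negbTE ji).
  rewrite -EFinD -mulrDl /= !mxE eqxx; congr (_ * _)%:E.
  exact: len_split.
rewrite (eq_eseriesr (fun k _ => vol (p k))) nneseriesD; last 2 first.
- by move=> k _ _; exact: box_volume_ge0.
- by move=> k _ _; exact: box_volume_ge0.
apply: leeD; apply: ereal_inf_lbound.
- exists (lo \o p) => // x [/Xp[k _ pk] /= xc]; exists k => // j /=.
  have := pk j; rewrite mxE; case: eqP => // ->.
  by rewrite le_min xc andbT.
- exists (hi \o p) => // x [/Xp[k _ pk] /= xc]; exists k => // j /=.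
  have := pk j; rewrite mxE; case: eqP => // ->.
  by rewrite gt_max => /andP[-> ->]; rewrite ltNge (introN idP xc).
Qed.

Lemma measurable_box (p : E * E) : measurable (box p).
Proof.
rewrite (_ : box p = \bigcap_(i in [set: 'I_n.+1])
    ([set x | x 0 i <= p.2 0 i] `\` [set x | x 0 i <= p.1 0 i])).
  apply: fin_bigcap_measurable => [|i _]; first exact: finite_finset.
  by apply: measurableD; exact: measurable_halfspace.
apply/seteqP; split=> [x px i _|x px i].
  by have /andP[xl xu] := px i; split => //=; apply/negP; rewrite -ltNge.
by have [/= xu /negP] := px i Logic.I; rewrite -ltNge => ->.
Qed.

Lemma open_box_nbhs (U : set E) (x : E) : open U -> U x ->
  exists q : 'rV[rat]_n.+1 * 'rV[rat]_n.+1,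
    box (map_mx ratr q.1, map_mx ratr q.2) x /\
    box (map_mx ratr q.1, map_mx ratr q.2) `<=` U.
Proof.
move=> oU Ux; have /nbhs_ballP[e /= e0 eU] := open_nbhs_nbhs (conj oU Ux).
have lt1 i : x 0 i - e < x 0 i by rewrite ltrBlDr ltrDl.
have lt2 i : x 0 i < x 0 i + e by rewrite ltrDl.
have [q1 hq1] := choice (fun i => rat_in_itvoo (lt1 i)).
have [q2 hq2] := choice (fun i => rat_in_itvoo (lt2 i)).
exists (\row_i q1 i, \row_i q2 i); split => [i|y yq] /=.
  rewrite !mxE; move: (hq1 i) (hq2 i); rewrite !in_itv/=.
  by move=> /andP[_ ->] /andP[/ltW ->].
apply: eU; split => // j i; rewrite (ord1 j) /ball/= ltr_distlC.
have := yq i; rewrite !mxE/=.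
move: (hq1 i) (hq2 i); rewrite !in_itv/=.
by move=> /andP[? ?] /andP[? ?] /andP[? ?]; apply/andP; split; lra.
Qed.

Lemma open_measurable_rV (U : set E) : open U -> measurable U.
Proof.
move=> oU.
pose T := ('rV[rat]_n.+1 * 'rV[rat]_n.+1)%type.
pose b (q : T) : set E := box (map_mx ratr q.1, map_mx ratr q.2).
pose F (q : T) : set E := if `[< b q `<=` U >] then b q else set0.
rewrite (_ : U = \bigcup_q F q).
  apply: countable_bigcupT_measurable => [|q]; last rewrite /F.
    exact: (@countableP ('rV[rat]_n.+1 * 'rV[rat]_n.+1)%type).
  by case: asboolP => _ //; exact: measurable_box.
apply/seteqP; split=> [x /(open_box_nbhs oU)[q [qx qU]]|x [q _]].
  by exists q => //; rewrite /F asboolT.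
by rewrite /F; case: asboolP => // qU /qU.
Qed.

Lemma closed_measurable_rV (A : set E) : closed A -> measurable A.
Proof.
move=> cA; rewrite -(setCK A); apply: measurableC.
by apply: open_measurable_rV; exact: closed_openC.
Qed.

Lemma continuous_measurable_rV (f : E -> R) :
  continuous f -> measurable_fun setT f.
Proof.
move=> /continuousP cf; apply: (measurability _ (RGenOpens.measurableE R)) => //.
by move=> _ [_ [a [c ->] <-]]; rewrite setTI; apply: open_measurable_rV; exact: cf.
Qed.

(** Covers are transported box by box, so it is enough to control the image of a single box. *)
Lemma lebesgue_outer_image_le (phi : E -> E) (C : R) : 0 < C ->
  (forall p, exists2 p', phi @` box p `<=` box p' &
    (box_volume p' <= C%:E * box_volume p)%E) ->
  forall A, (lebesgue_outer (phi @` A) <= C%:E * lebesgue_outer A)%E.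
Proof.
move=> C0 H A; rewrite -lee_pdivrMl//.
apply: le_ereal_inf_tmp => _ [p Ap <-].
have [q hq vq] : exists2 q : nat -> E * E, forall k, phi @` box (p k) `<=` box (q k) &
    forall k, (box_volume (q k) <= C%:E * box_volume (p k))%E.
  have /choice[q hq] : forall k, exists p', phi @` box (p k) `<=` box p' /\
      (box_volume p' <= C%:E * box_volume (p k))%E.
    by move=> k; have [p' ? ?] := H (p k); exists p'.
  by exists q => k; have [] := hq k.
rewrite lee_pdivrMl// -nneseriesZl; last by move=> k _; exact: box_volume_ge0.
apply: (@le_trans _ _ (\sum_(k <oo) box_volume (q k))%E).
  apply: ereal_inf_lbound; exists q => // _ [x Ax <-].
  by have [k _ pk] := Ap _ Ax; exists k => //; apply: hq; exists x.
apply: lee_nneseries => [k _ _|k _]; first exact: box_volume_ge0.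
exact: vq.
Qed.

Lemma expr_ord (t : R) : t ^+ n.+1 = \prod_(i < n.+1) t.
Proof. by rewrite prodr_const card_ord. Qed.

Lemma lebesgue_outer_affine_le (x : E) (r : R) (A : set E) : 0 < r ->
  (lebesgue_outer [set (x + r *: y)%R | y in A] <=
    (r ^+ n.+1)%:E * lebesgue_outer A)%E.
Proof.
move=> r0; apply: lebesgue_outer_image_le; first by rewrite exprn_gt0.
move=> p; exists (x + r *: p.1, x + r *: p.2).
  move=> _ [y py <-] i; have /andP[l u] := py i.
  by rewrite !mxE ltrD2l lerD2l ltr_pM2l// ler_pM2l// l.
rewrite -EFinM lee_fin expr_ord -big_split/=.
apply: ler_prod => i _; rewrite le_max lexx/= !mxE.
by rewrite opprD addrACA subrr add0r -mulrBr -{1}(mulr0 r) maxr_pMr// ltW.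
Qed.

(** Reflection exchanges open and closed faces, so the image of a half-open box is put in one that
    is twice as wide. The resulting factor is harmless, since only null sets are reflected. *)
Lemma lebesgue_outer_opp_le (A : set E) :
  (lebesgue_outer [set (- y)%R | y in A] <=
    (2 ^+ n.+1)%:E * lebesgue_outer A)%E.
Proof.
apply: lebesgue_outer_image_le; first by rewrite exprn_gt0.
move=> p; exists (p.1 - 2 *: p.2, - p.1).
  move=> _ [y py <-] i; have /andP[l u] := py i.
  by rewrite !mxE; apply/andP; split; lra.
rewrite -EFinM lee_fin expr_ord -big_split/=.
apply: ler_prod => i _; rewrite le_max lexx/= !mxE.
rewrite (_ : - p.1 0 i - _ = 2 * (p.2 0 i - p.1 0 i)); last by ring.
by rewrite -{1}(mulr0 2) maxr_pMr.
Qed.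

Lemma lebesgue_outer_translate (x : E) (A : set E) :
  lebesgue_outer [set (x + y)%R | y in A] = lebesgue_outer A.
Proof.
have H (z : E) (B : set E) :
    (lebesgue_outer [set (z + y)%R | y in B] <= lebesgue_outer B)%E.
  have := lebesgue_outer_affine_le z B ltr01.
  rewrite expr1n mul1e (_ : (fun y => z + 1 *: y) = (fun y => z + y))//.
  by apply/funext => y; rewrite scale1r.
apply/eqP; rewrite eq_le H/= -{1}(_ : [set (- x + z)%R | z in [set (x + y)%R | y in A]] = A)//.
apply/seteqP; split=> [_ [_ [y Ay <-] <-]|y Ay]; first by rewrite addKr.
by exists (x + y); rewrite ?addKr//; exists y.
Qed.

Lemma measurable_translate (x : E) (A : set E) :
  measurable A -> measurable [set y | A (x + y)%R].
Proof.
move=> mA; apply: le_caratheodory_measurable => X /=.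
rewrite -(lebesgue_outer_translate x X) (mA [set (x + y)%R | y in X]).
rewrite -(lebesgue_outer_translate x (X `&` _)).
rewrite -(lebesgue_outer_translate x (X `&` ~` _)).
apply: leeD; apply: le_outer_measure.
- by move=> _ [y [Xy Ay] <-]; split => //; exists y.
- by move=> _ [y [Xy Ay] <-]; split => //; exists y.
Qed.

Lemma lebesgue_outer_affine_null (x : E) (r : R) (A : set E) : 0 < r ->
  lebesgue_outer A = 0%E ->
  lebesgue_outer [set (x + r *: y)%R | y in A] = 0%E.
Proof.
move=> r0 A0; apply/eqP; rewrite eq_le outer_measure_ge0 andbT.
by have := lebesgue_outer_affine_le x A r0; rewrite A0 mule0.
Qed.

Lemma lebesgue_outer_opp_null (A : set E) : lebesgue_outer A = 0%E ->
  lebesgue_outer [set (- y)%R | y in A] = 0%E.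
Proof.
move=> A0; apply/eqP; rewrite eq_le outer_measure_ge0 andbT.
by have := lebesgue_outer_opp_le A; rewrite A0 mule0.
Qed.

(** The Caratheodory sigma-algebra is complete. Almost everywhere statements thus become equations
    on [lebesgue_outer], for sets whose measurability is unknown. *)
Lemma negligible_outer (A : set E) : mu.-negligible A <-> lebesgue_outer A = 0%E.
Proof.
split=> [[B [mB B0 AB]]|A0].
  apply/eqP; rewrite eq_le outer_measure_ge0 andbT.
  by rewrite -[leRHS]B0; exact: le_outer_measure.
exists A; split => //; apply: le_caratheodory_measurable => X /=.
rewrite (_ : lebesgue_outer (X `&` A) = 0%E) ?add0e.
  by apply: le_outer_measure => y [].
apply/eqP; rewrite eq_le outer_measure_ge0 andbT -[leRHS]A0.
by apply: le_outer_measure => y [].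
Qed.

Lemma normr_le_enorm (x : E) i : `|x 0 i| <= enorm x.
Proof.
rewrite -sqrtr_sqr; apply: ler_wsqrtr; rewrite (bigD1 i)//= lerDl.
by apply: sumr_ge0 => j _; exact: sqr_ge0.
Qed.

Lemma enorm_le_sum (x : E) : enorm x <= \sum_i `|x 0 i|.
Proof.
have s0 : 0 <= \sum_i `|x 0 i| by apply: sumr_ge0.
rewrite -[leRHS](ger0_norm s0) -sqrtr_sqr; apply: ler_wsqrtr.
rewrite expr2 mulr_suml; apply: ler_sum => i _.
rewrite -real_normK ?num_real// expr2 ler_wpM2l//.
by rewrite (bigD1 i)//= lerDl; apply: sumr_ge0.
Qed.

Lemma enorm_ge0 (x : E) : 0 <= enorm x.
Proof. exact: sqrtr_ge0. Qed.

Lemma enorm_continuous : continuous (@enorm R n).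
Proof.
move=> x; apply: (@continuous_comp _ _ _ (fun x : E => \sum_i x 0 i ^+ 2) Num.sqrt).
  apply: continuous_big => [|i _ y]; first exact: add_continuous.
  have c : {for y, continuous (fun x : E => x 0 i)} by exact: coord_continuous.
  exact: (continuousM c c).
exact: sqrt_continuous.
Qed.

Lemma enormN (x : E) : enorm (- x) = enorm x.
Proof. by congr Num.sqrt; apply: eq_bigr => i _; rewrite mxE sqrrN. Qed.

Lemma enormZ (t : R) (x : E) : 0 <= t -> enorm (t *: x) = t * enorm x.
Proof.
move=> t0; rewrite /enorm -{2}(ger0_norm t0) -sqrtr_sqr -sqrtrM ?sqr_ge0//.
by congr Num.sqrt; rewrite mulr_sumr; apply: eq_bigr => i _; rewrite mxE exprMn.
Qed.

Lemma enorm_eq0 (x : E) : enorm x = 0 -> x = 0.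
Proof.
move=> x0; apply/rowP => i; rewrite mxE; apply/normr0_eq0/eqP.
by rewrite eq_le normr_ge0 andbT -x0 normr_le_enorm.
Qed.

Lemma measurable_eball (c : E) (r : R) : measurable (eball c r).
Proof.
apply: open_measurable_rV.
have cf : continuous (fun x : E => enorm (x - c)).
  move=> x; apply: (@continuous_comp _ _ _ (fun x : E => x - c) (@enorm R n)).
    exact: (cvgB cvg_id (cvg_cst c)).
  exact: enorm_continuous.
by move/continuousP : cf => /(_ [set t | t < r]); apply; exact: open_lt.
Qed.

End lebesgue_sets.

(** * Inequalities between real-valued integrals *)

Section real_integral.
Context d (T : measurableType d) (R : realType) (mu : {measure set T -> \bar R}).
Implicit Types (A B D : set T) (f g : T -> R).

Lemma integrable_const A (c : R) : measurable A -> (mu A < +oo)%E ->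
  mu.-integrable A (EFin \o cst c).
Proof.
move=> mA Aoo; apply: measurable_bounded_integrable => //.
exists `|c|; split; first exact: num_real.
by move=> x cx y _; exact: ltW.
Qed.

Lemma integrable_addf A f g : measurable A -> mu.-integrable A (EFin \o f) ->
  mu.-integrable A (EFin \o g) -> mu.-integrable A (EFin \o (fun x => f x + g x)).
Proof.
move=> mA /integrableD /[apply] -/(_ mA); exact: eq_integrable.
Qed.

Lemma integrable_subf A f g : measurable A -> mu.-integrable A (EFin \o f) ->
  mu.-integrable A (EFin \o g) -> mu.-integrable A (EFin \o (fun x => f x - g x)).
Proof.
move=> mA /integrableB /[apply] -/(_ mA); exact: eq_integrable.
Qed.

Lemma integrable_scalef A f (k : R) : measurable A -> mu.-integrable A (EFin \o f) ->
  mu.-integrable A (EFin \o (fun x => k * f x)).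
Proof.
move=> mA /integrableZl -/(_ mA k); exact: eq_integrable.
Qed.

Lemma Rintegral_subset A B f : measurable A -> measurable B ->
  mu.-integrable B (EFin \o f) -> (forall x, B x -> 0 <= f x) -> A `<=` B ->
  \int[mu]_(x in A) f x <= \int[mu]_(x in B) f x.
Proof.
move=> mA mB fB f0 AB; have fA := integrableS mB mA AB fB.
apply: fine_le; rewrite ?integrable_fin_num//.
by apply: ge0_subset_integral => //; have := measurable_int mu fB.
Qed.

Lemma ae_le_Rintegral D f g : measurable D ->
  mu.-integrable D (EFin \o f) -> mu.-integrable D (EFin \o g) ->
  {ae mu, forall x, D x -> 0 <= f x <= g x} ->
  \int[mu]_(x in D) f x <= \int[mu]_(x in D) g x.
Proof.
move=> mD fD gD fg.
(* The signs are known only almost everywhere, so both functions are replaced by their absolute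
   values before comparing. *)
have normE h : mu.-integrable D (EFin \o h) -> {ae mu, forall x, D x -> 0 <= h x} ->
    (\int[mu]_(x in D) (h x)%:E = \int[mu]_(x in D) (`|h x|)%:E)%E.
  move=> hD h0; apply: ae_eq_integral => //.
  - by have := measurable_int mu hD.
  - by have := measurable_int mu (integrable_norm hD).
  - by apply: filterS h0 => x h0 Dx; rewrite ger0_norm// h0.
have f0 : {ae mu, forall x, D x -> 0 <= f x}.
  by apply: filterS fg => x H Dx; have /andP[] := H Dx.
have g0 : {ae mu, forall x, D x -> 0 <= g x}.
  by apply: filterS fg => x H Dx; have /andP[/le_trans] := H Dx; apply.
rewrite /Rintegral (normE f)// (normE g)//; apply: fine_le.
- by have := integrable_fin_num mD (integrable_norm fD).
- by have := integrable_fin_num mD (integrable_norm gD).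
apply: ae_ge0_le_integral => //.
- by have := measurable_int mu (integrable_norm fD).
- by have := measurable_int mu (integrable_norm gD).
apply: filterS fg => x H Dx; have /andP[fx gx] := H Dx.
by rewrite lee_fin !ger0_norm// (le_trans fx).
Qed.

Lemma Rintegral_setU_le A B f : measurable A -> measurable B ->
  mu.-integrable (A `|` B) (EFin \o f) -> (forall x, 0 <= f x) ->
  \int[mu]_(x in A `|` B) f x <= \int[mu]_(x in A) f x + \int[mu]_(x in B) f x.
Proof.
move=> mA mB fAB f0; have mAB := measurableU _ _ mA mB.
have mDA : measurable (B `\` A) by exact: measurableD.
have fB := integrableS mAB mB (@subsetUr _ A B) fAB.
have E : A `|` (B `\` A) = A `|` B.
  apply/seteqP; split=> [x [|[? _]]|x [|Bx]]; [by left|by right|by left|].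
  by have [Ax|Ax] := pselect (A x); [left|right].
rewrite -{1}E Rintegral_setU//; last 2 first.
- by rewrite E.
- by apply/disj_setPS => x [Ax []].
by rewrite lerD2l; apply: Rintegral_subset => // x [].
Qed.

End real_integral.

(** * Means and oscillations over cubes *)

(* Unification must never unfold the means and norms below: without these
   locks a failing comparison of two of them is explored down to the
   definition of the integral. *)
Fact lock_key : unit. Proof. exact: tt. Qed.

Section cubes.
Variables (R : realType) (n : nat) (s : 'rV[R]_n.+1).
Local Notation E := 'rV[R]_n.+1.
Local Notation mu := (@leb R n).
Hypothesis s_gt0 : forall i, 0 < s 0 i.
Implicit Types (x y z : E) (r t u v a c d K M B : R) (f g : E -> R) (k : nat).

Definition cube (x : E) (r : R) : set E := box (x - r *: s, x + r *: s).

(** The maximum norm weighted by [s]: up to its boundary, [cube x r] is the ball of radius [r] for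
    it. *)
Definition wnorm : E -> R := locked_with lock_key
  (fun x => \big[Num.max/0]_i (`|x 0 i| / s 0 i)).

Lemma wnormE x : wnorm x = \big[Num.max/0]_i (`|x 0 i| / s 0 i).
Proof. by rewrite [wnorm]unlock. Qed.

Definition cvol : R -> R := locked_with lock_key
  (fun r => (\prod_i (2 * s 0 i)) * r ^+ n.+1).

Lemma cvolE r : cvol r = (\prod_i (2 * s 0 i)) * r ^+ n.+1.
Proof. by rewrite [cvol]unlock. Qed.

Lemma cubeP x r y : cube x r y <->
  forall i, x 0 i - r * s 0 i < y 0 i <= x 0 i + r * s 0 i.
Proof. by split=> h i; have := h i; rewrite /= !mxE. Qed.

Lemma measurable_cube x r : measurable (cube x r).
Proof. exact: measurable_box. Qed.

Lemma cvol_gt0 r : 0 < r -> 0 < cvol r.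
Proof.
by move=> r0; rewrite cvolE mulr_gt0 ?exprn_gt0//; apply: prodr_gt0 => i _; rewrite mulr_gt0.
Qed.

Lemma cvolM t r : cvol (t * r) = t ^+ n.+1 * cvol r.
Proof. by rewrite !cvolE exprMn mulrCA. Qed.

Lemma leb_cube x r : 0 <= r -> mu (cube x r) = (cvol r)%:E.
Proof.
move=> r0; rewrite /leb lebesgue_outer_box /box_volume; congr _%:E.
rewrite cvolE expr_ord -big_split/=; apply: eq_bigr => i _.
rewrite !mxE max_r; first by ring.
by have := s_gt0 i => si; rewrite subr_ge0 lerD2l ge0_cp// ?mulr_ge0// ltW.
Qed.

Lemma leb_cube_lty x r : (mu (cube x r) < +oo)%E.
Proof. by rewrite /leb lebesgue_outer_box ltry. Qed.

Lemma wnormP x t : 0 <= t -> (wnorm x <= t) <-> (forall i, `|x 0 i| <= t * s 0 i).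
Proof.
move=> t0; rewrite wnormE; split=> [/bigmax_leP[_ h] i|h].
  by rewrite -ler_pdivrMr// h.
by apply/bigmax_leP; split => // i _; rewrite ler_pdivrMr.
Qed.

Lemma wnorm_ge0 x : 0 <= wnorm x.
Proof. by rewrite wnormE; exact: bigmax_ge_id. Qed.

Lemma normr_le_wnorm x i : `|x 0 i| <= wnorm x * s 0 i.
Proof. exact: (wnormP x (wnorm_ge0 x)).1. Qed.

Lemma wnormD x y : wnorm (x + y) <= wnorm x + wnorm y.
Proof.
apply/wnormP => [|i]; first by rewrite addr_ge0 ?wnorm_ge0.
by rewrite mxE mulrDl (le_trans (ler_normD _ _))// lerD// normr_le_wnorm.
Qed.

Lemma wnormN x : wnorm (- x) = wnorm x.
Proof. by rewrite !wnormE; apply: eq_bigr => i _; rewrite mxE normrN. Qed.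

Lemma wnormB x y : wnorm (x - y) = wnorm (y - x).
Proof. by rewrite -wnormN opprB. Qed.

Lemma wnorm_triangle y x z : wnorm (x - z) <= wnorm (x - y) + wnorm (y - z).
Proof. by rewrite -(subrK y x) -[_ + y - z]addrA addrK wnormD. Qed.

Lemma wnorm0 : wnorm 0 = 0.
Proof.
apply/eqP; rewrite eq_le wnorm_ge0 andbT; apply/wnormP => // i.
by rewrite mxE normr0 mul0r.
Qed.

Lemma wnormZ (a : R) x : 0 <= a -> wnorm (a *: x) <= a * wnorm x.
Proof.
move=> a0; apply/wnormP => [|i]; first by rewrite mulr_ge0 ?wnorm_ge0.
by rewrite mxE normrM (ger0_norm a0) -mulrA ler_wpM2l// normr_le_wnorm.
Qed.

Lemma cube_wnorm x r y : 0 <= r -> cube x r y -> wnorm (y - x) <= r.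
Proof.
move=> r0 /cubeP xy; apply/wnormP => // i; rewrite !mxE ler_norml.
by have /andP[? ?] := xy i; apply/andP; split; lra.
Qed.

Lemma wnorm_cube x r y : wnorm (y - x) < r -> cube x r y.
Proof.
move=> yx; apply/cubeP => i; have := normr_le_wnorm (y - x) i.
rewrite !mxE ler_norml => /andP[l u].
have : wnorm (y - x) * s 0 i < r * s 0 i by rewrite ltr_pM2r.
by move=> ?; apply/andP; split; lra.
Qed.

Lemma cube_center x r : 0 < r -> cube x r x.
Proof. by move=> r0; apply: wnorm_cube; rewrite subrr wnorm0. Qed.

Lemma cube_sub x r y t : wnorm (x - y) + r <= t -> cube x r `<=` cube y t.
Proof.
move=> xyt z /cubeP xz; apply/cubeP => i.
have /andP[? ?] := xz i; have := normr_le_wnorm (x - y) i.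
rewrite !mxE ler_norml => /andP[? ?].
have : wnorm (x - y) * s 0 i <= (t - r) * s 0 i by apply: ler_wpM2r; [exact: ltW|lra].
by rewrite mulrBl => ?; apply/andP; split; lra.
Qed.

Lemma wnorm_le_enorm : exists2 c : R, 0 < c & forall x, wnorm x <= c * enorm x.
Proof.
exists (\sum_i (s 0 i)^-1) => [|x].
  rewrite big_ord_recl ltr_pwDl ?invr_gt0//.
  by apply: sumr_ge0 => i _; rewrite invr_ge0 ltW.
have c0 : 0 <= \sum_i (s 0 i)^-1 by apply: sumr_ge0 => i _; rewrite invr_ge0 ltW.
apply/wnormP => [|i]; first by rewrite mulr_ge0 ?enorm_ge0.
rewrite mulrAC (le_trans (normr_le_enorm x i))// ler_peMl ?enorm_ge0//.
rewrite mulr_suml (bigD1 i)//= mulVf ?gt_eqF// lerDl.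
by apply: sumr_ge0 => j _; rewrite mulr_ge0 ?invr_ge0// ltW.
Qed.

Lemma enorm_le_wnorm : exists2 c : R, 0 < c & forall x, enorm x <= c * wnorm x.
Proof.
exists (\sum_i (s 0 i)) => [|x].
  by rewrite big_ord_recl ltr_pwDl//; apply: sumr_ge0 => i _; rewrite ltW.
rewrite (le_trans (enorm_le_sum x))// mulr_suml; apply: ler_sum => i _.
by rewrite mulrC normr_le_wnorm.
Qed.

Definition locint (f : E -> R) := forall x r, mu.-integrable (cube x r) (EFin \o f).

Lemma locally_integrable_locint f : locally_integrable_rV f -> locint f.
Proof.
move=> [mf fK] x r.
pose K : set E := [set y | forall i, (y ord0 i) \in `[(x - r *: s) 0 i, (x + r *: s) 0 i]].
have cK : compact K.
  apply: (@rV_compact _ _ (fun i => `[(x - r *: s) 0 i, (x + r *: s) 0 i]%classic)).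
  by move=> i; exact: segment_compact.
have mK : measurable K.
  apply: closed_measurable_rV; apply: compact_closed cK.
  exact: norm_hausdorff.
apply: (@integrableS _ _ _ mu K) => //; first exact: measurable_cube.
  move=> y xy i; rewrite in_itv/=.
  by have /andP[/ltW -> ->] := xy i.
apply/integrableP; split; last exact: fK.
by apply/measurable_EFinP; exact: measurable_funTS.
Qed.

Lemma locint_measurable f : locint f -> measurable_fun setT f.
Proof.
move=> fl; rewrite (_ : setT = \bigcup_k cube 0 k%:R).
  apply/measurable_fun_bigcup => [k|k]; first exact: measurable_cube.
  by apply/measurable_EFinP; have := measurable_int mu (fl 0 k%:R).
apply/seteqP; split=> // x _; exists (Num.truncn (wnorm x)).+1 => //.
by apply: wnorm_cube; rewrite subr0 truncnS_gt.
Qed.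

Lemma locintB f g : locint f -> locint g -> locint (fun x => f x - g x).
Proof. by move=> fl gl x r; apply: integrable_subf => //; exact: measurable_cube. Qed.

Lemma locintD f g : locint f -> locint g -> locint (fun x => f x + g x).
Proof. by move=> fl gl x r; apply: integrable_addf => //; exact: measurable_cube. Qed.

Lemma locint_cst c : locint (fun=> c).
Proof.
move=> x r; apply: integrable_const; first exact: measurable_cube.
exact: leb_cube_lty.
Qed.

Lemma locint_norm f : locint f -> locint (fun x => `|f x|).
Proof. by move=> fl x r; have := integrable_norm (fl x r). Qed.

Lemma locint_dist f c : locint f -> locint (fun x => `|f x - c|).
Proof. by move=> fl; apply: locint_norm; apply: locintB => //; exact: locint_cst. Qed.

Lemma locint_le f g : locint g -> measurable_fun setT f ->
  (forall x, `|f x| <= `|g x|) -> locint f.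
Proof.
move=> gl mf fg x r; apply: le_integrable (gl x r) => //; first exact: measurable_cube.
  by apply/measurable_EFinP; exact: measurable_funTS.
by move=> y _; rewrite /= lee_fin.
Qed.

Definition mean : (E -> R) -> E -> R -> R := locked_with lock_key
  (fun f x r => (cvol r)^-1 * \int[mu]_(y in cube x r) f y).

Lemma meanE f x r : mean f x r = (cvol r)^-1 * \int[mu]_(y in cube x r) f y.
Proof. by rewrite [mean]unlock. Qed.

(** The constant is free because the useful one is often a mean over another cube; by [osc_le], any
    choice bounds [osc] up to a factor 2. *)
Definition dev : (E -> R) -> R -> E -> R -> R := locked_with lock_key
  (fun f c x r => (cvol r)^-1 * \int[mu]_(y in cube x r) `|f y - c|).

Lemma devE f c x r :
  dev f c x r = (cvol r)^-1 * \int[mu]_(y in cube x r) `|f y - c|.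
Proof. by rewrite [dev]unlock. Qed.

Definition osc (f : E -> R) x r : R := dev f (mean f x r) x r.

Lemma oscE f x r : osc f x r = dev f (mean f x r) x r. Proof. by []. Qed.

Lemma dev_ge0 f c x r : 0 < r -> 0 <= dev f c x r.
Proof.
move=> r0; rewrite devE mulr_ge0 ?invr_ge0 ?(ltW (cvol_gt0 r0))//.
by apply: Rintegral_ge0.
Qed.

Lemma dev_eq f c x r : 0 < r ->
  \int[mu]_(y in cube x r) `|f y - c| = cvol r * dev f c x r.
Proof. by move=> r0; rewrite devE mulrA divff ?mul1r// gt_eqF// cvol_gt0. Qed.

Lemma Rintegral_cube_cst c x r : 0 < r -> \int[mu]_(y in cube x r) c = c * cvol r.
Proof.
move=> r0; rewrite Rintegral_cst; last exact: measurable_cube.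
by congr (_ * _); exact: (congr1 fine (leb_cube x (ltW r0))).
Qed.

Lemma le_dev_fun f g c d x r : locint f -> locint g -> 0 < r ->
  (forall y, cube x r y -> `|f y - c| <= `|g y - d|) -> dev f c x r <= dev g d x r.
Proof.
move=> fl gl r0 h; rewrite !devE ler_wpM2l ?invr_ge0 ?(ltW (cvol_gt0 r0))//.
apply: le_Rintegral => //; first exact: measurable_cube.
- exact: locint_dist.
- exact: locint_dist.
Qed.

Lemma dev_add f g c d x r : locint f -> locint g -> 0 < r ->
  dev (fun y => f y + g y) (c + d) x r <= dev f c x r + dev g d x r.
Proof.
move=> fl gl r0; rewrite !devE -mulrDr ler_wpM2l ?invr_ge0 ?(ltW (cvol_gt0 r0))//.
rewrite -RintegralD; last 3 first.
- exact: measurable_cube.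
- exact: locint_dist.
- exact: locint_dist.
apply: le_Rintegral; first exact: measurable_cube.
- by apply: locint_dist; exact: locintD.
- by apply: locintD; exact: locint_dist.
by move=> y _; rewrite opprD addrACA ler_normD.
Qed.

Lemma dev_cst a c x r : 0 < r -> dev (fun=> a) c x r = `|a - c|.
Proof.
by move=> r0; rewrite devE Rintegral_cube_cst// mulrC mulfK// gt_eqF// cvol_gt0.
Qed.

Lemma dev_le_bound f c x r B : locint f -> 0 < r ->
  (forall y, cube x r y -> `|f y - c| <= B) -> dev f c x r <= B.
Proof.
move=> fl r0 h.
have B0 : 0 <= B by rewrite (le_trans _ (h x (cube_center _ r0))).
rewrite -[leRHS](ger0_norm B0) -[in leRHS](subr0 B) -(dev_cst B 0 x r0).
apply: le_dev_fun => //; first exact: locint_cst.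
by move=> y /h; rewrite subr0 (ger0_norm B0).
Qed.

Lemma dev_shift f c d x r : locint f -> 0 < r -> dev f d x r <= dev f c x r + `|c - d|.
Proof.
move=> fl r0; rewrite -(dev_cst c d x r0).
have := @dev_add (fun y => f y - c) (fun=> c) 0 d x r.
rewrite add0r (_ : (fun y => f y - c + c) = f); last by apply/funext => y; rewrite subrK.
rewrite (_ : dev (fun y => f y - c) 0 x r = dev f c x r); last first.
  by rewrite !devE; congr (_ * _); apply: eq_Rintegral => y _; rewrite subr0.
apply => //.
  apply: locintB => //; exact: locint_cst.
exact: locint_cst.
Qed.

Lemma mean_dev f c x r : locint f -> 0 < r -> `|mean f x r - c| <= dev f c x r.
Proof.
move=> fl r0; have v0 := cvol_gt0 r0.
have -> : mean f x r - c = (cvol r)^-1 * \int[mu]_(y in cube x r) (f y - c).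
  rewrite RintegralB//; last 2 first.
  - exact: measurable_cube.
  - exact: locint_cst.
  by rewrite Rintegral_cube_cst// mulrBr meanE; congr (_ - _); rewrite mulrC mulfK// gt_eqF.
rewrite devE normrM gtr0_norm ?invr_gt0// ler_wpM2l ?invr_ge0 ?(ltW v0)//.
apply: le_normr_Rintegral; first exact: measurable_cube.
by apply: locintB => //; exact: locint_cst.
Qed.

Lemma osc_le f c x r : locint f -> 0 < r -> osc f x r <= 2 * dev f c x r.
Proof.
move=> fl r0; rewrite (le_trans (dev_shift c _ _ fl r0))// mulr2n mulrDl mul1r lerD2l.
by rewrite distrC mean_dev.
Qed.

Lemma le_dev f c x r y t K : locint f -> 0 < r -> cube x r `<=` cube y t ->
  0 < t -> t <= K * r -> dev f c x r <= K ^+ n.+1 * dev f c y t.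
Proof.
move=> fl r0 sub t0 tr.
rewrite -(ler_pM2l (cvol_gt0 r0)) -dev_eq// mulrA [_ * _ ^+ _]mulrC -cvolM.
have K0 : 0 < K by rewrite -(pmulr_lgt0 _ r0) (lt_le_trans t0).
have le1 : \int[mu]_(z in cube x r) `|f z - c| <= \int[mu]_(z in cube y t) `|f z - c|.
  by apply: Rintegral_subset => //; [exact: measurable_cube|exact: measurable_cube|
     exact: locint_dist].
rewrite (le_trans le1)// dev_eq// ler_wpM2r ?dev_ge0//.
rewrite !cvolE ler_wpM2l//; first by apply: prodr_ge0 => i _; rewrite mulr_ge0 ?ltW.
by rewrite lerXn2r// ?nnegrE ltW// mulr_gt0.
Qed.

Lemma mean_sub f x r y t K : locint f -> 0 < r -> cube x r `<=` cube y t ->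
  0 < t -> t <= K * r -> `|mean f x r - mean f y t| <= K ^+ n.+1 * osc f y t.
Proof.
move=> fl r0 sub t0 tr; rewrite (le_trans (mean_dev _ _ fl r0))//.
exact: le_dev.
Qed.

(** Each doubling moves the mean by at most the ratio of volumes times the oscillation on the larger
    cube. The linear growth in [k] is the loss to be compensated later. *)
Lemma mean_chain f x r k M : locint f -> 0 < r ->
  (forall i, (0 < i <= k)%N -> osc f x (2 ^+ i * r) <= M) ->
  `|mean f x r - mean f x (2 ^+ k * r)| <= k%:R * 2 ^+ n.+1 * M.
Proof.
move=> fl r0; elim: k => [|k IH] h; first by rewrite mul1r subrr normr0 !mul0r.
have p0 : 0 < 2 ^+ k * r by rewrite mulr_gt0 ?exprn_gt0.
have {}IH : `|mean f x r - mean f x (2 ^+ k * r)| <= k%:R * 2 ^+ n.+1 * M.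
  by apply: IH => i /andP[i0 ik]; apply: h; rewrite i0 ltnW.
have step : `|mean f x (2 ^+ k * r) - mean f x (2 ^+ k.+1 * r)| <= 2 ^+ n.+1 * M.
  rewrite (le_trans (@mean_sub _ _ _ x (2 ^+ k.+1 * r) 2 fl p0 _ _ _))//.
  - by apply: cube_sub; rewrite subrr wnorm0 add0r exprS -mulrA ler_peMl ?ltW// ltr1n.
  - by rewrite mulr_gt0 ?exprn_gt0.
  - by rewrite exprS -mulrA.
  - by rewrite ler_wpM2l ?exprn_ge0// h/=.
rewrite (le_trans (ler_distD (mean f x (2 ^+ k * r)) _ _))//.
by rewrite -(natr1 k) !mulrDl mul1r; exact: lerD.
Qed.

(** The cubes around [x] are doubled until comparable with [t], then a cube around [y] containing
    both ends is used as an intermediary: at most [k] doublings and two comparisons, each costing at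
    most [4 ^+ n.+1 * M]. *)
Lemma mean_nested f x r y t k M : locint f -> 0 < r -> r <= t ->
  wnorm (x - y) <= t -> t <= 2 ^+ k * r ->
  (forall z u, 0 < u -> osc f z u <= M) ->
  `|mean f x r - mean f y t| <= (k.+2)%:R * 4 ^+ n.+1 * M.
Proof.
move=> fl r0 rt xy; have t0 := lt_le_trans r0 rt.
move=> + h; have M0 : 0 <= M by rewrite (le_trans _ (h x r r0))// dev_ge0.
have chain m : `|mean f x r - mean f x (2 ^+ m * r)| <= m%:R * 2 ^+ n.+1 * M.
  by apply: mean_chain => // i _; apply: h; rewrite mulr_gt0 ?exprn_gt0.
have sub2 z u v : 0 < u -> cube z u `<=` cube y v -> 0 < v -> v <= 2 * u ->
    `|mean f z u - mean f y v| <= 2 ^+ n.+1 * M.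
  move=> u0 uv v0 vu; rewrite (le_trans (mean_sub fl u0 uv v0 vu))//.
  by rewrite ler_wpM2l ?exprn_ge0// h.
have sub4 z u v : 0 < u -> cube z u `<=` cube y v -> 0 < v -> v <= 4 * u ->
    `|mean f z u - mean f y v| <= 4 ^+ n.+1 * M.
  move=> u0 uv v0 vu; rewrite (le_trans (mean_sub fl u0 uv v0 vu))//.
  by rewrite ler_wpM2l ?exprn_ge0// h.
have c24 : 2 ^+ n.+1 * M <= 4 ^+ n.+1 * M.
  by rewrite ler_wpM2r// lerXn2r ?nnegrE// ler_nat.
have c2 : 0 <= 2 ^+ n.+1 * M by rewrite mulr_ge0 ?exprn_ge0.
move: chain sub2 sub4 c24 c2; rewrite -mulrA.
under [X in X -> _]eq_forall do rewrite -mulrA.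
move: (2 ^+ n.+1 * M) (4 ^+ n.+1 * M) => A B chain sub2 sub4 AB A0.
elim: k => [|k IH] tk.
  rewrite expr0 mul1r in tk.
  have tt0 : 0 < 2 * t by lra.
  have s1 : cube x r `<=` cube y (2 * t) by apply: cube_sub; lra.
  have s2 : cube y t `<=` cube y (2 * t) by apply: cube_sub; rewrite subrr wnorm0; lra.
  have e1 := sub2 x r (2 * t) r0 s1 tt0 ltac:(lra).
  have := sub2 y t (2 * t) t0 s2 tt0 (lexx _); rewrite distrC => e2.
  have := ler_distD (mean f y (2 * t)) (mean f x r) (mean f y t).
  by lra.
have [/IH|kt] := leP t (2 ^+ k * r).
  move=> /le_trans; apply; rewrite ler_wpM2r ?ler_nat//.
  exact: le_trans A0 AB.
(* With [v] for [2 ^+ k * r], one has v < t <= 2 v: the chain at [x] goes up to radius 2 v, and the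
   cube at [y] of radius 4 v contains its last member as well as [cube y t]. *)
have := chain k.+1; move: tk; rewrite exprS -mulrA; move: (2 ^+ k * r) kt => v vt tk e0.
have v0 : 0 < v by lra.
have s1 : cube x (2 * v) `<=` cube y (2 * (2 * v)) by apply: cube_sub; lra.
have s2 : cube y t `<=` cube y (2 * (2 * v)).
  by apply: cube_sub; rewrite subrr wnorm0; lra.
have e1 := sub2 x (2 * v) (2 * (2 * v)) ltac:(lra) s1 ltac:(lra) (lexx _).
have := sub4 y t (2 * (2 * v)) t0 s2 ltac:(lra) ltac:(lra); rewrite distrC => e2.
have d1 := ler_distD (mean f x (2 * v)) (mean f x r) (mean f y t).
have d2 := ler_distD (mean f y (2 * (2 * v))) (mean f x (2 * v)) (mean f y t).
have kAB : k.+1%:R * A <= k.+1%:R * B by rewrite ler_wpM2l.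
have -> : k.+3%:R * B = k.+1%:R * B + B + B by rewrite -!natr1; ring.
by lra.
Qed.

End cubes.

(** * Norms of indicators of cubes *)

Section ball_banach.
Variables (R : realType) (n : nat) (s : 'rV[R]_n.+1).
Local Notation E := 'rV[R]_n.+1.
Local Notation mu := (@leb R n).
Hypothesis s_gt0 : forall i, 0 < s 0 i.
Variable X : normedFunctionSpace R n.
Hypothesis bX : is_ball_banach X.
Hypothesis maxX : maximal_bounded X.
Implicit Types (x y z : E) (r t u : R) (f g : E -> R) (k : nat).
Local Notation cube := (cube s).
Local Notation cvol := (cvol s).

Lemma cube_sub_eball : exists2 c : R, 0 < c & forall x r, 0 < r ->
  cube x r `<=` eball x (c * r).
Proof.
have [c c0 h] := enorm_le_wnorm s_gt0.
exists (2 * c) => [|x r r0 y /(cube_wnorm s_gt0 (ltW r0)) xy]; first by rewrite mulr_gt0.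
rewrite /eball/= (le_lt_trans (h _))// (@le_lt_trans _ _ (c * r))//.
  by rewrite ler_wpM2l// ltW.
by rewrite -mulrA mulr_natl mulr2n ltrDl mulr_gt0.
Qed.

Lemma eball_sub_cube : exists2 c : R, 0 < c & forall x r, 0 < r ->
  eball x r `<=` cube x (c * r).
Proof.
have [c c0 h] := wnorm_le_enorm s_gt0.
exists c => // x r r0 y xy; apply: wnorm_cube => //.
by rewrite (le_lt_trans (h _))// ltr_pM2l.
Qed.

(** The maximal function runs over Euclidean balls; a ball containing the cube, of comparable
    volume, is a competitor at every point of the cube. *)
Lemma maximal_ge : exists2 c : R, 0 < c & forall f x r y, measurable_fun setT f ->
  0 < r -> cube x r y ->
  ((c / cvol r)%:E * \int[mu]_(z in cube x r) `|f z|%:E <= maximal f y)%E.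
Proof.
have [c c0 hc] := cube_sub_eball; have [e e0 he] := eball_sub_cube.
exists ((e * c) ^+ n.+1)^-1; first by rewrite invr_gt0 exprn_gt0// mulr_gt0.
move=> f x r y mf r0 xy.
have cr0 : 0 < c * r by rewrite mulr_gt0.
have Dle : (mu (eball x (c * r)) <= (cvol (e * (c * r)))%:E)%E.
  rewrite -(leb_cube s_gt0 x) ?(ltW (mulr_gt0 e0 cr0))//.
  by apply: le_measure; rewrite ?inE; [exact: measurable_eball|exact: measurable_cube|exact: he].
have Dge : ((cvol r)%:E <= mu (eball x (c * r)))%E.
  rewrite -(leb_cube s_gt0 x (ltW r0)).
  by apply: le_measure; rewrite ?inE; [exact: measurable_cube|exact: measurable_eball|exact: hc].
have Dfin : mu (eball x (c * r)) \is a fin_num.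
  by rewrite ge0_fin_numE// (le_lt_trans Dle)// ltry.
have D0 : 0 < fine (mu (eball x (c * r))).
  by rewrite -lte_fin fineK// (lt_le_trans _ Dge)// lte_fin cvol_gt0.
apply: le_trans (ereal_sup_ubound _); last first.
  by exists (x, c * r) => //; split => //; exact: hc.
have mfE A : measurable A -> measurable_fun A (fun z => `|f z|%:E).
  move=> mA; apply/measurable_EFinP/measurableT_comp => //.
  exact: measurable_funTS.
apply: lee_pmul => //.
- by rewrite lee_fin divr_ge0// ?invr_ge0 ?exprn_ge0 ?mulr_ge0 ?ltW ?cvol_gt0.
- exact: integral_ge0.
- rewrite lee_fin -invfM lef_pV2 ?posrE//.
    by rewrite -lee_fin fineK// -cvolM -mulrA.
  by rewrite mulr_gt0 ?exprn_gt0 ?mulr_gt0 ?cvol_gt0.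
- apply: ge0_subset_integral => //; [exact: measurable_cube|exact: measurable_eball| |exact: hc].
  by apply: mfE; exact: measurable_eball.
Qed.

Lemma lattice_le f g : measurable_fun setT g ->
  {ae mu, forall x, `|g x| <= `|f x|} -> (X g <= X f)%E.
Proof. exact: ball_banach_lattice bX f g. Qed.

Lemma fnorm_fin f : (X f < +oo)%E -> X f \is a fin_num.
Proof. by move=> ?; rewrite ge0_fin_numE// fnorm_ge0. Qed.

Lemma fnorm_cube_lty x r : (X \1_(cube x r) < +oo)%E.
Proof.
have [c c0 hc] := cube_sub_eball; pose t := Num.max r 1.
have t0 : 0 < t by rewrite lt_max ltr01 orbT.
apply: le_lt_trans (ball_banach_indic bX x (mulr_gt0 c0 t0)).
apply: lattice_le; first exact/(measurable_indic _)/measurable_cube.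
apply: aeW => y; rewrite !indicE !ger0_norm// ler_nat.
have [/set_mem xy|//] := boolP (y \in cube x r).
rewrite [X in (_ <= nat_of_bool X)%N]mem_set//; apply: hc => //.
by apply: (cube_sub s_gt0) xy; rewrite subrr wnorm0// add0r le_max lexx.
Qed.

Definition ncube x r : R := fine (X \1_(cube x r)).

Lemma ncubeE x r : X \1_(cube x r) = (ncube x r)%:E.
Proof. by rewrite fineK// fnorm_fin// fnorm_cube_lty. Qed.

Lemma ncube_ge0 x r : 0 <= ncube x r.
Proof. by rewrite fine_ge0// fnorm_ge0. Qed.

Lemma ncube_gt0 x r : 0 < r -> 0 < ncube x r.
Proof.
move=> r0; rewrite lt_neqAle ncube_ge0 andbT; apply/eqP => N0.
have := ncubeE x r; rewrite -N0 => /(ball_banach_eq0 bX)[A [mA A0 hA]].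
have : (mu (cube x r) <= mu A)%E.
  apply: le_measure; rewrite ?inE//; first exact: measurable_cube.
  move=> y xy; apply: hA => /=; rewrite indicE.
  by rewrite mem_set// => /eqP; rewrite oner_eq0.
by rewrite A0 leNgt leb_cube ?(ltW r0)// lte_fin cvol_gt0.
Qed.

Lemma ncube_le x r y t : cube x r `<=` cube y t -> ncube x r <= ncube y t.
Proof.
move=> xy; rewrite -lee_fin -!ncubeE; apply: lattice_le.
  exact/(measurable_indic _)/measurable_cube.
apply: aeW => z; rewrite !indicE !ger0_norm// ler_nat.
have [/set_mem/xy yz|//] := boolP (z \in cube x r).
by rewrite [X in (_ <= nat_of_bool X)%N]mem_set.
Qed.

Lemma fnorm_locint f : (X f < +oo)%E -> locint s f.
Proof.
move=> fX x r; have [c c0 hc] := cube_sub_eball; pose t := Num.max r 1.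
have t0 : 0 < t by rewrite lt_max ltr01 orbT.
have sub : cube x r `<=` eball x (c * t).
  move=> y xy; apply: hc => //.
  by apply: (cube_sub s_gt0) xy; rewrite subrr wnorm0// add0r le_max lexx.
have [C C0 hC] := ball_banach_integral bX x (mulr_gt0 c0 t0).
apply: (integrableS (measurable_eball x (c * t))) => //; first exact: measurable_cube.
apply/integrableP; split.
  by apply/measurable_EFinP; apply: measurable_funTS; exact: fnorm_measurable fX.
by rewrite (le_lt_trans (hC f fX))// -(fineK (fnorm_fin fX)) -EFinM ltry.
Qed.

Lemma Rintegral_EFin f x r : locint s f ->
  (\int[mu]_(z in cube x r) `|f z|%:E = (\int[mu]_(z in cube x r) `|f z|)%:E)%E.
Proof.
move=> fl; rewrite fineK//.
by have := integrable_fin_num (measurable_cube s x r) (integrable_norm (fl x r)).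
Qed.

(** M f is at least a multiple of the mean of |f| on the whole cube, so the boundedness of M bounds
    this mean times the norm of the indicator. This replaces Hoelder's inequality together with the
    Muckenhoupt type bound on ||1_Q||_X ||1_Q||_X'. *)
Lemma maximal_average : exists2 C : R, 0 < C & forall f x r, (X f < +oo)%E ->
  0 < r -> (\int[mu]_(z in cube x r) `|f z|) * ncube x r <= C * cvol r * fine (X f).
Proof.
have [c c0 hc] := maximal_ge; have [D D0 hD] := maxX.
exists (D / c); first by rewrite divr_gt0.
move=> f x r fX r0; have [g gM gX] := hD f fX.
have fl := fnorm_locint fX; have mf := fnorm_measurable fX.
set I := \int[mu]_(z in cube x r) `|f z|.
have I0 : 0 <= I by apply: Rintegral_ge0.
have v0 := cvol_gt0 s_gt0 r0.
pose a := c / cvol r * I.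
have a0 : 0 <= a by rewrite mulr_ge0// divr_ge0// ltW.
have aN : (X (fun y => (a * \1_(cube x r) y)%R) <= X g)%E.
  apply: lattice_le.
    by apply: measurable_funM => //; exact/(measurable_indic _)/measurable_cube.
  apply: filterS gM => y gy; rewrite indicE.
  have [/set_mem xy|_] := boolP (y \in cube x r); last by rewrite mulr0 normr0.
  rewrite mulr1 (ger0_norm a0) (le_trans _ (ler_norm _))//.
  by rewrite -lee_fin gy EFinM -/I -Rintegral_EFin// hc.
have := le_trans aN gX.
rewrite fnormZ ?fnorm_cube_lty// ncubeE -(fineK (fnorm_fin fX)) -!EFinM lee_fin.
rewrite (ger0_norm a0) /a => h.
have := ler_wpM2l (ltW (divr_gt0 v0 c0)) h.
rewrite [X in X <= _](_ : _ = I * ncube x r); last first.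
  by field; rewrite ?gt_eqF.
by move=> /le_trans; apply; rewrite le_eqVlt; apply/orP; left; apply/eqP; field; rewrite gt_eqF.
Qed.

Lemma Rintegral_indic_cube x r y t : 0 < r -> cube x r `<=` cube y t ->
  \int[mu]_(z in cube y t) (\1_(cube x r) z : R) = cvol r.
Proof.
move=> r0 xy; rewrite /Rintegral integral_indic; [|exact: measurable_cube..].
by rewrite setIidl//; exact: (congr1 fine (leb_cube s_gt0 x (ltW r0))).
Qed.

(** This is [maximal_average] for the indicator of the smaller cube, whose mean over the larger one
    is the ratio of the volumes. *)
Lemma ncube_doubling : exists2 C : R, 0 < C & forall x r y t K, 0 < r ->
  cube x r `<=` cube y t -> 0 < t -> t <= K * r ->
  ncube y t <= C * K ^+ n.+1 * ncube x r.
Proof.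
have [C C0 hC] := maximal_average; exists C => // x r y t K r0 xy t0 tK.
have v0 := cvol_gt0 s_gt0 r0.
have K0 : 0 < K by rewrite -(pmulr_lgt0 _ r0) (lt_le_trans t0).
have := hC _ y t (fnorm_cube_lty x r) t0.
under eq_Rintegral do rewrite ger0_norm//.
rewrite Rintegral_indic_cube// ncubeE/= => h.
rewrite -(ler_pM2l v0) (le_trans h)// -!mulrA (mulrCA _ C) ler_pM2l//.
rewrite mulrA ler_wpM2r ?ncube_ge0// [_ * _ ^+ _]mulrC -cvolM.
rewrite !cvolE ler_wpM2l//; first by apply: prodr_ge0 => i _; rewrite mulr_ge0 ?ltW.
by rewrite lerXn2r// ?nnegrE ltW// mulr_gt0.
Qed.

End ball_banach.

Section growth.
Variables (R : realType) (n : nat) (s : 'rV[R]_n.+1).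
Local Notation E := 'rV[R]_n.+1.
Local Notation mu := (@leb R n).
Hypothesis s_gt0 : forall i, 0 < s 0 i.
Variable X : normedFunctionSpace R n.
Hypothesis bX : is_ball_banach X.
Hypothesis maxX : maximal_bounded X.
Implicit Types (x y z : E) (r t u : R) (f g : E -> R) (k : nat).
Local Notation cube := (cube s).
Local Notation cvol := (cvol s).
Local Notation ncube := (ncube s X).

(** The mean of the indicator of [cube x r] over the [i]-th dyadic dilate. *)
Let a (i : nat) : R := (2 ^+ i) ^- n.+1.

Let a_gt0 i : 0 < a i.
Proof. by rewrite invr_gt0 !exprn_gt0. Qed.

Let aS i : 2 * a i.+1 <= a i.
Proof.
rewrite /a [2 ^+ i.+1]exprS exprMn invfM mulrA.
rewrite ler_piMl ?invr_ge0 ?exprn_ge0//.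
by rewrite -ler_pdivlMr ?invr_gt0 ?exprn_gt0// div1r invrK exprS ler_peMr// exprn_ege1// ler1n.
Qed.

Let a_vol i r : 0 < r -> a i * cvol (2 ^+ i * r) = cvol r.
Proof. by move=> r0; rewrite cvolM mulrA mulVf ?mul1r// gt_eqF// !exprn_gt0. Qed.

Let layers x r k : E -> R := fun y => \sum_(i < k.+1) a i * \1_(cube x (2 ^+ i * r)) y.

Let dyadic_sub x r i j : 0 < r -> (i <= j)%N ->
  cube x (2 ^+ i * r) `<=` cube x (2 ^+ j * r).
Proof.
move=> r0 ij; apply: cube_sub => //; rewrite subrr wnorm0// add0r; apply: ler_wpM2r; first exact: ltW.
by rewrite ler_weXn2l// ler1n.
Qed.

(** At a given point only the layers from some index on are active, and their coefficients at least
    halve at each step, so their sum is at most twice the first. Subtracting [a k] makes the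
    induction close. *)
Let layers_le x r k y (G : R) : 0 < r -> cube x (2 ^+ k * r) y ->
  (forall i, (i <= k)%N -> cube x (2 ^+ i * r) y -> a i <= G) ->
  layers x r k y <= 2 * G - a k.
Proof.
move=> r0; rewrite /layers; elim: k => [|k IH] xy h.
  rewrite big_ord1 indicE mem_set// mulr1.
  by have := h 0%N (leqnn _) xy; lra.
rewrite big_ord_recr/= indicE mem_set// mulr1.
have ak := aS k.
have [yk|yk] := pselect (cube x (2 ^+ k * r) y).
  have := IH yk (fun i ik => h i (leqW ik)); lra.
rewrite big1 ?add0r; first by have := h k.+1 (leqnn _) xy; lra.
move=> i _; rewrite indicE memNset ?mulr0//.
by move=> /(dyadic_sub r0 (ltn_ord i : (i <= k)%N)).
Qed.

Let layers_int x r k : 0 < r -> locint s (layers x r k) /\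
  forall j, (k <= j)%N ->
  \int[mu]_(y in cube x (2 ^+ j * r)) layers x r k y = k.+1%:R * cvol r.
Proof.
move=> r0.
have il i : locint s (fun y => a i * (\1_(cube x (2 ^+ i * r)) y : R)).
  move=> z t; apply: integrable_scalef; first exact: measurable_cube.
  by apply: (fnorm_locint s_gt0 bX); exact: (fnorm_cube_lty s_gt0 bX).
have ii i j : (i <= j)%N ->
    \int[mu]_(y in cube x (2 ^+ j * r)) (a i * (\1_(cube x (2 ^+ i * r)) y : R)) = cvol r.
  move=> ij; rewrite RintegralZl; last 2 first.
  - exact: measurable_cube.
  - by apply: (fnorm_locint s_gt0 bX); exact: (fnorm_cube_lty s_gt0 bX).
  rewrite (Rintegral_indic_cube s_gt0) ?a_vol ?mulr_gt0 ?exprn_gt0//.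
  exact: dyadic_sub.
elim: k => [|k [IHl IH]].
  rewrite (_ : layers x r 0 = fun y => a 0 * (\1_(cube x (2 ^+ 0 * r)) y : R)).
    by split => // j j0; rewrite ii// mul1r.
  by apply/funext => y; rewrite /layers big_ord1.
rewrite (_ : layers x r k.+1 = fun y => layers x r k y +
    a k.+1 * (\1_(cube x (2 ^+ k.+1 * r)) y : R)); last first.
  by apply/funext => y; rewrite /layers big_ord_recr.
split=> [|j kj]; first by apply: locintD => //; exact: il.
rewrite RintegralD; last 3 first.
- exact: measurable_cube.
- exact: IHl.
- exact: il.
by rewrite IH ?ii// ?(ltnW kj)// -(natr1 k.+1) mulrDl mul1r.
Qed.

(* A logarithmic gain: M 1_B dominates the sum of the k + 1 functions
   2^(-id) 1_(2^i B), each of which has the integral of 1_B. *)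
Lemma ncube_growth : exists2 C : R, 0 < C & forall x r k, 0 < r ->
  k.+1%:R * ncube x (2 ^+ k * r) <= C * (2 ^+ k) ^+ n.+1 * ncube x r.
Proof.
have [c c0 hc] := maximal_ge s_gt0; have [D D0 hD] := maxX.
have [C C0 hC] := maximal_average s_gt0 bX maxX.
exists (2 * (C * D) / c); first by rewrite divr_gt0 ?mulr_gt0.
move=> x r k r0; have fX := fnorm_cube_lty s_gt0 bX x r.
have [g gM gX] := hD _ fX.
have v0 := cvol_gt0 s_gt0 r0.
have rk0 : 0 < 2 ^+ k * r by rewrite mulr_gt0 ?exprn_gt0.
have XgE : (X g < +oo)%E.
  by rewrite (le_lt_trans gX)// (ncubeE s_gt0 bX) -EFinM ltry.
have gl := fnorm_locint s_gt0 bX XgE.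
have [hl hi] := @layers_int x r k r0.
have gE : \int[mu]_(y in cube x (2 ^+ k * r)) layers x r k y <=
    \int[mu]_(y in cube x (2 ^+ k * r)) (2 / c * `|g y|).
  apply: ae_le_Rintegral => //; first exact: measurable_cube.
    apply: integrable_scalef; first exact: measurable_cube.
    exact: locint_norm.
  apply: filterS gM => y gy xy; apply/andP; split.
    by apply: sumr_ge0 => i _; rewrite mulr_ge0// ltW.
  have : layers x r k y <= 2 * (g y / c) - a k.
    apply: layers_le => // i ik iy; rewrite ler_pdivlMr// -lee_fin gy.
    have ri0 : 0 < 2 ^+ i * r by rewrite mulr_gt0 ?exprn_gt0.
    have mI : measurable_fun setT (\1_(cube x r) : E -> R).
      exact/(measurable_indic _)/measurable_cube.
    have := hc _ x (2 ^+ i * r) y mI ri0 iy.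
    move=> /(le_trans _); apply.
    rewrite Rintegral_EFin; last exact: (fnorm_locint s_gt0 bX).
    under eq_Rintegral do rewrite ger0_norm//.
    have sub : cube x r `<=` cube x (2 ^+ i * r).
      by rewrite -{1}(mul1r r) -(expr0 2); exact: dyadic_sub.
    rewrite (Rintegral_indic_cube s_gt0)// -EFinM lee_fin -(a_vol i r0).
    by rewrite le_eqVlt; apply/orP; left; apply/eqP; field; rewrite gt_eqF// cvol_gt0.
  move=> /le_trans; apply; rewrite mulrAC -mulrA.
  have := a_gt0 k; have : g y / c <= `|g y| / c.
    by rewrite ler_wpM2r ?invr_ge0 ?(ltW c0)// ler_norm.
  by lra.
(* [g] represents M 1_B, a member of X with norm at most D ||1_B||; averaging it over the dilated
   cube uses the boundedness of M a second time, and the [k.+1] layers below [g] all contribute. *)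
have gN := hC g x _ XgE rk0.
have gD : fine (X g) <= D * ncube x r.
  rewrite -lee_fin (fineK (fnorm_fin XgE)) EFinM -(ncubeE s_gt0 bX)//.
have cE : cvol (2 ^+ k * r) = (2 ^+ k) ^+ n.+1 * cvol r by rewrite cvolM.
have kk0 : 0 < (2 ^+ k) ^+ n.+1 :> R by rewrite !exprn_gt0.
rewrite RintegralZl in gE; last 2 first.
- exact: measurable_cube.
- exact: locint_norm.
rewrite hi// in gE.
move: gE gN; rewrite cE; set I := Rintegral _ _ _.
move: (ncube_ge0 s X x (2 ^+ k * r)) (ncube_ge0 s X x r).
move: ((2 ^+ k) ^+ n.+1) kk0 (ncube x (2 ^+ k * r)) I => q q0 N2 I.
move: (ncube x r) (fine (X g)) (cvol r) v0 gD => N1 G v v0 gD N20 N10 gE gN.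
rewrite -(ler_pM2l v0).
have h1 : v * (k.+1%:R * N2) <= 2 / c * I * N2.
  by rewrite mulrA [v * _]mulrC ler_wpM2r.
apply: (le_trans h1).
have h2 : 2 / c * I * N2 <= 2 / c * (C * (q * v) * G).
  by rewrite -mulrA ler_wpM2l// divr_ge0// ltW.
apply: (le_trans h2).
have h3 : C * (q * v) * G <= C * (q * v) * (D * N1).
  by rewrite ler_wpM2l// ltW// !mulr_gt0.
have h4 : 2 / c * (C * (q * v) * G) <= 2 / c * (C * (q * v) * (D * N1)).
  by rewrite ler_wpM2l// divr_ge0// ltW.
apply: (le_trans h4); rewrite le_eqVlt; apply/orP; left; apply/eqP.
by field; rewrite gt_eqF.
Qed.

(** The gain is applied from radius r to 2^k r and again from there to 2^(2k) r. Of the two factors,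
    one pays for the growth of the means of [b] and the other yields decay. *)
Lemma ncube_growth2 : exists2 C : R, 0 < C & forall x r k, 0 < r ->
  k.+1%:R ^+ 2 * ncube x (2 ^+ (k + k) * r) <=
  C * (2 ^+ (k + k)) ^+ n.+1 * ncube x r.
Proof.
have [C C0 hC] := ncube_growth; exists (C ^+ 2); first by rewrite exprn_gt0.
move=> x r k r0; have rk0 : 0 < 2 ^+ k * r by rewrite mulr_gt0 ?exprn_gt0.
have h1 := hC x r k r0; have h2 := hC x _ k rk0.
rewrite exprD exprMn -mulrA.
have q0 : 0 < (2 ^+ k) ^+ n.+1 :> R by rewrite !exprn_gt0.
move: ((2 ^+ k) ^+ n.+1) q0 h1 h2 => q q0.
move: (ncube x (2 ^+ k * (2 ^+ k * r))) (ncube x (2 ^+ k * r)) (ncube x r) => N3 N2 N1 h1 h2.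
rewrite expr2 -mulrA (@le_trans _ _ (k.+1%:R * (C * q * N2)))//.
  by rewrite ler_wpM2l.
rewrite mulrCA (@le_trans _ _ (C * q * (C * q * N1)))//.
  by rewrite ler_wpM2l// mulr_ge0// ltW.
by rewrite le_eqVlt; apply/orP; left; apply/eqP; ring.
Qed.

End growth.

(** * Homogeneous kernels *)

Section homogeneous_kernel.
Variables (R : realType) (n : nat).
Local Notation E := 'rV[R]_n.+1.
Local Notation mu := (@leb R n).
Local Notation outer := (@lebesgue_outer R n).
Implicit Types (x y z w : E) (r t : R) (A B : set E).

Lemma outer_subset0 A B : A `<=` B -> outer B = 0%E -> outer A = 0%E.
Proof.
move=> AB B0; apply/eqP; rewrite eq_le outer_measure_ge0 andbT -[leRHS]B0.
exact: le_outer_measure.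
Qed.

Lemma outer_bigcup0 (A : nat -> set E) : (forall k, outer (A k) = 0%E) ->
  outer (\bigcup_k A k) = 0%E.
Proof.
move=> A0; apply/negligible_outer/negligible_bigcup => k.
exact/negligible_outer.
Qed.

Lemma outer_translate0 x A : outer A = 0%E -> outer [set y | A (y - x)] = 0%E.
Proof.
move=> A0; apply: (@outer_subset0 _ [set (x + y)%R | y in A]).
  by move=> y Ay; exists (y - x) => //; rewrite addrC subrK.
by rewrite lebesgue_outer_translate.
Qed.

Lemma outer_opp0 A : outer A = 0%E -> outer [set y | A (- y)] = 0%E.
Proof.
move=> A0; apply: (@outer_subset0 _ [set (- y)%R | y in A]).
  by move=> y Ay; exists (- y) => //; rewrite opprK.
exact: lebesgue_outer_opp_null.
Qed.

Lemma outer_scale0 r A : 0 < r -> outer A = 0%E -> outer [set y | A (r *: y)] = 0%E.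
Proof.
move=> r0 A0; apply: (@outer_subset0 _ [set (0 + r^-1 *: y)%R | y in A]).
  move=> y Ay; exists (r *: y) => //.
  by rewrite add0r scalerA mulVf ?scale1r// gt_eqF.
by apply: lebesgue_outer_affine_null; rewrite ?invr_gt0.
Qed.

Lemma outer_set0 : outer [set 0] = 0%E.
Proof.
apply/eqP; rewrite eq_le outer_measure_ge0 andbT; apply/lee_addgt0Pr => e e0.
rewrite add0e; pose s : E := const_mx 1.
have s1 i : 0 < s 0 i by rewrite mxE.
have v0 := cvol_gt0 s1 ltr01.
pose t := Num.min 1 (e / cvol s 1).
have t0 : 0 < t by rewrite lt_min ltr01 divr_gt0.
apply: (@le_trans _ _ (mu (cube s 0 t))).
  by apply: le_outer_measure => _ ->; exact: cube_center.
rewrite leb_cube ?(ltW t0)// lee_fin -[t]mulr1 cvolM.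
rewrite -ler_pdivlMr// (@le_trans _ _ t)//; last by rewrite ge_min lexx orbT.
rewrite exprS ler_piMr ?(ltW t0)// exprn_ile1// ?(ltW t0)//.
by rewrite ge_min lexx.
Qed.

Definition unit_dir z : E := (enorm z)^-1 *: z.

Lemma unit_dirE z : z != 0 -> [/\ 0 < enorm z, sphere (unit_dir z) &
  z = enorm z *: unit_dir z].
Proof.
move=> z0; have e0 : 0 < enorm z.
  by rewrite lt_neqAle enorm_ge0 andbT eq_sym; apply: contra z0 => /eqP/enorm_eq0 ->.
split => //; last by rewrite scalerA divff ?scale1r// gt_eqF.
by rewrite /sphere/= enormZ ?invr_ge0 ?enorm_ge0// mulVf// gt_eqF.
Qed.

Lemma sphere_negligible A :
  (@surface R n).-negligible (A : set (caratheodory_type (@surface_outer R n))) <->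
  outer (cone A) = 0%E.
Proof.
split=> [[B [mB B0 AB]]|A0].
  apply: (@outer_subset0 _ (cone B)).
    by move=> x [t [y [t01 Sy Ay ->]]]; exists t, y; split => //; exact: AB.
  move: B0; rewrite /= /surface/= /surface_outer => /eqP.
  by rewrite mule_eq0 eqe pnatr_eq0/= => /eqP.
have S0 : surface_outer A = 0%E by rewrite /surface_outer A0 mule0.
exists A; split => //; apply: le_caratheodory_measurable => Y /=.
rewrite (_ : surface_outer (Y `&` A) = 0%E) ?add0e.
  by apply: le_surface_outer => y [].
apply/eqP; rewrite eq_le surface_outer_ge0 andbT -S0.
by apply: le_surface_outer => y [].
Qed.

(* The cone over A only contains the directions of A up to radius 1. *)
Lemma cone_null A : outer (cone A) = 0%E ->
  outer [set z | z != 0 /\ A (unit_dir z)] = 0%E.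
Proof.
move=> A0; apply: (@outer_subset0 _ (\bigcup_k [set z | cone A (k.+1%:R^-1 *: z)])).
  move=> z [z0 Az]; have [e0 sz zE] := unit_dirE z0.
  exists (Num.truncn (enorm z)) => //=.
  have kz := truncnS_gt (enorm z).
  exists (enorm z / (Num.truncn (enorm z)).+1%:R), (unit_dir z); split => //.
    by rewrite divr_gt0//= ler_pdivrMr// mul1r ltW.
  by rewrite mulrC -scalerA -zE.
by apply: outer_bigcup0 => k; apply: outer_scale0 => //; rewrite invr_gt0.
Qed.

Variable Omega : E -> R.
Hypothesis hom : homogeneous0 Omega.

Lemma homogeneous_dir z : z != 0 -> Omega z = Omega (unit_dir z).
Proof. by move=> /unit_dirE[e0 sz {1}->]; exact: hom. Qed.

Lemma homogeneous_scale t z : 0 < t -> Omega (t *: z) = Omega z.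
Proof.
move=> t0; have [->|z0] := eqVneq z 0; first by rewrite scaler0.
have [e0 sz zE] := unit_dirE z0.
by rewrite [in RHS]homogeneous_dir// [in LHS]zE scalerA hom// mulr_gt0.
Qed.

(** A dilation-invariant property that fails at [z] fails at its direction, and a null set of
    directions spans a null cone. *)
Lemma sphere_ae (P : E -> Prop) : (forall t z, 0 < t -> P z -> P (t *: z)) ->
  {ae @surface R n, forall x, sphere x -> P x} ->
  outer [set z | z != 0 /\ ~ P z] = 0%E.
Proof.
move=> hP /sphere_negligible/cone_null; apply: outer_subset0 => z [z0 Pz].
split => // h; apply: Pz; have [e0 sz ->] := unit_dirE z0.
by apply: hP => //; exact: h.
Qed.

Lemma essential_bound : sphere_Linfty Omega ->

  exists2 M : R, 0 < M & outer [set z | ~ (`|Omega z| <= M)] = 0%E.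
Proof.
move=> OL.
have [M hM] : exists M : R, {ae @surface R n, forall x, sphere x -> `|Omega x| <= M}.
  have := sub_Lfun_finLfun OL; rewrite inE /= /finite_norm unlock.
  case: ifPn => [_|] h.
    have ae := ess_sup_ge (@surface R n) (abse \o (EFin \o Omega)).
    have [y yoo hy] : exists2 y : R, (ess_sup (@surface R n) (abse \o (EFin \o Omega)) <= y%:E)%E & True.
      move: h; case: (ess_sup _ _) => [y|//|] _; first by exists y.
      by exists 0; rewrite ?leNye.
    exists y; apply: filterS ae => x xle _; rewrite -lee_fin.
    exact: le_trans xle yoo.
  (* The norm of order [+oo] is defined by cases: if the whole space has measure zero, any bound
     holds almost everywhere. *)
  move=> _; exists 0; exists setT; split => //.
  by apply/eqP; rewrite eq_le measure_ge0 andbT leNgt.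
exists (Num.max M 1); first by rewrite lt_max ltr01 orbT.
apply: (@outer_subset0 _ ([set 0] `|` [set z | z != 0 /\ ~ (`|Omega z| <= M)])).
  move=> z zM; have [->|z0] := eqVneq z 0; [by left|right; split => //].
  by move=> h; apply: zM; rewrite le_max h.
apply/negligible_outer/negligibleU; apply/negligible_outer; first exact: outer_set0.
apply: sphere_ae hM => t z t0 /=; by rewrite homogeneous_scale.
Qed.

End homogeneous_kernel.

(** * Boxes almost filled by a set of positive measure *)

Section dense_box.
Variables (R : realType) (n : nat).
Local Notation E := 'rV[R]_n.+1.
Local Notation mu := (@leb R n).
Local Notation outer := (@lebesgue_outer R n).
Implicit Types (p q : E * E) (x y z w : E) (r t : R) (A B : set E).

Definition boxI p q : E * E :=
  (\row_i Num.max (p.1 0 i) (q.1 0 i), \row_i Num.min (p.2 0 i) (q.2 0 i)).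

Lemma boxIE p q : box (boxI p q) = box p `&` box q.
Proof.
apply/seteqP; split=> [x h|x [hp hq] i].
  by split=> i; have := h i; rewrite /= !mxE gt_max le_min;
    move=> /andP[/andP[? ?] /andP[? ?]]; apply/andP.
rewrite /= !mxE gt_max le_min.
by have /andP[-> ->] := hp i; have /andP[-> ->] := hq i.
Qed.

Lemma boxI_volume p q : (box_volume (boxI p q) <= box_volume p)%E.
Proof.
rewrite -!lebesgue_outer_box boxIE.
by apply: le_outer_measure => x [].
Qed.

Lemma box_volume0 p i : p.2 0 i <= p.1 0 i -> box_volume p = 0%E.
Proof.
move=> pi; rewrite /box_volume (bigD1 i)//= max_l ?mul0r//.
by rewrite subr_le0.
Qed.

(** This plays the role of Lebesgue's density theorem. Cover [G] by boxes of total volume below (1 +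
    eta) |G|, cut down to [Q]. If [G] filled at most the fraction 1 - eta of each of them, then |G|
    <= (1 - eta)(1 + eta) |G| would follow, contradicting |G| > 0. *)
Lemma dense_box (Q : E * E) (G : set E) (eta : R) : measurable G ->
  G `<=` box Q -> (0 < outer G)%E -> 0 < eta < 1 ->
  exists p, [/\ box p `<=` box Q, (forall i, p.1 0 i < p.2 0 i) &
    (outer (box p `\` G) <= eta%:E * box_volume p)%E].
Proof.
move=> mG GQ G0 /andP[e0 e1].
have Gfin : outer G \is a fin_num.
  rewrite ge0_fin_numE ?outer_measure_ge0//.
  rewrite (@le_lt_trans _ _ (outer (box Q)))//; first exact: le_outer_measure.
  by rewrite lebesgue_outer_box ltry.
set m := fine (outer G); have mE : outer G = m%:E by rewrite fineK.
have m0 : 0 < m by rewrite -lte_fin -mE.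
have [_ [q Gq <-] qm] := lb_ereal_inf_adherent (mulr_gt0 e0 m0) Gfin.
rewrite -/(lebesgue_outer G) mE -EFinD in qm.
apply: contrapT => no.
have bound k : (outer (box (boxI (q k) Q) `&` G) <=
    (1 - eta)%:E * box_volume (q k))%E.
  set p := boxI (q k) Q.
  apply: (@le_trans _ _ ((1 - eta)%:E * box_volume p)%E); last first.
    by rewrite lee_wpmul2l ?boxI_volume// lee_fin subr_ge0 ltW.
  have [pos|/existsNP[i /negP]] := pselect (forall i, p.1 0 i < p.2 0 i).
    have : ~ (outer (box p `\` G) <= eta%:E * box_volume p)%E.
      by move=> h; apply: no; exists p; split => //; rewrite boxIE => x [].
    move=> /negP; rewrite -ltNge => h.
    have := mG (box p) => /=; rewrite lebesgue_outer_box -setDE.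
    have Ifin : outer (box p `&` G) \is a fin_num.
      rewrite ge0_fin_numE ?outer_measure_ge0//.
      rewrite (@le_lt_trans _ _ (outer (box p)))//; first by apply: le_outer_measure => x [].
      by rewrite lebesgue_outer_box ltry.
    have Dfin : outer (box p `\` G) \is a fin_num.
      rewrite ge0_fin_numE ?outer_measure_ge0//.
      rewrite (@le_lt_trans _ _ (outer (box p)))//; first by apply: le_outer_measure => x [].
      by rewrite lebesgue_outer_box ltry.
    move: h; rewrite -(fineK Ifin) -(fineK Dfin) -EFinD /box_volume -!EFinM lte_fin lee_fin.
    set v := \prod_i _; move: v (fine _) (fine _) => v a b h [] vab.
    by rewrite mulrBl mul1r; lra.
  rewrite -leNgt => /box_volume0 v0; rewrite v0 mule0.
  by rewrite -v0 -lebesgue_outer_box; apply: le_outer_measure => x [].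
have : (m%:E <= (1 - eta)%:E * (m + eta * m)%:E)%E.
  rewrite -mE (@le_trans _ _ (\sum_(k <oo) outer (box (boxI (q k) Q) `&` G))%E)//.
    apply: le_trans (lebesgue_outer_sigma_subadditive _).
    apply: le_outer_measure => x Gx; have [k _ qx] := Gq _ Gx.
    by exists k => //; split => //; rewrite boxIE; split => //; exact: GQ.
  apply: (@le_trans _ _ (\sum_(k <oo) ((1 - eta)%:E * box_volume (q k)))%E).
    by apply: lee_nneseries => [k _ _|k _]; [exact: outer_measure_ge0|exact: bound].
  rewrite nneseriesZl; last by move=> k _; exact: box_volume_ge0.
  by rewrite lee_wpmul2l ?ltW// lte_fin subr_gt0.
rewrite -EFinM lee_fin leNgt => /negP; apply.
by have := mulr_gt0 m0 (mulr_gt0 e0 e0); lra.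
Qed.

End dense_box.

Section kernel.
Variables (R : realType) (n : nat).
Local Notation E := 'rV[R]_n.+1.
Local Notation mu := (@leb R n).
Local Notation outer := (@lebesgue_outer R n).
Implicit Types (x y z w : E) (r t : R) (A B : set E).
Variable Omega : E -> R.
Hypothesis hom : homogeneous0 Omega.

Lemma unit_dir_continuous z : z != 0 -> {for z, continuous (@unit_dir R n)}.
Proof.
move=> z0; have [e0 _ _] := unit_dirE z0.
have c : {for z, continuous (fun x : E => (enorm x)^-1)}.
  apply: continuousV; [exact: lt0r_neq0|exact: enorm_continuous].
exact: (cvgZ c (@cvg_id _ (nbhs z))).
Qed.

(* The argument is -w because the kernel is Omega(x - y) while boxes will be
   translated along y - x. *)
Lemma direction_box (sg : R) (L : set E) (eta : R) : 0 < eta < 1 ->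
  (forall e c : R, 0 < e < 2^-1 ->
     measurable [set w | e < enorm w < 2 /\ c < sg * Omega (- w)]) ->
  open_in_sphere L ->
  {ae @surface R n, forall x, L x -> 0 <= sg * Omega x} ->
  ~ {ae @surface R n, forall x, L x -> sg * Omega x = 0} ->
  exists (p : E * E) (e : R), [/\ 0 < e, (forall i, p.1 0 i < p.2 0 i),
    (forall w, box p w -> e < enorm w),
    outer [set w | box p w /\ sg * Omega (- w) < 0] = 0%E &
    (outer [set w | box p w /\ (sg * Omega (- w) <= e)%R] <=
       eta%:E * box_volume p)%E].
Proof.
move=> eta01 mG [U oU LU] sge0 nz.
pose C := [set w : E | w != 0 /\ U (unit_dir (- w))].
(* The shift by 3 keeps [e k] below 1/2, the range in which measurability is available. *)
pose e k : R := k.+3%:R^-1.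
have e01 k : 0 < e k < 2^-1.
  by rewrite invr_gt0 ltr0n/= ltf_pV2 ?posrE// ltr_nat.
(* These sets exhaust, inside the unit ball, the directions of [L] where [sg * Omega] is positive;
   were they all null, [Omega] would vanish almost everywhere on [L]. *)
pose A k := [set w : E | [/\ e k < enorm w, enorm w <= 1, C w & e k < sg * Omega (- w)]].
have [k Ak] : exists k, outer (A k) <> 0%E.
  apply/existsNP => A0; apply: nz; apply/sphere_negligible.
  set N := ~` _; suff : outer [set w | cone (N `&` [set x | 0 <= sg * Omega x]) (- w)] = 0%E.
    move=> /outer_opp0 h1; move/sphere_negligible : sge0 => h2.
    have : outer ([set w | cone (N `&` [set x | 0 <= sg * Omega x]) w] `|`
        cone (~` [set x | L x -> 0 <= sg * Omega x])) = 0%E.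
      apply/negligible_outer/negligibleU; apply/negligible_outer => //.
      by apply: outer_subset0 h1 => w /=; rewrite opprK.
    apply: outer_subset0 => w [t [y [t01 Sy Ny ->]]].
    have [Py|Py] := pselect (0 <= sg * Omega y).
      by left; exists t, y.
    right; exists t, y; split => // h; apply: Py; apply: h.
    by apply: contrapT => Ly; apply: Ny.
  apply: (outer_subset0 _ (outer_bigcup0 A0)) => w [t [y [/andP[t0 t1] Sy [Ny /= Py] wE]]].
  have {}wE : w = - (t *: y) by rewrite -wE opprK.
  have Ly : L y by apply: contrapT => Ly; apply: Ny.
  have y0 : sg * Omega y != 0 by apply/eqP => y0; apply: Ny.
  have Op : 0 < sg * Omega y by rewrite lt_neqAle eq_sym y0.
  have Ew : enorm w = t by rewrite wE enormN enormZ ?ltW// Sy mulr1.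
  have m0 : 0 < Num.min t (sg * Omega y) by rewrite lt_min t0.
  pose k := Num.truncn (Num.min t (sg * Omega y))^-1.
  have ek : e k < Num.min t (sg * Omega y).
    rewrite -[ltRHS]invrK ltf_pV2 ?posrE ?invr_gt0//.
    by rewrite (lt_le_trans (truncnS_gt _))// ler_nat !ltnS -/k ltnW.
  move: ek; rewrite lt_min => /andP[ek1 ek2].
  exists k => //; split => //.
  - by rewrite Ew.
  - by rewrite Ew.
  - split; first by apply/eqP => w0; move: Ew; rewrite w0 /enorm big1 ?sqrtr0 ?(gt_eqF t0)// => [t00|i _]; [rewrite -t00 ltxx in t0|rewrite mxE expr0n].
    rewrite /unit_dir enormN Ew wE opprK scalerA mulVf ?gt_eqF// scale1r.
    by move: Ly; rewrite LU => -[].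
  - by rewrite wE opprK hom.
pose D := [set w : E | e k < enorm w < 2 /\ C w].
have oD : open D.
  rewrite openE => w [/andP[h1 h2] [w0 Uw]]; rewrite /interior.
  have n1 : \forall z \near w, e k < enorm z.
    exact: (cvgr_gt _ (@enorm_continuous R n w)).
  have n2 : \forall z \near w, enorm z < 2.
    exact: (cvgr_lt _ (@enorm_continuous R n w)).
  have n3 : \forall z \near w, U (unit_dir (- z)).
    have Nw0 : - w != 0 by rewrite oppr_eq0.
    have c : {for w, continuous (fun z : E => unit_dir (- z))}.
      apply: (@continuous_comp _ _ _ (fun z : E => - z) (@unit_dir R n)).
        exact: opp_continuous.
      exact: unit_dir_continuous.
    by apply: (c U); exact: open_nbhs_nbhs.
  near=> z; split; first by apply/andP; split; near: z.
  split; last by near: z.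
  have : e k < enorm z by near: z.
  apply: contraTneq => ->; rewrite -leNgt /enorm big1 ?sqrtr0//.
    by have /andP[/ltW] := e01 k.
  by move=> i _; rewrite mxE expr0n.
have [q [Dq Aq]] : exists q : 'rV[rat]_n.+1 * 'rV[rat]_n.+1,
    box (map_mx ratr q.1, map_mx ratr q.2) `<=` D /\
    outer (A k `&` box (map_mx ratr q.1, map_mx ratr q.2)) <> 0%E.
  apply: contrapT => no; apply: Ak.
  pose T := ('rV[rat]_n.+1 * 'rV[rat]_n.+1)%type.
  pose b (q : T) : set E := box (map_mx ratr q.1, map_mx ratr q.2).
  pose F m := if unpickle m is Some q then
    if `[< b q `<=` D >] then A k `&` b q else set0 else set0.
  have F0 m : outer (F m) = 0%E.
    rewrite /F; case: unpickle => [q|]; last exact: outer_measure0.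
    case: asboolP => [qD|_]; last exact: outer_measure0.
    by apply: contrapT => h; apply: no; exists q.
  apply: outer_subset0 (outer_bigcup0 F0) => w Aw.
  have Dw : D w by case: Aw => h1 h2 h3 h4; split => //; rewrite h1 (le_lt_trans h2)// ltr1n.
  have [q [qw qD]] := open_box_nbhs oD Dw.
  by exists (pickle (q : T)) => //; rewrite /F pickleK asboolT.
set Q := (map_mx ratr q.1, map_mx ratr q.2) in Dq Aq.
(* [G] enlarges the part of [A k] in the box to a set known to be measurable; the box lies in the
   open cone [D], so nothing outside the directions of [L] is added. *)
pose G := [set w | e k < enorm w < 2 /\ e k < sg * Omega (- w)] `&` box Q.
have mG' : measurable G.
  by apply: measurableI; [exact: mG|exact: measurable_box].
have AG : A k `&` box Q `<=` G.
  by move=> w [[h1 h2 h3 h4] h5]; split => //; split => //; rewrite h1 (le_lt_trans h2)// ltr1n.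
have G0 : (0 < outer G)%E.
  rewrite lt_neqAle outer_measure_ge0 andbT eq_sym; apply/eqP => G0.
  by apply: Aq; exact: outer_subset0 AG G0.
have GQ : G `<=` box Q by move=> w [].
have [p [pQ p12 hp]] := dense_box mG' GQ G0 eta01.
have /andP[ek0 _] := e01 k.
exists p, (e k); split => //.
- by move=> w /pQ/Dq[/andP[]].
- move/sphere_negligible/cone_null/outer_opp0 : sge0; apply: outer_subset0 => w [pw /= neg].
  have [_ [w0 Uw]] := Dq _ (pQ _ pw).
  have Nw0 : - w != 0 by rewrite oppr_eq0.
  split => // h; move: neg; rewrite (homogeneous_dir hom Nw0) ltNge => /negP; apply; apply: h.
  by rewrite LU; split => //; have [] := unit_dirE Nw0.
- apply: le_trans hp; apply: le_outer_measure => w [pw /= we]; split => // -[[_ /=]].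
  by rewrite ltNge we.
Unshelve. all: by end_near. Qed.

End kernel.

Section good_kernel.
Variables (R : realType) (n : nat).
Local Notation E := 'rV[R]_n.+1.
Local Notation mu := (@leb R n).
Local Notation outer := (@lebesgue_outer R n).
Implicit Types (x y z w : E) (r t e c sg M : R) (A B : set E).

(* The cube of center x + r *: z0 and radius r is the companion of the cube of
   center x and radius r: on their product Omega(x - y) has the sign sg almost
   everywhere, and it exceeds c up to a small set. *)
Record good_kernel (Omega : E -> R) (s z0 : E) sg M c dlt : Prop := GoodKernel {
  gk_s : forall i, 0 < s 0 i ;
  gk_sg : `|sg| = 1 ;
  gk_M : 0 < M ;
  gk_c : 0 < c ;
  gk_dlt : 0 < dlt ;
  gk_bound : forall x, {ae mu, forall y, `|Omega (x - y)| <= M} ;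
  gk_sign : forall x r, 0 < r -> {ae mu, forall y,
    cube s (x + r *: z0) (2 * r) y -> 0 <= sg * Omega (x - y)} ;
  gk_dense : forall x r, 0 < r ->
    (outer [set y | cube s (x + r *: z0) (2 * r) y /\ (sg * Omega (x - y) <= c)%R]
      <= (cvol s r / 4)%:E)%E ;
  gk_away : forall x r y, 0 < r -> cube s (x + r *: z0) (2 * r) y ->
    dlt * r <= enorm (x - y) }.

Lemma cube_affine (s : E) z r x w (u : R) : 0 < r ->
  cube s (x + r *: z) (u * r) (x + r *: w) <-> cube s z u w.
Proof.
move=> r0; split=> /cubeP h; apply/cubeP => i; have := h i; rewrite !mxE.
  by rewrite -!addrA ltrD2l lerD2l mulrAC [_ * r]mulrC -mulrBr -mulrDr ltr_pM2l// ler_pM2l.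
by rewrite -!addrA ltrD2l lerD2l mulrAC [_ * r]mulrC -mulrBr -mulrDr ltr_pM2l// ler_pM2l.
Qed.

Lemma ae_outer (P : E -> Prop) : {ae mu, forall x, P x} <-> outer [set x | ~ P x] = 0%E.
Proof. exact: negligible_outer. Qed.

Lemma sphere_aeS (P Q : E -> Prop) : (forall x, P x -> Q x) ->
  {ae @surface R n, forall x, P x} -> {ae @surface R n, forall x, Q x}.
Proof. by move=> PQ; apply: negligibleS => x; apply: contra_not; exact: PQ. Qed.

(** Homogeneity of degree zero spreads the properties of one box of directions to all its translates
    and dilates, so that a single box determines the shape [s] and the displacement [z0] at every
    scale. *)
Lemma good_kernel_exists (Omega : E -> R) (L : set E) : homogeneous0 Omega ->
  sphere_Linfty Omega ->
  (forall sg e c : R, 0 < e < 2^-1 ->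
     measurable [set w | e < enorm w < 2 /\ c < sg * Omega (- w)]) ->
  open_in_sphere L -> no_sign_change Omega L -> ~ ae_zero_on_sphere Omega L ->
  exists s z0 sg M c dlt, good_kernel Omega s z0 sg M c dlt.
Proof.
move=> hom OL mG oL sgn nz.
have [sg sg1 sgL] : exists2 sg : R, `|sg| = 1 &
    {ae @surface R n, forall x, L x -> 0 <= sg * Omega x}.
  case: sgn => sgn; [exists 1; rewrite ?normr1//|exists (-1); rewrite ?normrN1//].
    by apply: sphere_aeS sgn => x h Lx; rewrite mul1r h.
  by apply: sphere_aeS sgn => x h Lx; rewrite mulN1r oppr_ge0 h.
have sg0 : sg != 0 by rewrite -normr_eq0 sg1 oner_eq0.
have nz' : ~ {ae @surface R n, forall x, L x -> sg * Omega x = 0}.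
  apply: contra_not nz; apply: sphere_aeS => x h Lx; apply/eqP.
  by have /eqP := h Lx; rewrite mulf_eq0 (negbTE sg0).
have [M M0 hM] := essential_bound hom OL.
(* The box becomes a cube of radius 2 r; with this density the exceptional set takes at most a
   quarter of the volume of a cube of radius r. *)
pose eta : R := (2 ^+ n.+1)^-1 / 4.
have p20 : 0 < 2 ^+ n.+1 :> R by rewrite exprn_gt0.
have eta01 : 0 < eta < 1.
  rewrite divr_gt0 ?invr_gt0//= /eta -invfM invf_lt1 ?mulr_gt0//.
  by rewrite (@lt_le_trans _ _ (1 * 4))// ?ler_wpM2r ?exprn_ege1 ?ler1n// mul1r ltr1n.
have [p [e [e0 p12 pe pneg pdense]]] := direction_box hom eta01 (mG sg) oL sgL nz'.
(* A quarter of the sides makes the box equal to [cube s z0 2]. Radius 2 leaves room for [x] to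
   move: if [x] lies in [cube s x0 r], the companion of the latter lies in the doubled companion
   attached to [x]. *)
pose s : E := 4^-1 *: (p.2 - p.1); pose z0 : E := 2^-1 *: (p.1 + p.2).
have pE : box p = cube s z0 2.
  by rewrite /cube; congr box; rewrite [LHS]surjective_pairing; congr (_, _);
    apply/rowP => i; rewrite !mxE; lra.
have s0 i : 0 < s 0 i by rewrite !mxE; have := p12 i; lra.
have volE : box_volume p = (2 ^+ n.+1 * cvol s 1)%:E.
  rewrite -cvolM mulr1 -(leb_cube s0 z0 (ler0n R 2)) -pE.
  by rewrite /leb lebesgue_outer_box.
have affE x r y : 0 < r -> exists2 w, y = x + r *: w & x - y = r *: (- w).
  move=> r0; exists (r^-1 *: (y - x)).
    by rewrite scalerA divff ?gt_eqF// scale1r addrC subrK.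
  by rewrite scalerN scalerA divff ?gt_eqF// scale1r opprB.
exists s, z0, sg, M, e, e; split => //.
- move=> x; apply/ae_outer.
  move: hM => /outer_opp0/(outer_translate0 x); apply: outer_subset0 => y /=.
  by rewrite opprB.
- move=> x r r0; apply/ae_outer.
  apply: (outer_subset0 _ (lebesgue_outer_affine_null x r0 pneg)) => y.
  have [w -> xyE] := affE x r y r0; move=> /not_implyP[/(cube_affine _ _ _ _ _ r0) yQ h].
  exists w => //; split; first by rewrite pE.
  by move/negP: h; rewrite xyE (homogeneous_scale hom)// -ltNge.
- move=> x r r0.
  have h := lebesgue_outer_affine_le x [set w | box p w /\ (sg * Omega (- w) <= e)%R] r0.
  apply: (@le_trans _ _
     (outer [set x + r *: y | y in [set w | box p w /\ (sg * Omega (- w) <= e)%R]])).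
    apply: le_outer_measure => y [].
    have [w -> xyE] := affE x r y r0 => /(cube_affine _ _ _ _ _ r0) yQ.
    rewrite xyE (homogeneous_scale hom)// => h2.
    by exists w => //; split => //; rewrite pE.
  apply: (le_trans h); apply: (@le_trans _ _ ((r ^+ n.+1)%:E * (eta%:E * box_volume p))%E).
    by rewrite lee_wpmul2l// lee_fin exprn_ge0// ltW.
  rewrite volE -!EFinM lee_fin -[r in leRHS]mulr1 cvolM /eta.
  move: (2 ^+ n.+1) p20 (r ^+ n.+1) (cvol s 1) => a a0 b v.
  by rewrite le_eqVlt; apply/orP; left; apply/eqP; field; rewrite gt_eqF.
- move=> x r y r0; have [w -> xyE] := affE x r y r0 => /(cube_affine _ _ _ _ _ r0) yQ.
  rewrite xyE (enormZ _ (ltW r0)) enormN mulrC; apply: ler_wpM2l; first exact: ltW.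
  by apply: ltW; apply: pe; rewrite pE.
Qed.

Lemma ae_exists (P : E -> Prop) (A : set E) : {ae mu, forall x, P x} ->
  outer A <> 0%E -> exists2 x, A x & P x.
Proof.
move=> /ae_outer P0 A0; apply: contrapT => h; apply: A0.
by apply: (outer_subset0 _ P0) => x Ax Px; apply: h; exists x.
Qed.

Lemma outer_cube_neq0 (s : E) x r : (forall i, 0 < s 0 i) -> 0 < r -> outer (cube s x r) <> 0%E.
Proof.
move=> s0 r0; have := leb_cube s0 x (ltW r0); rewrite /leb => -> /eqP.
by rewrite eqe gt_eqF// cvol_gt0.
Qed.

Lemma dist_continuous x : continuous (fun y => enorm (x - y)).
Proof.
move=> y; apply: (@continuous_comp _ _ _ (fun y : E => x - y) (@enorm R n)).
  exact: (cvgB (@cvg_cst _ x _ (nbhs y) _) (@cvg_id _ (nbhs y))).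
exact: enorm_continuous.
Qed.

Lemma measurable_dist_itv x a c : measurable [set y | a < enorm (x - y) < c].
Proof.
have -> : [set y | a < enorm (x - y) < c] =
    [set y | a < enorm (x - y)] `&` [set y | enorm (x - y) < c].
  by apply/seteqP; split=> y /= => [/andP[? ?]|[? ?]]; [split|apply/andP].
have /continuousP h := @dist_continuous x.
apply: measurableI; apply: open_measurable_rV.
  exact: (h _ (@open_gt R a)).
exact: (h _ (@open_lt R c)).
Qed.

(** [sphere_Linfty] speaks of measurability for the area measure. In space, measurability is read
    off one truncated integral: at a point [x0] where T is defined on the indicator of a large ball,
    the integrand times a power of the distance is Omega(x0 - y) on an annulus. *)
Lemma kernel_measurable (X : normedFunctionSpace R n) (Omega : E -> R) :
  is_ball_banach X ->
  (forall f, (X f < +oo)%E -> {ae mu, forall x, T_Omega_exists Omega f x}) ->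
  forall sg e c : R, 0 < e < 2^-1 ->
     measurable [set w | e < enorm w < 2 /\ c < sg * Omega (- w)].
Proof.
move=> bX TX sg e c /andP[e0 e2].
pose s : E := const_mx 1; have s0 i : 0 < s 0 i by rewrite mxE.
(* Points at distance less than 2 from a point of the cube of radius 1 have coordinates at most 3,
   hence lie in this ball. *)
pose rho : R := 4 * n.+2%:R; have rho0 : 0 < rho by rewrite mulr_gt0.
have [x0 x0c [ex _]] := ae_exists (TX _ (ball_banach_indic bX 0 rho0))
  (@outer_cube_neq0 s 0 1 s0 ltr01).
have /measurable_EFinP mS := measurable_int mu (ex e e0).
pose D := [set y | e < enorm (x0 - y) < 2].
have mD : measurable D by exact: measurable_dist_itv.
have Dsub : D `<=` annulus x0 e.
  move=> y /andP[h1 h2]; rewrite /annulus/= h1/= (lt_trans h2)//.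
  by rewrite -(invrK 2) ltf_pV2 ?posrE.
have mH : measurable_fun D (fun y => sg * (singular_integrand Omega (\1_(eball 0 rho) : E -> R) x0 y *
    enorm (x0 - y) ^+ n.+1)).
  apply: measurable_funM => //; apply: measurable_funM.
    by apply: measurable_funS mS => //; exact: measurable_dist_itv.
  apply: measurable_funX; apply: measurable_funTS.
  exact: (continuous_measurable_rV (@dist_continuous x0)).
have HE y : D y -> sg * (singular_integrand Omega (\1_(eball 0 rho) : E -> R) x0 y *
    enorm (x0 - y) ^+ n.+1) = sg * Omega (x0 - y).
  move=> /andP[h1 h2]; congr (_ * _); rewrite /singular_integrand indicE mem_set.
    by rewrite mulr1 divfK// gt_eqF// exprn_gt0// (lt_trans e0).
  rewrite /eball/= subr0 (le_lt_trans (enorm_le_sum _))//.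
  rewrite (@le_lt_trans _ _ (\sum_(i < n.+1) 3))//.
    apply: ler_sum => i _; have := normr_le_enorm (x0 - y) i.
    move/(cubeP _ _ _ _)/(_ i) : x0c; rewrite !mxE !ler_norml => /andP[? ?] /andP[? ?].
    by apply/andP; split; lra.
  rewrite sumr_const card_ord -[ltLHS]mulr_natr /rho.
  have : n.+1%:R < n.+2%:R :> R by rewrite ltr_nat.
  have : 0 <= n.+1%:R :> R by rewrite ler0n.
  by move: (n.+1%:R) (n.+2%:R) => a d ? ?; lra.
have mHc : measurable (D `&` (fun y => sg * (singular_integrand Omega (\1_(eball 0 rho) : E -> R) x0 y *
    enorm (x0 - y) ^+ n.+1)) @^-1` `]c, +oo[%classic).
  by apply: mH => //; exact: measurable_itv.
have := measurable_translate x0 mHc; congr measurable.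
have DE w : D (x0 + w) <-> e < enorm w < 2.
  by rewrite /D/= opprD addrA subrr sub0r enormN.
apply/seteqP; split=> w.
  move=> [Dw]; rewrite /= HE// in_itv/= andbT opprD addrA subrr sub0r => h.
  by split => //; exact/DE.
move=> [/DE Dw h]; split => //; rewrite /= HE// in_itv/= andbT.
by rewrite opprD addrA subrr sub0r.
Qed.

End good_kernel.

(** * Test functions for the commutator *)

Section commutator_formula.
Variables (R : realType) (n : nat).
Local Notation E := 'rV[R]_n.+1.
Local Notation mu := (@leb R n).
Local Notation outer := (@lebesgue_outer R n).
Implicit Types (x y z w : E) (r t a rho beta m tau : R) (A B F : set E) (f g : E -> R).

Lemma integrable_indic_lty A B : measurable A -> measurable B -> (mu A < +oo)%E ->
  mu.-integrable A (EFin \o (\1_B : E -> R)).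
Proof.
move=> mA mB Aoo; apply: (le_integrable _ _ _ (integrable_const 1 mA Aoo)) => //.
  by apply/measurable_EFinP; exact: measurable_indic.
move=> x _; rewrite /= lee_fin normr1 indicE ger0_norm// lern1.
by case: (_ \in _).
Qed.

(** For small [e] the annulus contains all of [F], so the truncated integral no longer depends on
    [e]. *)
Lemma T_Omega_off (Omega : E -> R) g x F dl Dl : measurable F -> 0 < dl ->
  (forall y, ~ F y -> g y = 0) ->
  (forall y, F y -> dl <= enorm (x - y) <= Dl) -> T_Omega_exists Omega g x ->
  mu.-integrable F (EFin \o singular_integrand Omega g x) /\
  T_Omega Omega g x = \int[mu]_(y in F) singular_integrand Omega g x y.
Proof.
move=> mF dl0 g0 Fd [gi _].
have D0 : 0 < `|Dl| + 1 by rewrite ltr_wpDl.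
(* The first bound keeps [F] outside the inner sphere, the second one inside the sphere of radius
   [e^-1]. *)
pose e0 := Num.min dl (`|Dl| + 1)^-1.
have e00 : 0 < e0 by rewrite lt_min dl0 invr_gt0.
have sub e : 0 < e < e0 -> F `<=` annulus x e.
  move=> /andP[ep]; rewrite lt_min => /andP[e1 e2] y /Fd /andP[h1 h2].
  rewrite /annulus/= (lt_le_trans e1)//= (le_lt_trans h2)//.
  rewrite (@lt_trans _ _ (`|Dl| + 1))//; first by rewrite (le_lt_trans (ler_norm _))// ltrDl.
  by rewrite -(invrK (`|Dl| + 1)) ltf_pV2 ?posrE ?invr_gt0.
have mA e : measurable (annulus x e) by exact: measurable_dist_itv.
have e02 : 0 < e0 / 2 < e0 by rewrite divr_gt0//= ltr_pdivrMr// ltr_pMr// ltr1n.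
split.
  have /andP[ep _] := e02.
  exact: (integrableS (mA _) mF (sub _ e02) (gi _ ep)).
apply: lim_near_cst => //.
near=> e; rewrite /truncated_integral.
have ee : 0 < e < e0 by apply/andP; split; near: e; [exact: nbhs_right_gt|exact: nbhs_right_lt].
rewrite -[in RHS](setIidr (sub e ee)) Rintegral_mkcondr.
apply: eq_Rintegral => y _; rewrite patchE.
by case: ifPn => // /negP yF; rewrite /singular_integrand g0 ?mulr0// => Fy; apply: yF; exact/mem_set.
Unshelve. all: by end_near. Qed.

Definition kernel (Omega : E -> R) x y : R := Omega (x - y) / enorm (x - y) ^+ n.+1.

Lemma commutator_off (b Omega : E -> R) a x F dl Dl :
  measurable F -> 0 < dl ->
  (forall y, F y -> dl <= enorm (x - y) <= Dl) ->
  T_Omega_exists Omega (fun y => a * \1_F y) x ->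
  T_Omega_exists Omega (b \* (fun y => a * \1_F y)) x ->
  [/\ mu.-integrable F (EFin \o (fun y => a * kernel Omega x y)),
   mu.-integrable F (EFin \o (fun y => (b x - b y) * (a * kernel Omega x y))) &
   commutator b Omega (fun y => a * \1_F y) x =
     \int[mu]_(y in F) ((b x - b y) * (a * kernel Omega x y))].
Proof.
move=> mF dl0 Fd ex1 ex2.
have out y : ~ F y -> a * \1_F y = 0 by move=> Fy; rewrite indicE memNset// mulr0.
have [i1 T1] := T_Omega_off mF dl0 out Fd ex1.
have [|i2 T2] := T_Omega_off mF dl0 _ Fd ex2.
  by move=> y Fy /=; rewrite out// mulr0.
have E1 : {in F, forall y, singular_integrand Omega (fun y => a * \1_F y) x y =
    a * kernel Omega x y}.
  by move=> y yF; rewrite /singular_integrand indicE yF mulr1 mulrC.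
have E2 : {in F, forall y, singular_integrand Omega (b \* (fun y => a * \1_F y)) x y =
    b y * (a * kernel Omega x y)}.
  move=> y yF; rewrite /singular_integrand /= indicE yF mulr1.
  by rewrite [RHS]mulrA [RHS]mulrC.
have j1 : mu.-integrable F (EFin \o (fun y => a * kernel Omega x y)).
  by apply: eq_integrable i1 => // y yF /=; rewrite E1.
have j2 : mu.-integrable F (EFin \o (fun y => b y * (a * kernel Omega x y))).
  by apply: eq_integrable i2 => // y yF /=; rewrite E2.
have j3 := integrable_scalef (b x) mF j1.
split => //.
  apply: eq_integrable (integrable_subf mF j3 j2) => // y _ /=.
  by rewrite mulrBl.
rewrite /commutator T1 T2 (eq_Rintegral _ E1) (eq_Rintegral _ E2) -RintegralZl// -RintegralB//.
by apply: eq_Rintegral => y _; rewrite mulrBl.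
Qed.

Variables (s z0 : E) (sg M c dlt : R) (b Omega : E -> R).
Hypothesis gk : good_kernel Omega s z0 sg M c dlt.
Hypothesis bl : locint s b.
Let s_gt0 := gk_s gk.

(** Size estimate: the kernel is at most a multiple of rho^(-d), and b(x) - b(y) is split at the
    free constant [beta]. *)
Lemma commutator_upper : exists2 C : R, 0 < C & forall F x0 r a x rho beta,
  measurable F -> F `<=` cube s x0 r -> 0 < r -> 0 < rho ->
  (forall y, cube s x0 r y -> rho <= wnorm s (x - y)) ->
  T_Omega_exists Omega (fun y => a * \1_F y) x ->
  T_Omega_exists Omega (b \* (fun y => a * \1_F y)) x ->
  `|commutator b Omega (fun y => a * \1_F y) x| <=
  C * `|a| * (r / rho) ^+ n.+1 * (`|b x - beta| + dev s b beta x0 r).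
Proof.
have [c1 c10 h1] := wnorm_le_enorm s_gt0; have [c2 c20 h2] := enorm_le_wnorm s_gt0.
have M0 := gk_M gk.
have v10 := cvol_gt0 s_gt0 (@ltr01 R).
exists (M * c1 ^+ n.+1 * cvol s 1); first by rewrite !mulr_gt0 ?exprn_gt0.
move=> F x0 r a x rho beta mF Fsub r0 rho0 far ex1 ex2.
have dl0 : 0 < rho / c1 by rewrite divr_gt0.
have Fd y : F y -> rho / c1 <= enorm (x - y) <= c2 * (wnorm s (x - x0) + r).
  move=> Fy; apply/andP; split.
    by rewrite ler_pdivrMr// mulrC (le_trans (far _ (Fsub _ Fy)))// h1.
  rewrite (le_trans (h2 _))// ler_wpM2l ?(ltW c20)//.
  rewrite (le_trans (wnorm_triangle s_gt0 x0 x y))// lerD2l wnormB.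
  by apply: cube_wnorm => //; [exact: ltW|exact: Fsub].
have [i1 i2 ->] := commutator_off mF dl0 Fd ex1 ex2.
have K0 : 0 <= M * (c1 / rho) ^+ n.+1 by rewrite mulr_ge0 ?exprn_ge0 ?divr_ge0 ?ltW.
have kb : {ae mu, forall y, F y -> `|kernel Omega x y| <= M * (c1 / rho) ^+ n.+1}.
  apply: filterS (gk_bound gk x) => y Oy Fy; have /andP[d1 _] := Fd y Fy.
  have en0 : 0 < enorm (x - y) by rewrite (lt_le_trans dl0).
  rewrite /kernel normrM normfV normrX (ger0_norm (enorm_ge0 _)).
  apply: ler_pM => //; first by rewrite invr_ge0 exprn_ge0 ?enorm_ge0.
  rewrite -exprVn; apply: lerXn2r; rewrite ?nnegrE ?invr_ge0 ?enorm_ge0//.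
    by rewrite divr_ge0// ltW.
  by rewrite -(invf_div rho) lef_pV2 ?posrE.
apply: (le_trans (le_normr_Rintegral mF i2)).
pose H y := `|a| * (M * (c1 / rho) ^+ n.+1) * (`|b x - beta| + `|b y - beta|).
have Hl : locint s H.
  move=> u t; apply: integrable_scalef; first exact: measurable_cube.
  apply: locintD; first exact: locint_cst.
  exact: locint_dist.
have H0 y : 0 <= H y by rewrite mulr_ge0 ?addr_ge0// mulr_ge0.
have mC : measurable (cube s x0 r) by exact: measurable_cube.
apply: (@le_trans _ _ (\int[mu]_(y in F) H y)).
  apply: ae_le_Rintegral => //.
  - by have := integrable_norm i2.
  - exact: integrableS (Hl x0 r).
  apply: filterS kb => y hk Fy; rewrite normr_ge0/= normrM normrM /H.
  rewrite mulrC; apply: ler_pM; rewrite ?mulr_ge0//.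
    by rewrite ler_wpM2l// hk.
  by rewrite -(subrKA beta (b x)) (le_trans (ler_normD _ _))// lerD2l distrC.
apply: (@le_trans _ _ (\int[mu]_(y in cube s x0 r) H y)).
  by apply: Rintegral_subset => //; exact: Hl.
rewrite RintegralZl//; last first.
  by apply: locintD; [exact: locint_cst|exact: locint_dist].
rewrite RintegralD//; [|exact: locint_cst|exact: locint_dist].
rewrite Rintegral_cube_cst// dev_eq// [`|b x - beta| * _]mulrC -mulrDr.
rewrite -[r in cvol s r]mulr1 cvolM expr_div_n (expr_div_n r).
move: (_ + dev s b beta x0 r) (cvol s 1) (c1 ^+ n.+1) (r ^+ n.+1) (rho ^+ n.+1)
  (exprn_gt0 n.+1 rho0) => D v p q u u0.
by rewrite le_eqVlt; apply/orP; left; apply/eqP; field; rewrite gt_eqF.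
Qed.

(** When [tau * (b x - m)] is nonnegative, both b(x) - b(y) and the kernel have constant sign for
    [y] in [F], so nothing cancels in the integral. Otherwise the bound is trivial. *)
Lemma commutator_lower : exists2 k : R, 0 < k & forall F x0 r a x m tau,
  measurable F -> F `<=` cube s (x0 + r *: z0) r -> 0 < r -> 0 < a ->
  `|tau| = 1 -> (forall y, F y -> tau * b y <= tau * m) ->
  ((cvol s r / 2)%:E <= mu F)%E -> cube s x0 r x ->
  T_Omega_exists Omega (fun y => a * \1_F y) x ->
  T_Omega_exists Omega (b \* (fun y => a * \1_F y)) x ->
  k * a * (tau * (b x - m)) <= `|commutator b Omega (fun y => a * \1_F y) x|.
Proof.
have [c2 c20 h2] := enorm_le_wnorm s_gt0.
have c0 := gk_c gk; have d0 := gk_dlt gk.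
have w0 := wnorm_ge0 s z0.
have [c3 c3E] : exists c3, c3 = c2 * (wnorm s z0 + 2) by eexists.
have c30 : 0 < c3 by rewrite c3E mulr_gt0// ltr_wpDl.
have v10 := cvol_gt0 s_gt0 (@ltr01 R).
have kk0 : 0 < c / c3 ^+ n.+1 * (cvol s 1 / 4) by rewrite mulr_gt0 ?divr_gt0 ?exprn_gt0.
exists (c / c3 ^+ n.+1 * (cvol s 1 / 4)) => //.
move=> F x0 r a x m tau mF Fsub r0 a0 tau1 Fb Fvol xB ex1 ex2.
have xx0 := cube_wnorm s_gt0 (ltW r0) xB.
have Q y : F y -> cube s (x + r *: z0) (2 * r) y.
  move=> /Fsub; apply: cube_sub => //.
  by rewrite opprD addrACA subrr addr0 wnormB; lra.
have Fd y : F y -> dlt * r <= enorm (x - y) <= c3 * r.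
  move=> Fy; rewrite (gk_away gk r0 (Q _ Fy))/= (le_trans (h2 _))// c3E -mulrA.
  rewrite ler_wpM2l ?(ltW c20)// wnormB.
  have := cube_wnorm s_gt0 (ltW (mulr_gt0 (ltr0n R 2) r0)) (Q _ Fy) => yQ.
  have := wnorm_triangle s_gt0 (x + r *: z0) y x.
  have := wnormZ s_gt0 z0 (ltW r0).
  by rewrite [x + _ - x]addrAC subrr add0r; lra.
have dr0 : 0 < dlt * r by rewrite mulr_gt0.
have [i1 i2 ->] := commutator_off mF dr0 Fd ex1 ex2.
have [neg|pos] := ltP (tau * (b x - m)) 0.
  apply: (@le_trans _ _ 0); last exact: normr_ge0.
  by rewrite nmulr_lle0// mulr_ge0// ltW.
(* Multiplying by two signs does not change the modulus and makes the integrand nonnegative almost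
   everywhere. *)
have -> : `|\int[mu]_(y in F) ((b x - b y) * (a * kernel Omega x y))| =
    `|\int[mu]_(y in F) (tau * sg * ((b x - b y) * (a * kernel Omega x y)))|.
  by rewrite RintegralZl// normrM normrM tau1 (gk_sg gk) !mul1r.
apply: le_trans (ler_norm _).
pose G := F `&` [set y | c < sg * Omega (x - y)].
have mG : measurable G.
  have /measurable_EFinP mk := measurable_int mu i1.
  have mh : measurable_fun F (fun y => sg * (a^-1 * (a * kernel Omega x y) * enorm (x - y) ^+ n.+1)).
    apply: measurable_funM; first exact: measurable_cst.
    apply: measurable_funM.
      by apply: measurable_funM; [exact: measurable_cst|exact: mk].
    apply: measurable_funX; apply: measurable_funTS.
    exact: (continuous_measurable_rV (@dist_continuous _ _ x)).
  have := mh mF _ (measurable_itv `]c, +oo[); congr measurable.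
  apply/seteqP; split=> y [Fy]; rewrite /= in_itv/= andbT => h; split => //; move: h;
    have /andP[en _] := Fd y Fy; have en0 := lt_le_trans dr0 en;
    rewrite /kernel mulKf ?gt_eqF// divfK// gt_eqF// exprn_gt0//.
have Ffin : (mu F < +oo)%E.
  apply: (@le_lt_trans _ _ (mu (cube s (x0 + r *: z0) r))); last exact: leb_cube_lty.
  by apply: le_measure; rewrite ?inE//; exact: measurable_cube.
have iG : mu.-integrable F (EFin \o (\1_G : E -> R)) by exact: integrable_indic_lty.
(* [F] has at least half of the volume of a cube of radius [r], and the points where the kernel may
   be small take at most a quarter of it. *)
have Gvol : cvol s r / 4 <= fine (mu G).
  have Gfin : mu G \is a fin_num.
    rewrite ge0_fin_numE// (le_lt_trans _ Ffin)//.
    by apply: le_measure; rewrite ?inE// => y [].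
  have : (mu F <= mu G + (cvol s r / 4)%:E)%E.
    rewrite /leb; apply: (@le_trans _ _ (outer (G `|` (F `\` G)))).
      by apply: le_outer_measure => y Fy; have [Gy|Gy] := pselect (G y); [left|right].
    apply: (le_trans (outer_measureU2 _ _ _)); rewrite leeD2l//.
    apply: le_trans (gk_dense gk x r0); apply: le_outer_measure => y [Fy Gy].
    by split; [exact: Q|rewrite leNgt; apply/negP => h; apply: Gy].
  rewrite -(fineK Gfin) -EFinD => h; have := le_trans Fvol h.
  by rewrite lee_fin; lra.
pose k0 := a * c / (c3 * r) ^+ n.+1 * (tau * (b x - m)).
have ac0 : 0 < a * c / (c3 * r) ^+ n.+1.
  by apply: divr_gt0; [exact: mulr_gt0|apply: exprn_gt0; exact: mulr_gt0].
have k00 : 0 <= k0 by rewrite mulr_ge0// ltW.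
apply: (@le_trans _ _ (\int[mu]_(y in F) (k0 * \1_G y))); last first.
  apply: ae_le_Rintegral => //.
  - by apply: integrable_scalef => //; exact: iG.
  - exact: integrable_scalef.
  apply: filterS (gk_sign gk x r0) => y Oy Fy.
  have {}Oy := Oy (Q _ Fy); have by_ := Fb y Fy.
  rewrite mulr_ge0//= ; have /andP[en1 en2] := Fd y Fy.
  have en0 := lt_le_trans dr0 en1.
  have -> : tau * sg * ((b x - b y) * (a * kernel Omega x y)) =
      a * (sg * Omega (x - y)) / enorm (x - y) ^+ n.+1 * (tau * (b x - b y)).
    by rewrite /kernel; ring.
  rewrite indicE; have [/set_mem[_ /= cG]|_] := boolP (y \in G); last first.
    rewrite mulr0; apply: mulr_ge0; last by move: pos by_; rewrite !mulrBr; lra.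
    by apply: divr_ge0; [apply: mulr_ge0; [exact: ltW|exact: Oy]|apply: exprn_ge0; exact: enorm_ge0].
  rewrite mulr1 /k0; apply: ler_pM => //.
  - exact: ltW.
  - apply: ler_pM.
    + by apply: mulr_ge0; exact: ltW.
    + by rewrite invr_ge0; apply: exprn_ge0; apply: mulr_ge0; exact: ltW.
    + by apply: ler_wpM2l; exact: ltW.
    have cr0 : 0 < c3 * r by exact: mulr_gt0.
    rewrite lef_pV2 ?posrE; [|exact: exprn_gt0|exact: exprn_gt0].
    by apply: lerXn2r; rewrite ?nnegrE ?enorm_ge0// mulr_ge0// ltW.
  - by rewrite !mulrBr lerD2l lerN2.
rewrite (RintegralZl _ mF iG).
have -> : \int[mu]_(y in F) (\1_G y : R) = fine (mu G).
  by rewrite /Rintegral integral_indic// setIidl// => y [].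
apply: (@le_trans _ _ (k0 * (cvol s r / 4))); last by rewrite ler_wpM2l.
have vE : cvol s r = r ^+ n.+1 * cvol s 1 by rewrite -cvolM mulr1.
rewrite /k0 vE (exprMn _ c3 r).
have : 0 < c3 ^+ n.+1 by rewrite exprn_gt0.
have : 0 < r ^+ n.+1 by rewrite exprn_gt0.
move: (c3 ^+ n.+1) (r ^+ n.+1) (cvol s 1) (tau * (b x - m)) => p q v u q0 p0.
by rewrite le_eqVlt; apply/orP; left; apply/eqP; field; rewrite !gt_eqF.
Qed.

End commutator_formula.

(** * Medians *)

Section median.
Context d (T : measurableType d) (R : realType) (mu : {measure set T -> \bar R}).
Implicit Types (P : set T) (b : T -> R) (F : nat -> set T).

Lemma bigcup_le F (c : \bar R) : (forall k, measurable (F k)) ->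
  (forall k, F k `<=` F k.+1) -> (forall k, (mu (F k) <= c)%E) ->
  (mu (\bigcup_k F k) <= c)%E.
Proof.
move=> mF ndF Fc.
have h : mu \o F @ \oo --> mu (\bigcup_k F k).
  apply: nondecreasing_cvg_mu => //; first exact: bigcup_measurable.
  by apply/nondecreasing_seqP => k; exact/subsetPset.
by rewrite -(cvg_lim _ h)//; apply: lime_le; [exact: cvgP h|exact: nearW].
Qed.

Lemma bigcap_ge F (c : \bar R) : (forall k, measurable (F k)) ->
  (mu (F 0%N) < +oo)%E ->
  (forall k, F k.+1 `<=` F k) -> (forall k, (c <= mu (F k))%E) ->
  (c <= mu (\bigcap_k F k))%E.
Proof.
move=> mF F0 niF Fc.
have h : mu \o F @ \oo --> mu (\bigcap_k F k).
  apply: nonincreasing_cvg_mu => //; first exact: bigcap_measurable.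
  by apply/nonincreasing_seqP => k; exact/subsetPset.
by rewrite -(cvg_lim _ h)//; apply: lime_ge; [exact: cvgP h|exact: nearW].
Qed.

Let low P b (t : R) := P `&` [set y | b y <= t].

(** The median is the infimum of the levels whose sublevel set fills half of [P]; continuity of the
    measure from above gives the first half. *)
Lemma median P b (v : R) : measurable P -> measurable_fun setT b ->
  mu P = v%:E -> 0 < v ->
  exists m : R, ((v / 2)%:E <= mu (P `&` [set y | (b y <= m)%R]))%E /\
            ((v / 2)%:E <= mu (P `&` [set y | (m <= b y)%R]))%E.
Proof.
move=> mP mb muP v0.
have mlow t : measurable (low P b t).
  apply: measurableI => //; rewrite -[X in measurable X]setTI.
  have := mb measurableT _ (measurable_itv `]-oo, t]).
  by congr measurable; apply/seteqP; split=> y [_]; rewrite /= in_itv/=.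
have low_le t u : t <= u -> low P b t `<=` low P b u.
  by move=> tu y [Py /= yt]; split => //=; exact: le_trans tu.
have vlt : ((v / 2)%:E < v%:E)%E by rewrite lte_fin ltr_pdivrMr// ltr_pMr// ltr1n.
have lowfin t : (mu (low P b t) < +oo)%E.
  apply: (@le_lt_trans _ _ (mu P)); last by rewrite muP ltry.
  by apply: le_measure; rewrite ?inE// => y [].
pose S := [set t : R | ((v / 2)%:E <= mu (low P b t))%E].
have S0 : S !=set0.
  apply/set0P/negP => /eqP S0.
  have PE : \bigcup_k low P b k%:R = P.
    apply/seteqP; split=> [y [k _ []]//|y Py].
    exists (Num.truncn `|b y|).+1 => //; split => //=.
    by rewrite (le_trans (ler_norm _))// ltW// truncnS_gt.
  have : (mu P <= (v / 2)%:E)%E.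
    rewrite -{1}PE; apply: bigcup_le => // k; first by apply: low_le; rewrite ler_nat.
    rewrite leNgt; apply/negP => h.
    have Sk : S k%:R by exact: ltW.
    by rewrite S0 in Sk.
  by rewrite muP leNgt vlt.
have Slb : has_lbound S.
  apply: contrapT => noS.
  have PE : \bigcap_k low P b (- k%:R) = set0.
    apply/seteqP; split=> // y h.
    have [_ /=] := h (Num.truncn `|b y|).+1 Logic.I; rewrite leNgt => /negP; apply.
    by rewrite ltrNl (le_lt_trans (ler_norm _))// normrN truncnS_gt.
  have : ((v / 2)%:E <= mu set0)%E.
    rewrite -PE; apply: bigcap_ge => // k.
      by apply: low_le; rewrite lerN2 ler_nat.
    have /existsNP[t /not_implyP[St /negP]] : ~ lbound S (- k%:R).
      by apply: contra_not noS => h; exists (- k%:R).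
    rewrite -ltNge => tk; apply: (le_trans St).
    by apply: le_measure; rewrite ?inE//; apply: low_le; exact: ltW.
  by rewrite measure0 lee_fin leNgt divr_gt0.
have hinf : has_inf S by [].
exists (inf S); split.
  have PE : \bigcap_k low P b (inf S + k.+1%:R^-1) = low P b (inf S).
    apply/seteqP; split=> [y h|y yS k _]; last first.
      by apply: low_le yS; rewrite lerDl invr_ge0.
    split; first by have [] := h 0%N Logic.I.
    rewrite /= leNgt; apply/negP => lt; have d0 : 0 < b y - inf S by rewrite subr_gt0.
    have [_ /=] := h (Num.truncn (b y - inf S)^-1) Logic.I.
    rewrite -lerBlDl leNgt => /negP; apply.
    by rewrite -[ltRHS]invrK ltf_pV2 ?posrE ?invr_gt0// truncnS_gt.
  rewrite -/(low P b (inf S)) -PE; apply: bigcap_ge => // k.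
    by apply: low_le; rewrite lerD2l lef_pV2 ?posrE// ler_nat.
  have k0 : 0 < k.+1%:R^-1 :> R by rewrite invr_gt0.
  have [t St tlt] := inf_adherent k0 hinf.
  apply: (le_trans St).
  by apply: le_measure; rewrite ?inE//; apply: low_le; exact: ltW.
(* This is the strict sublevel set at the infimum. By continuity from below it has at most half of
   the measure, and its complement in [P] is the upper set. *)
pose U := \bigcup_k low P b (inf S - k.+1%:R^-1).
have mU : measurable U by apply: bigcup_measurable.
have UP : U `<=` P by move=> y [k _ []].
have Ule : (mu U <= (v / 2)%:E)%E.
  apply: bigcup_le => // k.
    by apply: low_le; rewrite lerD2l lerN2 lef_pV2 ?posrE// ler_nat.
  rewrite leNgt; apply/negP => h.
  have : inf S <= inf S - k.+1%:R^-1 by apply: ge_inf => //; exact: ltW.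
  by rewrite leNgt => /negP; apply; rewrite ltrBlDr ltrDl invr_gt0.
have <- : P `\` U = P `&` [set y | inf S <= b y].
  apply/seteqP; split=> y [Py h]; split => //=.
    rewrite leNgt; apply/negP => lt; apply: h.
    have d0 : 0 < inf S - b y by rewrite subr_gt0.
    exists (Num.truncn (inf S - b y)^-1) => //; split => //=.
    rewrite lerBrDl -lerBrDr ltW// -[ltRHS]invrK ltf_pV2 ?posrE ?invr_gt0//.
    exact: truncnS_gt.
  move=> [k _ [_ /= yk]]; move: h => /=; rewrite leNgt => /negP; apply.
  by rewrite (le_lt_trans yk)// ltrBlDr ltrDl invr_gt0.
have Ufin : mu U \is a fin_num.
  by rewrite ge0_fin_numE// (le_lt_trans Ule)// ltry.
have PU : P `&` U = U by apply/setIidPr.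
have e : (v%:E = mu (P `\` U) + mu U)%E by rewrite -muP -{2}PU; exact: measureDI.
have Dfin : mu (P `\` U) \is a fin_num.
  rewrite ge0_fin_numE// (@le_lt_trans _ _ (mu P))//; last by rewrite muP ltry.
  by apply: le_measure; rewrite ?inE//; exact: measurableD.
move: Ule e; rewrite -(fineK Ufin) -(fineK Dfin) -EFinD !lee_fin => Ule [e].
by lra.
Qed.

End median.

Section pointed_element.
Variables (R : realType) (n : nat) (X : normedFunctionSpace R n).

Let zero_lty : (X (fun=> 0%R) < +oo)%E.
Proof. by rewrite fnorm0 ltry. Qed.

HB.instance Definition _ := isPointed.Build (element X) (Element zero_lty).

End pointed_element.

(** * Finite nets and the pigeonhole principle *)

Section compact_operator.
Variables (R : realType) (n : nat) (X : normedFunctionSpace R n).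
Local Notation E := 'rV[R]_n.+1.
Implicit Types (f g : E -> R) (D : set (E -> R)) (T : (E -> R) -> (E -> R)).

Lemma element_ball_interior (f : element X) (e : R) : 0 < e ->
  interior (element_ball f e : set (element X)) f.
Proof. by move=> e0; apply/nbhs_ballP; exists e. Qed.

(** Interiors of the balls of radius [e] cover the closure of the image of the unit ball, which is
    compact; a finite subcover gives the centers. *)
Lemma compact_operator_net D T (e : R) : compact_operator X D T -> 0 < e ->
  exists S : seq (element X), forall f, (X f <= 1)%E ->
    exists2 g : element X, g \in S & (X (g \- T f)%R < e%:E)%E.
Proof.
move=> [TX TC] e0.
pose A := [set f : element X | (X f <= 1)%E].
have /TC : exists M : R, forall f : element X, A f -> (X f <= M%:E)%E by exists 1.
rewrite precompactE; set K := closure _ => cK.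
rewrite compact_cover in cK.
have [|g Kg|S SK] := cK (element X) K (fun g : element X => interior (element_ball g e)).
- by move=> g _; exact: open_interior.
- by exists g => //; exact: element_ball_interior.
move=> cov; exists (finmap.enum_fset S) => f f1.
have fX : (X f < +oo)%E by rewrite (le_lt_trans f1)// ltry.
have [_ TfX] := TX f fX.
have : K (Element TfX) by apply: subset_closure; exists (Element fX).
by move=> /cov[g gS /interior_subset]; exists g.
Qed.

Lemma fnorm_distC f g : (X (f \- g)%R < +oo)%E -> X (f \- g)%R = X (g \- f)%R.
Proof.
move=> fg; rewrite (_ : (g \- f)%R = fun x => -1 * (f \- g) x)%R.
  by rewrite fnormZ// normrN1 mul1e.
by apply/funext => x /=; rewrite mulN1r opprB.
Qed.

Lemma compact_operator_bounded D T : compact_operator X D T ->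
  exists2 C : R, 0 < C & forall f, (X f <= 1)%E -> (X (T f) <= C%:E)%E.
Proof.
move=> cT; have [S hS] := compact_operator_net cT ltr01.
pose C := \sum_(g <- S) fine (X g) + 1.
have C0 : 0 <= \sum_(g <- S) fine (X g).
  by apply: sumr_ge0 => g _; rewrite fine_ge0// fnorm_ge0.
exists C; first by rewrite ltr_wpDl.
move=> f /hS[g gS gf].
have -> : T f = (g \+ (T f \- g))%R by apply/funext => x /=; rewrite addrC subrK.
rewrite (le_trans (fnormD _ _ _))// EFinD leeD//.
  rewrite -(fineK (fnorm_fin (element_lty g))) lee_fin (big_rem g)//= lerDl.
  by apply: sumr_ge0 => h _; rewrite fine_ge0// fnorm_ge0.
by rewrite -fnorm_distC ?ltW// (lt_trans gf)// ltry.
Qed.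

(** Among one more image than there are centers in an [e / 2] net, two are close to the same
    center. *)
Lemma compact_operator_pigeonhole D T (e : R) (f : nat -> (E -> R)) :
  compact_operator X D T -> 0 < e -> (forall k, (X (f k) <= 1)%E) ->
  exists i j, (i < j)%N /\ (X (T (f i) \- T (f j))%R < e%:E)%E.
Proof.
move=> cT e0 f1; have e20 : 0 < e / 2 by rewrite divr_gt0.
have [S hS] := compact_operator_net cT e20.
have /choice[h hh] : forall k, exists g : element X, g \in S /\ (X (g \- T (f k))%R < (e / 2)%:E)%E.
  by move=> k; have [g gS gf] := hS _ (f1 k); exists g.
pose N := size S.
have : ~~ uniq [seq h i | i <- iota 0 N.+1].
  apply/negP => /uniq_leq_size/(_ _); rewrite size_map size_iota.
  move=> /(_ S); rewrite ltnn => H; suff : false by [].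
  by apply: H => _ /mapP[i _ ->]; have [] := hh i.
have close i j : (i < j)%N -> h i = h j -> (X (T (f i) \- T (f j))%R < e%:E)%E.
  move=> ij hij.
  have -> : (T (f i) \- T (f j))%R = ((T (f i) \- h i) \+ (h j \- T (f j)))%R.
    by apply/funext => x /=; rewrite hij addrA subrK.
  rewrite (le_lt_trans (fnormD _ _ _))// [e](splitr e) EFinD lteD//.
    by have [_ hi] := hh i; rewrite -fnorm_distC// (lt_trans hi)// ltry.
  by have [_] := hh j.
move=> nu; apply: contrapT => no; move/negP : nu; apply.
rewrite map_inj_in_uniq ?iota_uniq// => i j _ _ hij.
have [ij|ji|//] := ltngtP i j; exfalso; apply: no.
  by exists i, j; split => //; exact: close.
by exists j, i; split => //; exact: close.
Qed.

End compact_operator.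

(** * Test functions and bounded mean oscillation *)

Section necessity.
Variables (R : realType) (n : nat) (X : normedFunctionSpace R n).
Local Notation E := 'rV[R]_n.+1.
Local Notation mu := (@leb R n).
Variables (b Omega : E -> R) (s z0 : E) (sg M c dlt : R).
Hypothesis bX : is_ball_banach X.
Hypothesis maxX : maximal_bounded X.
Hypothesis gk : good_kernel Omega s z0 sg M c dlt.
Hypothesis bl : locint s b.
Hypothesis cT : compact_operator X (commutator_dom b Omega) (commutator b Omega).
Implicit Types (x y z w : E) (r t u rho beta m : R) (F : set E) (f g : E -> R).
Local Notation cube := (cube s).
Local Notation cvol := (cvol s).
Local Notation wnorm := (wnorm s).
Local Notation osc := (osc s).
Local Notation dev := (dev s).
Local Notation mean := (mean s).
Local Notation ncube := (ncube s X).
Local Notation T := (commutator b Omega).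
Let s_gt0 := gk_s gk.

Definition companion x r := x + r *: z0.

Definition test_fun x r F : E -> R :=
  fun y => (ncube (companion x r) r)^-1 * \1_F y.

Definition integral_abs f x r : R := \int[mu]_(y in cube x r) `|f y|.

Let np_gt0 x r : 0 < r -> 0 < ncube (companion x r) r.
Proof. by move=> r0; exact: ncube_gt0. Qed.

Lemma companion_norm x r : 0 <= r -> wnorm (x - companion x r) <= r * wnorm z0.
Proof.
by move=> r0; rewrite /companion wnormB addrAC subrr add0r wnormZ.
Qed.

Lemma test_fun_le1 x r F : measurable F -> F `<=` cube (companion x r) r ->
  0 < r -> (X (test_fun x r F) <= 1)%E.
Proof.
move=> mF Fsub r0; have N0 := np_gt0 x r0.
have XF : (X \1_F <= X \1_(cube (companion x r) r))%E.
  apply: (lattice_le bX); first exact: measurable_indic.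
  apply: aeW => y; rewrite !indicE !ger0_norm// ler_nat.
  have [/set_mem/Fsub yF|//] := boolP (y \in F).
  by rewrite [X in (_ <= nat_of_bool X)%N]mem_set.
rewrite (ncubeE s_gt0 bX) in XF.
rewrite fnormZ; last by rewrite (le_lt_trans XF)// ltry.
rewrite ger0_norm ?invr_ge0 ?(ltW N0)// lee_pdivrMl//.
by rewrite mule1.
Qed.

Lemma test_fun_exists x r F : measurable F -> F `<=` cube (companion x r) r ->
  0 < r -> {ae mu, forall y, T_Omega_exists Omega (test_fun x r F) y /\
    T_Omega_exists Omega (b \* test_fun x r F) y}.
Proof.
move=> mF Fsub r0; have [TX _] := cT.
have [|h _] := TX (test_fun x r F); last exact: h.
by rewrite (le_lt_trans (test_fun_le1 mF Fsub r0))// ltry.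
Qed.

Lemma T_lty f : (X f <= 1)%E -> (X (T f) < +oo)%E.
Proof.
by move=> f1; have [TX _] := cT; have [|] := TX f => //; rewrite (le_lt_trans f1)// ltry.
Qed.

Lemma T_locint f : (X f <= 1)%E -> locint s (T f).
Proof. by move=> f1; apply: (fnorm_locint s_gt0 bX); exact: T_lty. Qed.

(** [rho] is quantified after [x], so that one null set serves all distances. *)
Lemma test_fun_upper : exists2 C : R, 0 < C & forall x0 r F beta,
  measurable F -> F `<=` cube (companion x0 r) r -> 0 < r ->
  {ae mu, forall x, forall rho, 0 < rho ->
    (forall y, cube (companion x0 r) r y -> rho <= wnorm (x - y)) ->
    ncube (companion x0 r) r * `|T (test_fun x0 r F) x| <=
    C * (r / rho) ^+ n.+1 * (`|b x - beta| + dev b beta (companion x0 r) r)}.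
Proof.
have [C C0 hC] := commutator_upper gk bl; exists C => //.
move=> x0 r F beta mF Fsub r0; have N0 := np_gt0 x0 r0.
apply: filterS (test_fun_exists mF Fsub r0) => x [ex1 ex2] rho rho0 far.
have := hC F _ r _ x rho beta mF Fsub r0 rho0 far ex1 ex2.
rewrite -(ler_pM2l N0) => /le_trans; apply.
rewrite (ger0_norm (ltW _)) ?invr_gt0//.
rewrite le_eqVlt; apply/orP; left; apply/eqP.
move: (_ + dev _ _ _ _) ((r / rho) ^+ n.+1) => D q.
by move: N0; move: (ncube _ _) => N N0; field; rewrite gt_eqF.
Qed.

Lemma ncube_companion : exists2 C : R, 0 < C & forall x r, 0 < r ->
  ncube (companion x r) r <= C * ncube x r.
Proof.
have [C C0 hC] := ncube_doubling s_gt0 bX maxX.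
have w0 := wnorm_ge0 s z0.
exists (C * (wnorm z0 + 1) ^+ n.+1); first by rewrite mulr_gt0// exprn_gt0// ltr_wpDl.
move=> x r r0.
have A0 : 0 < (wnorm z0 + 1) * r by rewrite mulr_gt0// ltr_wpDl.
have sub : cube x r `<=` cube (companion x r) ((wnorm z0 + 1) * r).
  by apply: (cube_sub s_gt0); have := companion_norm x (ltW r0); lra.
apply: le_trans (hC _ _ _ _ _ r0 sub A0 (lexx _)).

apply: (ncube_le s_gt0 bX); apply: (cube_sub s_gt0); rewrite subrr wnorm0// add0r.
by rewrite ler_peMl ?(ltW r0)// lerDr.
Qed.

Lemma integral_abs_ge0 f x r : 0 <= integral_abs f x r.
Proof. exact: Rintegral_ge0. Qed.

Let abs_le_add (a t A B : R) : 0 <= A -> 0 <= B -> a * t <= A -> a * - t <= B ->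
  a * `|t| <= A + B.
Proof. by case: (ger0P t) => _; lra. Qed.

(** The parts of the companion below and above a median of [b] are both tested. The first image
    controls the positive part of b - m, the second one the negative part, and the set with the
    larger integral is kept. *)
Lemma test_set_exists : exists2 k : R, 0 < k & forall x0 r, 0 < r ->
  exists F, [/\ measurable F, F `<=` cube (companion x0 r) r &
    k * cvol r * osc b x0 r <=
    ncube (companion x0 r) r * integral_abs (T (test_fun x0 r F)) x0 r].
Proof.
have [k k0 hk] := commutator_lower b gk; exists (k / 4); first by rewrite divr_gt0.
move=> x0 r r0; have N0 := np_gt0 x0 r0; have v0 := cvol_gt0 s_gt0 r0.
set P := cube (companion x0 r) r.
have mP : measurable P by exact: measurable_cube.
have mb := locint_measurable s_gt0 bl.
have [m [m1 m2]] := median mP mb (leb_cube s_gt0 (companion x0 r) (ltW r0)) v0.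
pose Fp := P `&` [set y | b y <= m]; pose Fm := P `&` [set y | m <= b y].
have mFp : measurable Fp.
  apply: measurableI => //; rewrite -[X in measurable X]setTI.
  have := mb measurableT _ (measurable_itv `]-oo, m]).
  by congr measurable; apply/seteqP; split=> y [_]; rewrite /= in_itv/=.
have mFm : measurable Fm.
  apply: measurableI => //; rewrite -[X in measurable X]setTI.
  have := mb measurableT _ (measurable_itv `[m, +oo[).
  by congr measurable; apply/seteqP; split=> y [_]; rewrite /= in_itv/= andbT.
have sFp : Fp `<=` P by move=> y [].
have sFm : Fm `<=` P by move=> y [].
pose N := ncube (companion x0 r) r.
have a0 : 0 < N^-1 by rewrite invr_gt0.
have lp := T_locint (test_fun_le1 mFp sFp r0).
have lm := T_locint (test_fun_le1 mFm sFm r0).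
pose Ip := integral_abs (T (test_fun x0 r Fp)) x0 r.
pose Im := integral_abs (T (test_fun x0 r Fm)) x0 r.
have bound : k * N^-1 * (cvol r * dev b m x0 r) <= Ip + Im.
  rewrite -dev_eq// -RintegralZl; [|exact: measurable_cube|exact: locint_dist].
  rewrite /Ip /Im /integral_abs -RintegralD; [|exact: measurable_cube|exact: locint_norm|exact: locint_norm].
  apply: ae_le_Rintegral.
  - exact: measurable_cube.
  - by apply: integrable_scalef; [exact: measurable_cube|exact: locint_dist].
  - by apply: locintD; exact: locint_norm.
  apply: filterS2 (test_fun_exists mFp sFp r0) (test_fun_exists mFm sFm r0).
  move=> x [e1 e2] [e3 e4] xB.
  have kN0 : 0 <= k * N^-1 by rewrite mulr_ge0// ltW.
  rewrite mulr_ge0//=.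
  have h1 : k * N^-1 * (b x - m) <= `|T (test_fun x0 r Fp) x|.
    have hb y : Fp y -> 1 * b y <= 1 * m by move=> [_ /= ?]; rewrite !mul1r.
    have := hk Fp x0 r N^-1 x m 1 mFp sFp r0 a0 (normr1 _) hb m1 xB e1 e2.
    by rewrite mul1r.
  have h2 : k * N^-1 * (m - b x) <= `|T (test_fun x0 r Fm) x|.
    have hb y : Fm y -> -1 * b y <= -1 * m by move=> [_ /= ?]; rewrite !mulN1r lerN2.
    have := hk Fm x0 r N^-1 x m (-1) mFm sFm r0 a0 (normrN1 _) hb m2 xB e3 e4.
    by rewrite mulN1r opprB.
  rewrite -(opprB (b x)) in h2.
  exact: (abs_le_add (normr_ge0 _) (normr_ge0 _) h1 h2).
have osc_dev := osc_le s_gt0 m x0 bl r0.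
(* One factor 2 is the passage from the median to the mean, the other one the choice between two
   sets. *)
have le4 : k / 4 * cvol r * osc b x0 r <= N * ((Ip + Im) / 2).
  have h : k / 4 * cvol r * osc b x0 r <= k / 4 * cvol r * (2 * dev b m x0 r).
    by rewrite ler_wpM2l// mulr_ge0 ?divr_ge0// ltW.
  apply: (le_trans h); rewrite -(ler_pM2l a0) mulKf ?gt_eqF//.
  move: bound; move: (N^-1) (cvol r) (dev b m x0 r) => a v D; lra.
have N00 : 0 <= N by exact: ltW.
have [pm|mp] := leP Im Ip.
  exists Fp; split; [exact: mFp|exact: sFp|apply: (le_trans le4)].
  by apply: ler_wpM2l; [exact: N00|rewrite -/Ip; lra].
exists Fm; split; [exact: mFm|exact: sFm|apply: (le_trans le4)].
by apply: ler_wpM2l; [exact: N00|rewrite -/Im; lra].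
Qed.

(** The images of the test functions are bounded in X; [maximal_average] turns this into a bound on
    their means, once the norms of the indicators of a cube and its companion are compared. *)
Lemma osc_bounded : exists2 B : R, 0 < B & forall x r, 0 < r -> osc b x r <= B.
Proof.
have [k k0 hk] := test_set_exists.
have [C C0 hC] := maximal_average s_gt0 bX maxX.
have [D D0 hD] := ncube_companion.
have [B B0 hB] := compact_operator_bounded cT.
exists (C * B * D / k); first by rewrite divr_gt0// !mulr_gt0.
move=> x r r0; have [F [mF Fsub h]] := hk x r r0.
have v0 := cvol_gt0 s_gt0 r0; have N0 := ncube_gt0 s_gt0 bX x r0.
have f1 := test_fun_le1 mF Fsub r0.
have := hC _ x r (T_lty f1) r0; rewrite -/(integral_abs _ x r).
have : fine (X (T (test_fun x r F))) <= B.
  by rewrite -lee_fin (fineK (fnorm_fin (T_lty f1))) hB.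
move: h (hD x r r0) (integral_abs_ge0 (T (test_fun x r F)) x r).
move: (integral_abs _ _ _) (ncube _ _) (ncube x r) N0 (fine _) (osc b x r) (cvol r) v0.
move=> I P N N0 t o v v0 h1 PN I0 tB h2.
rewrite ler_pdivlMr// -(ler_pM2l v0) -(ler_pM2r N0).
have e1 : v * (o * k) * N <= P * I * N.
  by rewrite ler_wpM2r ?(ltW N0)// (le_trans _ h1)// le_eqVlt; apply/orP; left; apply/eqP; ring.
apply: (le_trans e1); rewrite -mulrA.
have e2 : I * N <= C * v * B by rewrite (le_trans h2)// ler_wpM2l// mulr_ge0 ?ltW.
have e3 : P * (I * N) <= D * N * (C * v * B).
  apply: (@le_trans _ _ (D * N * (I * N))).
    by rewrite ler_wpM2r// mulr_ge0// ltW.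
  by rewrite ler_wpM2l// mulr_ge0// ltW.
by apply: (le_trans e3); rewrite le_eqVlt; apply/orP; left; apply/eqP; ring.
Qed.

End necessity.

(** * Size of the images near and far from a companion cube *)

Section separation.
Variables (R : realType) (n : nat) (X : normedFunctionSpace R n).
Local Notation E := 'rV[R]_n.+1.
Local Notation mu := (@leb R n).
Variables (b Omega : E -> R) (s z0 : E) (sg M c dlt : R).
Hypothesis bX : is_ball_banach X.
Hypothesis maxX : maximal_bounded X.
Hypothesis gk : good_kernel Omega s z0 sg M c dlt.
Hypothesis bl : locint s b.
Hypothesis cT : compact_operator X (commutator_dom b Omega) (commutator b Omega).
Implicit Types (x y z w : E) (r t u rho beta m N D : R) (F Z : set E) (f g : E -> R).
Local Notation cube := (cube s).
Local Notation cvol := (cvol s).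
Local Notation wnorm := (wnorm s).
Local Notation osc := (osc s).
Local Notation dev := (dev s).
Local Notation mean := (mean s).
Local Notation ncube := (ncube s X).
Local Notation T := (commutator b Omega).
Local Notation companion := (companion z0).
Local Notation test_fun := (test_fun X s z0).
Local Notation integral_abs := (integral_abs s).
Let s_gt0 := gk_s gk.

Lemma integral_bound f Z x r N D beta B0 : locint s f -> measurable Z ->
  Z `<=` cube x r -> 0 < r -> 0 <= N -> 0 <= D -> 0 <= B0 ->
  {ae mu, forall y, Z y -> N * `|f y| <= D * (`|b y - beta| + B0)} ->
  N * \int[mu]_(y in Z) `|f y| <= D * cvol r * (dev b beta x r + B0).
Proof.
move=> fl mZ Zsub r0 N0 D0 B00 h.
have mC : measurable (cube x r) by exact: measurable_cube.
have Hl : locint s (fun y => D * (`|b y - beta| + B0)).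
  move=> z t; apply: integrable_scalef; first exact: measurable_cube.
  by apply: locintD; [exact: locint_dist|exact: locint_cst].
have fZ : mu.-integrable Z (EFin \o (fun y => `|f y|)).
  by apply: (integrableS mC mZ Zsub); exact: locint_norm.
rewrite -RintegralZl//.
apply: (@le_trans _ _ (\int[mu]_(y in Z) (D * (`|b y - beta| + B0)))).
  apply: ae_le_Rintegral => //.
  - exact: integrable_scalef.
  - exact: (integrableS mC mZ Zsub (Hl _ _)).
  by apply: filterS h => y hy Zy; rewrite mulr_ge0//= hy.
apply: (@le_trans _ _ (\int[mu]_(y in cube x r) (D * (`|b y - beta| + B0)))).
  apply: (Rintegral_subset mZ mC (Hl x r) _ Zsub) => y _.
  by rewrite mulr_ge0// addr_ge0.
rewrite RintegralZl//; last first.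
  by apply: locintD; [exact: locint_dist|exact: locint_cst].
rewrite RintegralD//; [|exact: locint_dist|exact: locint_cst].
rewrite (Rintegral_cube_cst s_gt0)// (dev_eq s_gt0)//.
by rewrite le_eqVlt; apply/orP; left; apply/eqP; ring.
Qed.

Lemma dev_mean_le beta x r B : 0 < r -> osc b x r <= B ->
  dev b beta x r <= B + `|mean b x r - beta|.
Proof.
move=> r0 oB; apply: (le_trans (dev_shift s_gt0 (mean b x r) _ _ bl r0)).
by rewrite lerD2r.
Qed.

Lemma companion_far : exists2 e : R, 0 < e & forall x r w y, 0 < r ->
  cube x r w -> cube (companion x r) r y -> e * r <= wnorm (w - y).
Proof.
have [c2 c20 h2] := enorm_le_wnorm s_gt0; have d0 := gk_dlt gk.
exists (dlt / c2); first by rewrite divr_gt0.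
move=> x r w y r0 xw xy.
rewrite mulrAC ler_pdivrMr// mulrC [wnorm _ * _]mulrC.
apply: le_trans (h2 _); rewrite mulrC; apply: (gk_away gk r0).
move: xy; apply: (cube_sub s_gt0); rewrite /companion opprD addrACA subrr addr0 wnormB.
by have := cube_wnorm s_gt0 (ltW r0) xw; lra.
Qed.

Let twoE (a d : R) : a + d + a = 2 * a + d.
Proof. by ring. Qed.

Let near_algebra (a u p v : R) : 1 <= a -> 0 <= u -> 0 <= v -> 0 <= p ->
  2 * v + ((u + a) * p * v + a * p * v) <= (u + 1) * (v * (2 + (a + a) * p)).
Proof.
move=> a1 u0 v0 p0; rewrite -subr_ge0.
have -> : (u + 1) * (v * (2 + (a + a) * p)) - (2 * v + ((u + a) * p * v + a * p * v)) =
  u * v * 2 + u * (v * p) * (a - 1) + u * (v * p) * a by ring.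
by rewrite !addr_ge0// !mulr_ge0// ?subr_ge0// (le_trans _ a1).
Qed.

(** On a small cube inside the large one, [F] stays at distance comparable to [r] and the kernel is
    harmless; only the mean of [b] may have moved, by a multiple of [q], and the volume [2 ^- q]
    beats it. The center [w] is arbitrary, so that it can be the companion of another cube. *)
Lemma near_bound : exists2 C : R, 0 < C & forall q x r w F, 0 < r ->
  measurable F -> F `<=` cube (companion x r) r ->
  ncube (companion x r) r *
    \int[mu]_(y in cube x r `&` cube w (2 ^- q * r)) `|T (test_fun x r F) y| <=
  C * (q.+1%:R / 2 ^+ q) * cvol r.
Proof.
have [B B0 hB] := osc_bounded bX maxX gk bl cT.
have [C C0 hC] := test_fun_upper bX gk bl cT.
have [e e0 he] := companion_far.
have w0 := wnorm_ge0 s z0.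
(* Chosen so that radius [2 ^+ l * r] around [x] reaches the companion center as well as any [w]
   whose small cube meets [cube x r]. *)
pose l := (Num.truncn (wnorm z0)).+3.
have lw : wnorm z0 + 2 < 2 ^+ l.
  apply: (@lt_le_trans _ _ l%:R); last by rewrite -natrX ler_nat ltnW// ltn_expl.
  by rewrite /l -(natr1 _.+2) -(natr1 _.+1); have := truncnS_gt (wnorm z0); lra.
pose P := 4 ^+ n.+1 : R; have P0 : 0 < P by rewrite exprn_gt0.
pose A := C * (1 / e) ^+ n.+1.
have A0 : 0 < A by rewrite mulr_gt0// exprn_gt0// divr_gt0.
pose L := 2 + (l.+2 + l.+2)%:R * P.
have L0 : 0 < L by rewrite ltr_wpDr// mulr_ge0// ltW.
have ABL0 : 0 < A * (B * L) := mulr_gt0 A0 (mulr_gt0 B0 L0).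
exists (A * (B * L)) => //.
move=> q x r w F r0 mF Fsub.
have tau0 : 0 < 2 ^- q * r by rewrite mulr_gt0// invr_gt0 exprn_gt0.
have taur : 2 ^- q * r <= r.
  by rewrite ler_piMl ?(ltW r0)// invf_le1 ?exprn_gt0// exprn_ege1 ?ler1n.
have RHS0 : 0 <= A * (B * L) * (q.+1%:R / 2 ^+ q) * cvol r.
  apply: mulr_ge0; last exact: ltW (cvol_gt0 s_gt0 r0).
  by apply: mulr_ge0; [exact: ltW|apply: divr_ge0 => //; exact: exprn_ge0].
have [Y0|/set0P[v [xv wv]]] := eqVneq (cube x r `&` cube w (2 ^- q * r)) set0.
  by rewrite Y0 Rintegral_set0 mulr0.
have N0 := ncube_gt0 s_gt0 bX (companion x r) r0.
set beta := mean b (companion x r) r.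
have ub := hC x r F beta mF Fsub r0.
have hb : {ae mu, forall y, (cube x r `&` cube w (2 ^- q * r)) y ->
    ncube (companion x r) r * `|T (test_fun x r F) y| <= A * (`|b y - beta| + B)}.
  apply: filterS ub => y hy [xy _].
  have er0 : 0 < e * r by rewrite mulr_gt0.
  have := hy (e * r) er0 (fun z Pz => he x r y z r0 xy Pz).
  have -> : r / (e * r) = 1 / e by field; rewrite !gt_eqF.
  move=> /le_trans; apply; rewrite -/A; apply: ler_wpM2l; first exact: ltW.
  by rewrite lerD2l; apply: hB.
have mY : measurable (cube x r `&` cube w (2 ^- q * r)).
  by apply: measurableI; exact: measurable_cube.
have Tl := T_locint bX gk cT (test_fun_le1 bX gk mF Fsub r0).
have := integral_bound Tl mY (@subIsetr _ _ _) tau0 (ltW N0) (ltW A0) (ltW B0) hb.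
move=> /le_trans; apply.
(* One power of the scale suffices; the remaining ones are bounded by 1. *)
have vq : cvol (2 ^- q * r) <= 2 ^- q * cvol r.
  rewrite cvolM ler_wpM2r ?(ltW (cvol_gt0 s_gt0 r0))// exprS ler_piMr ?invr_ge0 ?exprn_ge0//.
  by rewrite exprn_ile1 ?invr_ge0 ?exprn_ge0// invf_le1 ?exprn_gt0// exprn_ege1 ?ler1n.
have wx : wnorm (w - x) <= 2 * r.
  have e1 : wnorm (v - x) <= r := cube_wnorm s_gt0 (ltW r0) xv.
  have e2 : wnorm (v - w) <= 2 ^- q * r := cube_wnorm s_gt0 (ltW tau0) wv.
  apply: (le_trans (wnorm_triangle s_gt0 v w x)).
  have -> : 2 * r = r + r by rewrite mulr_natl mulr2n.
  by apply: lerD => //; rewrite wnormB (le_trans e2).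
have lwr : wnorm z0 * r + 2 * r <= 2 ^+ l * r by rewrite -mulrDl ler_wpM2r// ltW.
have z0r : 0 <= wnorm z0 * r by rewrite mulr_ge0// ltW.
have rl : r <= 2 ^+ l * r by rewrite ler_peMl ?(ltW r0)// exprn_ege1// ler1n.
have d1 : `|mean b w (2 ^- q * r) - mean b x (2 ^+ l * r)| <= (q + l).+2%:R * P * B.
  have g1 : 2 ^- q * r <= 2 ^+ l * r by exact: le_trans taur rl.
  have g2 : wnorm (w - x) <= 2 ^+ l * r by apply: (le_trans wx); rewrite (le_trans _ lwr)// lerDr.
  have g3 : 2 ^+ l * r <= 2 ^+ (q + l) * (2 ^- q * r).
    have q0 : 2 ^+ q != 0 :> R by rewrite gt_eqF// exprn_gt0.
    rewrite exprD; move: (2 ^+ q) (2 ^+ l) q0 => a m a0.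
    by rewrite le_eqVlt; apply/orP; left; apply/eqP; field.
  exact: (mean_nested s_gt0 bl tau0 g1 g2 g3 hB).
have d2 : `|beta - mean b x (2 ^+ l * r)| <= l.+2%:R * P * B.
  have g2 : wnorm (companion x r - x) <= 2 ^+ l * r.
    rewrite wnormB; apply: (le_trans (companion_norm gk x (ltW r0))); rewrite mulrC.
    by rewrite (le_trans _ lwr)// lerDl mulr_ge0// ltW.
  exact: (mean_nested s_gt0 bl r0 rl g2 (lexx _) hB).
have d3 := dev_mean_le beta tau0 (hB w _ tau0).
have d4 := ler_distD (mean b x (2 ^+ l * r)) (mean b w (2 ^- q * r)) beta.
rewrite [`|mean b x _ - beta|]distrC in d4.
have tot : dev b beta w (2 ^- q * r) + B <= q.+1%:R * (B * L).
  have e1 : dev b beta w (2 ^- q * r) + B <= 2 * B + ((q + l).+2%:R * P * B + l.+2%:R * P * B).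
    apply: (le_trans (lerD (le_trans d3 (lerD (lexx B) (le_trans d4 (lerD d1 d2)))) (lexx B))).
    by rewrite twoE.
  apply: (le_trans e1); rewrite /L -!addnS !natrD -(natr1 q).
  by apply: near_algebra => //; [rewrite ler1n|exact: ltW|exact: ltW].
have t0 : 0 <= dev b beta w (2 ^- q * r) + B by rewrite addr_ge0 ?dev_ge0// ltW.
apply: (@le_trans _ _ (A * (2 ^- q * cvol r) * (q.+1%:R * (B * L)))).
  apply: ler_pM => //.
    by rewrite mulr_ge0 ?(ltW A0)// ltW// cvol_gt0.
  by rewrite ler_wpM2l// ltW.
move: (2 ^- q) (q.+1%:R) (cvol r) (B * L) => a u a' m.
by rewrite le_eqVlt; apply/orP; left; apply/eqP; ring.
Qed.

Let far_algebra (a p m : R) : 0 <= a * m ->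
  2 * m + ((a + a + 1 + 1) * p * m + (a + a + 1 + 1) * p * m) <=
  (a + 1) * (m * (2 + 4 * p)).
Proof.
move=> am; rewrite -subr_ge0.
have -> : (a + 1) * (m * (2 + 4 * p)) -
  (2 * m + ((a + a + 1 + 1) * p * m + (a + a + 1 + 1) * p * m)) = 2 * (a * m) by ring.
by rewrite mulr_ge0.
Qed.

(** Here (x, r) is the smaller cube and 4^k r is comparable to rho, the distance plus [t]. The
    kernel contributes 2^(q d) (r / rho)^d, the norms 4^(k d) / (k + 1)^2 by [ncube_growth2], the
    means of [b] a multiple of k + 1: the powers of 4 cancel and 1 / (k + 1) is left. *)
Lemma far_bound : exists2 C : R, 0 < C & forall q k x r y t F, 0 < r -> r <= t ->
  measurable F -> F `<=` cube (companion x r) r ->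
  6 * 2 ^+ q * r <= wnorm (companion x r - y) + t ->
  wnorm (companion x r - y) + t <= 2 ^+ (k + k) * r ->
  2 ^+ (k + k) * r <= 8 * (wnorm (companion x r - y) + t) ->
  ncube y t * \int[mu]_(z in cube y t `\` cube (companion x r) (2 ^- q * t))
     `|T (test_fun x r F) z| <=
  C * ((2 ^+ q) ^+ n.+1 / k.+1%:R) * cvol t.
Proof.
have [B B0 hB] := osc_bounded bX maxX gk bl cT.
have [C C0 hC] := test_fun_upper bX gk bl cT.
have [G G0 hG] := ncube_growth2 s_gt0 bX maxX.
pose P := 4 ^+ n.+1 : R; have P0 : 0 < P by rewrite exprn_gt0.
pose L := 2 + 4 * P; have L0 : 0 < L by rewrite addr_gt0// mulr_gt0.
pose H := 48 ^+ n.+1 : R; have H0 : 0 < H by rewrite exprn_gt0.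
exists (G * C * H * (B * L)).
  exact: mulr_gt0 (mulr_gt0 (mulr_gt0 G0 C0) H0) (mulr_gt0 B0 L0).
move=> q k x r y t F r0 rt mF Fsub; set v := companion x r.
set rho := wnorm (v - y) + t => h1 h2 h3.
have t0 : 0 < t := lt_le_trans r0 rt.
have wvy := wnorm_ge0 s (v - y).
have rho0 : 0 < rho by rewrite ltr_wpDl.
have q0 : 0 < 2 ^+ q :> R by rewrite exprn_gt0.
have q1 : 1 <= 2 ^+ q :> R by rewrite exprn_ege1// ler1n.
(* A lower bound for the distance from [Z] to the companion: 3 comes from the comparison of [rho]
   with the distance to its center, 2 from absorbing the radius [r]. *)
pose rh := rho / (6 * 2 ^+ q).
have rh0 : 0 < rh by rewrite divr_gt0// mulr_gt0.
have rrh : r <= rh by rewrite ler_pdivlMr ?mulr_gt0// mulrC.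
have N0 := ncube_gt0 s_gt0 bX v r0.
set beta := mean b v r.
pose Z := cube y t `\` cube v (2 ^- q * t).
have far z w : Z z -> cube v r w -> rh <= wnorm (z - w).
  move=> [yz vz] vw.
  have a1 : 2 ^- q * t <= wnorm (z - v).
    by rewrite leNgt; apply/negP => /(wnorm_cube s_gt0).
  have a2 := cube_wnorm s_gt0 (ltW t0) yz.
  have a3 := cube_wnorm s_gt0 (ltW r0) vw.
  have a4 := wnorm_triangle s_gt0 w z v.
  have a5 := wnorm_triangle s_gt0 z v y.
  rewrite [wnorm (v - z)]wnormB in a5.
  (* If [v] is within 2 t of the cube's center, then rho <= 3 t and the removed cube provides the
     distance; otherwise the position of the cube does. *)
  have a6 : rho <= 3 * 2 ^+ q * wnorm (z - v).
    have [near|far] := lerP (wnorm (v - y)) (2 * t).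
      have : t <= 2 ^+ q * wnorm (z - v) by rewrite -ler_pdivrMl.
      by rewrite /rho -mulrA; lra.
    apply: (@le_trans _ _ (3 * wnorm (z - v))); first by rewrite /rho; lra.
    by rewrite ler_wpM2r ?wnorm_ge0// ler_peMr.
  have a7 : 2 * rh <= wnorm (z - v).
    rewrite /rh mulrA ler_pdivrMr ?mulr_gt0//.
    by move: a6; move: (2 ^+ q) (wnorm (z - v)) => a m; lra.
  by lra.
have hb : {ae mu, forall z, Z z ->
    ncube v r * `|T (test_fun x r F) z| <= C * (r / rh) ^+ n.+1 * (`|b z - beta| + B)}.
  apply: filterS (hC x r F beta mF Fsub r0) => z hz Zz.
  have := hz rh rh0 (fun w vw => far z w Zz vw).
  move=> /le_trans; apply; apply: ler_wpM2l.
    by rewrite mulr_ge0 ?(ltW C0)// exprn_ge0// divr_ge0// ltW.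
  by rewrite lerD2l; apply: hB.
have mZ : measurable Z by apply: measurableD; exact: measurable_cube.
have Tl := T_locint bX gk cT (test_fun_le1 bX gk mF Fsub r0).
have D0 : 0 <= C * (r / rh) ^+ n.+1.
  by rewrite mulr_ge0 ?(ltW C0)// exprn_ge0// divr_ge0// ltW.
have Zsub : Z `<=` cube y t by move=> z [].
have ib := integral_bound Tl mZ Zsub t0 (ltW N0) D0 (ltW B0) hb.
set I := Rintegral _ _ _ in ib *.
have I0 : 0 <= I by apply: Rintegral_ge0.
pose u := 2 ^+ (k + k) * r.
have u0 : 0 < u by rewrite mulr_gt0// exprn_gt0.
have tu : t <= u by rewrite (le_trans _ h2)// lerDr.
have ut : u <= 2 ^+ (k + k) * t by rewrite /u ler_wpM2l// exprn_ge0.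
have d1 : `|mean b y t - mean b v u| <= (k + k).+2%:R * P * B.
  have g : wnorm (y - v) <= u by rewrite wnormB (le_trans _ h2)// lerDl ltW.
  exact: (mean_nested s_gt0 bl t0 tu g ut hB).
have d2 : `|beta - mean b v u| <= (k + k).+2%:R * P * B.
  have g : wnorm (v - v) <= u by rewrite subrr wnorm0// ltW.
  exact: (mean_nested s_gt0 bl r0 (le_trans rt tu) g (lexx _) hB).
have d3 := dev_mean_le beta t0 (hB y t t0).
have d4 := ler_distD (mean b v u) (mean b y t) beta.
rewrite [`|mean b v u - beta|]distrC in d4.
have tot : dev b beta y t + B <= k.+1%:R * (B * L).
  have e1 : dev b beta y t + B <= 2 * B + ((k + k).+2%:R * P * B + (k + k).+2%:R * P * B).
    apply: (le_trans (lerD (le_trans d3 (lerD (lexx B) (le_trans d4 (lerD d1 d2)))) (lexx B))).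
    by rewrite twoE.
  apply: (le_trans e1); rewrite /L -(natr1 (k + k).+1) -(natr1 (k + k)) natrD -(natr1 k).
  by apply: far_algebra; rewrite mulr_ge0// ltW.
have N2 : k.+1%:R ^+ 2 * ncube y t <= G * (2 ^+ (k + k)) ^+ n.+1 * ncube v r.
  apply: le_trans (hG v r k r0); rewrite ler_wpM2l ?exprn_ge0//.
  apply: (ncube_le s_gt0 bX); apply: (cube_sub s_gt0).
  by rewrite wnormB (le_trans _ h2).
(* The base 48 is 8, from the hypothesis on [k], times 6, from [rh]. *)
have ratio : (2 ^+ (k + k)) ^+ n.+1 * (r / rh) ^+ n.+1 <= H * (2 ^+ q) ^+ n.+1.
  rewrite -!exprMn; apply: lerXn2r; rewrite ?nnegrE.
  - by rewrite mulr_ge0 ?exprn_ge0// divr_ge0// ltW.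
  - by rewrite mulr_ge0// ltW.
  rewrite mulrA ler_pdivrMr// /rh mulrA ler_pdivlMr ?mulr_gt0//.
  move: h3; rewrite -/rho; move: (2 ^+ (k + k) * r) (2 ^+ q) q0 => a m m0 h3.
  by rewrite [_ * rho]mulrAC mulrA; have := ler_wpM2r (ltW m0) h3; lra.
have k10 : 0 < k.+1%:R :> R by [].
rewrite -(ler_pM2l (exprn_gt0 2 k10)).
have t00 : 0 <= dev b beta y t + B by rewrite addr_ge0 ?dev_ge0// ltW.
have vt0 := cvol_gt0 s_gt0 t0.
have qd0 : 0 < (2 ^+ q) ^+ n.+1 :> R by rewrite exprn_gt0.
have kd0 : 0 < (2 ^+ (k + k)) ^+ n.+1 :> R by rewrite !exprn_gt0.
apply: (@le_trans _ _ (G * (2 ^+ (k + k)) ^+ n.+1 * (ncube v r * I))).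
  rewrite [leLHS]mulrA [leRHS]mulrA.
  by apply: ler_wpM2r.
apply: (@le_trans _ _ (G * (2 ^+ (k + k)) ^+ n.+1 *
    (C * (r / rh) ^+ n.+1 * cvol t * (dev b beta y t + B)))).
  by rewrite ler_wpM2l// mulr_ge0 ?(ltW G0)// ltW.
move: ratio tot t00 kd0 qd0; move: ((r / rh) ^+ n.+1) ((2 ^+ q) ^+ n.+1).
move: ((2 ^+ (k + k)) ^+ n.+1) (dev b beta y t + B) (cvol t) vt0 (k.+1%:R : R) k10.
move=> a T1 vt vt0 kk k10 rr qq ratio tot t00 a0 qq0.
have -> : G * a * (C * rr * vt * T1) = (G * C * vt) * (a * rr * T1) by ring.
have -> : kk ^+ 2 * (G * C * H * (B * L) * (qq / kk) * vt) =
    (G * C * vt) * (H * qq * (kk * (B * L))) by field; rewrite gt_eqF.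
apply: ler_wpM2l; first by rewrite !mulr_ge0// ltW.
apply: (@le_trans _ _ (H * qq * T1)); first by rewrite ler_wpM2r.
by rewrite ler_wpM2l// mulr_ge0// ltW.
Qed.

End separation.

(** * Separated images and decay of the oscillation *)

Section oscillation_decay.
Variables (R : realType) (n : nat) (X : normedFunctionSpace R n).
Local Notation E := 'rV[R]_n.+1.
Local Notation mu := (@leb R n).
Variables (b Omega : E -> R) (s z0 : E) (sg M c dlt : R).
Hypothesis bX : is_ball_banach X.
Hypothesis maxX : maximal_bounded X.
Hypothesis gk : good_kernel Omega s z0 sg M c dlt.
Hypothesis bl : locint s b.
Hypothesis cT : compact_operator X (commutator_dom b Omega) (commutator b Omega).
Implicit Types (x y z w : E) (r t u rho beta m N D L : R) (F Z : set E) (f g : E -> R).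
Local Notation cube := (cube s).
Local Notation cvol := (cvol s).
Local Notation wnorm := (wnorm s).
Local Notation osc := (osc s).
Local Notation ncube := (ncube s X).
Local Notation T := (commutator b Omega).
Local Notation companion := (companion z0).
Local Notation test_fun := (test_fun X s z0).
Local Notation integral_abs := (integral_abs s).
Let s_gt0 := gk_s gk.

Lemma linear_over_exp (e : R) : 0 < e -> exists q, q.+1%:R / 2 ^+ q <= e.
Proof.
move=> e0; pose j := Num.truncn (2 / e); exists (j + j)%N.
have je : 2 / e < j.+1%:R := truncnS_gt _.
have j2 : j.+1%:R <= 2 ^+ j :> R by rewrite -natrX ler_nat ltn_expl.
have h : j.+1%:R ^+ 2 <= 2 ^+ (j + j) :> R.
  by rewrite exprD -expr2 lerXn2r// nnegrE// exprn_ge0.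
rewrite ler_pdivrMr ?exprn_gt0//.
apply: (@le_trans _ _ (e * j.+1%:R ^+ 2)); last by rewrite ler_wpM2l// ltW.
apply: (@le_trans _ _ (2 * j.+1%:R)).
  by rewrite -natrM ler_nat mul2n -addnn addSn addnS ltnS.
by rewrite expr2 mulrA ler_wpM2r// ltW// -ltr_pdivrMl// mulrC.
Qed.

Let separation_sum (q1 q2 q3 q4 : R) : 4 * q1 <= q2 + q3 + q4 -> q3 <= q1 ->
  q4 <= q1 -> q2 <= q1 -> 0 < q1 -> False.
Proof. by lra. Qed.

(** Three contributions, each at most a quarter of the lower bound on the test integral, cannot add
    up to it. *)
Let separation_arith (k0 gamma CD CM C2 A1 A2 N2 Nb vv o xd I2 Id aY aZ dZ eZ : R) :
  0 < k0 -> 0 < CD -> 0 < CM -> 0 < k0 * gamma / 4 -> 0 < vv -> 0 < N2 -> 0 < Nb ->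
  0 <= eZ -> 0 <= Id ->
  k0 * vv * o <= N2 * I2 -> gamma <= o ->
  I2 <= aY + aZ -> aZ <= dZ + eZ -> dZ <= Id ->
  N2 * aY <= A1 * vv -> A1 <= k0 * gamma / 4 ->
  Nb * eZ <= C2 * A2 * vv -> CD * C2 * A2 <= k0 * gamma / 4 ->
  Id * Nb <= CM * vv * xd -> xd <= k0 * gamma / 4 / (CD * CM) ->
  N2 <= CD * Nb -> False.
Proof.
move=> k00 CD0 CM0 kg0 v0 N20 Nb0 eZ0 d0 test go s1 s2 s3 b1 hA1 b2 hA2 b3 b4 NN.
have t1 : k0 * vv * gamma <= N2 * (aY + Id + eZ).
  apply: (@le_trans _ _ (k0 * vv * o)); first by rewrite ler_pM2l// mulr_gt0.
  apply: (le_trans test); rewrite ler_pM2l//.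
  by lra.
have t2 : N2 * Id <= vv * (k0 * gamma / 4).
  apply: (@le_trans _ _ (CD * Nb * Id)); first by rewrite ler_wpM2r.
  rewrite -mulrA [Nb * Id]mulrC; apply: (@le_trans _ _ (CD * (CM * vv * xd))).
    by rewrite ler_pM2l.
  apply: (@le_trans _ _ (CD * (CM * vv * (k0 * gamma / 4 / (CD * CM))))).
    by rewrite ler_pM2l// ler_pM2l// mulr_gt0.
  by rewrite le_eqVlt; apply/orP; left; apply/eqP; field; rewrite !gt_eqF.
have t3 : N2 * eZ <= vv * (k0 * gamma / 4).
  apply: (@le_trans _ _ (CD * Nb * eZ)); first by rewrite ler_wpM2r.
  rewrite -mulrA; apply: (@le_trans _ _ (CD * (C2 * A2 * vv))).
    by rewrite ler_pM2l.
  have -> : CD * (C2 * A2 * vv) = vv * (CD * C2 * A2) by ring.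
  by rewrite ler_pM2l.
have t4 : N2 * aY <= vv * (k0 * gamma / 4).
  by apply: (le_trans b1); rewrite mulrC ler_pM2l.
have t5 : 0 < vv * (k0 * gamma / 4) by rewrite mulr_gt0.
rewrite !mulrDr in t1.
have t6 : k0 * vv * gamma = 4 * (vv * (k0 * gamma / 4)) by field.
rewrite t6 in t1.
move: t1 t2 t3 t4 t5; move: (vv * (k0 * gamma / 4)) (N2 * aY) (N2 * Id) (N2 * eZ).
move=> q1 q2 q3 q4 *; exact: (@separation_sum q1 q2 q3 q4).
Qed.

(** The integral of |T f2| on the larger cube is at most that on the small cube around the companion
    of the first one, plus those of |T f2 - T f1| and |T f1| on the rest. If the images were close
    in X, all three would be too small for the lower bound given by the oscillation. *)
Lemma separation (k0 gamma : R) : 0 < k0 -> 0 < gamma ->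
  exists L e : R, [/\ 1 <= L, 0 < e & forall x1 r1 x2 r2 F1 F2,
    0 < r1 -> r1 <= r2 -> L * r1 <= wnorm (companion x1 r1 - x2) + r2 ->
    gamma <= osc b x2 r2 ->
    measurable F1 -> F1 `<=` cube (companion x1 r1) r1 ->
    measurable F2 -> F2 `<=` cube (companion x2 r2) r2 ->
    k0 * cvol r2 * osc b x2 r2 <= ncube (companion x2 r2) r2 *
      integral_abs (T (test_fun x2 r2 F2)) x2 r2 ->
    ~ (X (T (test_fun x2 r2 F2) \- T (test_fun x1 r1 F1))%R < e%:E)%E].
Proof.
move=> k00 g0.
have [C1 C10 h1] := near_bound bX maxX gk bl cT.
have [C2 C20 h2] := far_bound bX maxX gk bl cT.
have [CM CM0 hM] := maximal_average s_gt0 bX maxX.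
have [CD CD0 hD] := ncube_companion bX maxX gk.
have kg0 : 0 < k0 * gamma / 4 by rewrite divr_gt0// mulr_gt0.
(* [q] makes the near part at most a quarter; only then can [K] be chosen, since [far_bound] loses a
   power of [2 ^+ q]. *)
have [q hq] := linear_over_exp (divr_gt0 kg0 C10).
pose K := Num.truncn (CD * C2 * (2 ^+ q) ^+ n.+1 / (k0 * gamma / 4)).
have hK k : (K <= k)%N -> CD * C2 * ((2 ^+ q) ^+ n.+1 / k.+1%:R) <= k0 * gamma / 4.
  move=> Kk; rewrite mulrA ler_pdivrMr// -ler_pdivrMl// [leLHS]mulrC.
  by apply: ltW; apply: (lt_le_trans (truncnS_gt _)); rewrite ler_nat ltnS.
pose e := k0 * gamma / 4 / (CD * CM).
have e0 : 0 < e by rewrite divr_gt0// mulr_gt0.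
have q1 : 1 <= 2 ^+ q :> R by rewrite exprn_ege1// ler1n.
(* The first summand gives the separation required by [far_bound], the second one forces the number
   of scales to be at least [K]. *)
exists (6 * 2 ^+ q + 2 ^+ (K + K)), e; split => //.
  by apply: (@le_trans _ _ (6 * 2 ^+ q)); [lra|rewrite lerDl ltW].
move=> x1 r1 x2 r2 F1 F2 r10 r12 Lr go mF1 sF1 mF2 sF2 test close.
have r20 : 0 < r2 := lt_le_trans r10 r12.
set v := companion x1 r1 in Lr sF1 *.
set rho := wnorm (v - x2) + r2 in Lr *.
have far1 : 6 * 2 ^+ q * r1 <= rho.
  by apply: le_trans Lr; apply: ler_wpM2r; [exact: ltW|rewrite lerDl ltW].
have far2 : 2 ^+ (K + K) * r1 <= rho.
  apply: le_trans Lr; apply: ler_wpM2r; [exact: ltW|rewrite lerDr].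
  by rewrite mulr_ge0// ltW// exprn_gt0.
have r1rho : r1 <= rho.
  apply: (le_trans r12); rewrite /rho lerDr; exact: wnorm_ge0.
(* The least [k] for which 4^k r1 reaches [rho]; powers of 4 because [ncube_growth2] works with even
   exponents. *)
have [k Kk [k1 k2]] : exists2 k, (K <= k)%N &
    rho <= 2 ^+ (k + k) * r1 /\ 2 ^+ (k + k) * r1 <= 8 * rho.
  have ex : exists k, rho <= 2 ^+ (k + k) * r1.
    exists (Num.truncn (rho / r1)).+1; rewrite -ler_pdivrMr// ltW//.
    apply: (lt_le_trans (truncnS_gt _)).
    rewrite -natrX ler_nat; apply: (leq_trans (ltnW (ltn_expl _ (ltnSn 1)))).
    by rewrite leq_pexp2l// leq_addr.
  case: (ex_minnP ex) => k hk kmin.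
  have Kk : (K <= k)%N.
    rewrite leqNgt; apply/negP => kK.
    have : 2 ^+ (K + K) * r1 <= 2 ^+ (k + k) * r1 := le_trans far2 hk.
    by rewrite ler_pM2r// leNgt => /negP; apply; rewrite ltr_eXn2l ?ltr1n// !addnn ltn_double.
  exists k => //; split => //.
  case: k hk kmin {Kk} => [|k] hk kmin.
    by rewrite mul1r (le_trans r1rho)// ler_peMl ?ler1n// (le_trans (ltW r10)).
  have kr : 2 ^+ (k + k) * r1 < rho.
    by rewrite ltNge; apply/negP => /kmin; rewrite ltnn.
  rewrite addSn addnS !exprS; move: kr; move: (2 ^+ (k + k)) => a kr.
  have -> : 2 * (2 * a) * r1 = 4 * (a * r1) by ring.
  have a0 : 0 <= rho := le_trans (ltW r10) r1rho.
  by move: kr a0; move: (a * r1) => p; lra.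
have f1 := test_fun_le1 bX gk mF1 sF1 r10.
have f2 := test_fun_le1 bX gk mF2 sF2 r20.
have l1 := T_locint bX gk cT f1; have l2 := T_locint bX gk cT f2.
have b1 := h1 q x2 r2 v F2 r20 mF2 sF2.
have b2 := h2 q k x1 r1 x2 r2 F1 r10 r12 mF1 sF1 far1 k1 k2.
rewrite -/v in b2.
set Y := cube x2 r2 `&` cube v (2 ^- q * r2) in b1.
set Z := cube x2 r2 `\` cube v (2 ^- q * r2) in b2.
have mC : measurable (cube x2 r2) by exact: measurable_cube.
have mV : measurable (cube v (2 ^- q * r2)) by exact: measurable_cube.
have mY : measurable Y by exact: measurableI.
have mZ : measurable Z by exact: measurableD.
have ZC : Z `<=` cube x2 r2 by move=> z [].
have YZ : Y `|` Z = cube x2 r2.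
  apply/seteqP; split=> [z [[]//|/ZC//]|z zC].
  by have [?|?] := pselect (cube v (2 ^- q * r2) z); [left|right].
pose d z := T (test_fun x2 r2 F2) z - T (test_fun x1 r1 F1) z.
have ld : locint s d by exact: locintB.
have Xd : (X d < +oo)%E by rewrite (lt_trans close)// ltry.
have b3 := hM d x2 r2 Xd r20.
have b4 : fine (X d) <= e.
  by rewrite -lee_fin (fineK (fnorm_fin Xd)) ltW.
have split1 : integral_abs (T (test_fun x2 r2 F2)) x2 r2 <=
    \int[mu]_(z in Y) `|T (test_fun x2 r2 F2) z| + \int[mu]_(z in Z) `|T (test_fun x2 r2 F2) z|.
  rewrite /integral_abs -YZ; apply: (Rintegral_setU_le mY mZ) => //.
  by rewrite YZ; exact: locint_norm.
have split2 : \int[mu]_(z in Z) `|T (test_fun x2 r2 F2) z| <=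
    \int[mu]_(z in Z) `|d z| + \int[mu]_(z in Z) `|T (test_fun x1 r1 F1) z|.
  have i1 := integrableS mC mZ ZC (locint_norm ld x2 r2).
  have i2 := integrableS mC mZ ZC (locint_norm l1 x2 r2).
  have i3 := integrableS mC mZ ZC (locint_norm l2 x2 r2).
  rewrite -(RintegralD mZ i1 i2).
  apply: (le_Rintegral mZ i3 (integrable_addf mZ i1 i2)) => z _; rewrite -[T (test_fun x2 r2 F2) z](subrK (T (test_fun x1 r1 F1) z)).
  exact: ler_normD.
have split3 : \int[mu]_(z in Z) `|d z| <= integral_abs d x2 r2.
  apply: (Rintegral_subset mZ mC (locint_norm ld x2 r2) _ ZC) => z _.
  exact: normr_ge0.
have hq' : C1 * (q.+1%:R / 2 ^+ q) <= k0 * gamma / 4.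
  by rewrite mulrC -ler_pdivlMr.
have NN := hD x2 r2 r20.
have v0 := cvol_gt0 s_gt0 r20.
have Nb0 := ncube_gt0 s_gt0 bX x2 r20.
have N0 := ncube_gt0 s_gt0 bX (companion x2 r2) r20.
have eZ0 : 0 <= \int[mu]_(z in Z) `|T (test_fun x1 r1 F1) z| by apply: Rintegral_ge0.
have d0 : 0 <= integral_abs d x2 r2 by apply: integral_abs_ge0.
exact: (separation_arith k00 CD0 CM0 kg0 v0 N0 Nb0 eZ0 d0 test go split1 split2 split3
  b1 hq' b2 (hK k Kk) b3 b4 NN).
Qed.

Let decay_arith (a u v wi w q q' Lj p : R) : a <= u + (v + wi) -> u <= w -> q' <= q ->
  q + wi + w < Lj -> Lj < a -> 0 < p -> q' <= v + p.
Proof. by lra. Qed.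

Let decay_bounds (a1 a2 a3 a4 a5 a6 Lj : R) : 0 < a1 -> 0 <= a2 -> 0 <= a3 ->
  0 <= a4 -> 0 <= a5 -> 0 <= a6 -> a1 + a2 + a3 + a4 + a5 + a6 <= Lj ->
  [/\ a2 < Lj, a3 < Lj, a6 < Lj & a3 + a4 + a5 < Lj].
Proof. by move=> *; split; lra. Qed.

(** If it fails, bad cubes exist at every level [L]. Levels are chosen recursively so fast that any
    two cubes of the sequence satisfy [separation], while compactness brings two images together. *)
Lemma osc_decay gamma : 0 < gamma -> exists2 L, 0 < L & forall x r, 0 < r ->
  r < L^-1 \/ L < r \/ L < wnorm x -> osc b x r < gamma.
Proof.
move=> g0; apply: contrapT => no.
have [k0 k00 hk] := test_set_exists bX gk bl cT.
have [S [e [S1 e0 sep]]] := separation k00 g0.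
have {no}/choice[h hh] : forall L, exists p : E * R, 0 < L ->
    [/\ 0 < p.2, p.2 < L^-1 \/ L < p.2 \/ L < wnorm p.1 & gamma <= osc b p.1 p.2].
  move=> L; apply: contrapT => noL; apply: no.
  have [L0|L0] := ltP 0 L; last by exfalso; apply: noL; exists (0, 0); rewrite ltNge L0.
  exists L => // x r r0 bad; rewrite ltNge; apply/negP => hosc.
  by apply: noL; exists (x, r).
have /choice[Fs hFs] : forall p : E * R, exists F, 0 < p.2 ->
    [/\ measurable F, F `<=` cube (companion p.1 p.2) p.2 &
    k0 * cvol p.2 * osc b p.1 p.2 <= ncube (companion p.1 p.2) p.2 *
      integral_abs (T (test_fun p.1 p.2 F)) p.1 p.2].
  move=> [x r]; have [r0|r0] := ltP 0 r; last by exists set0.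
  by have [F hF] := hk x r r0; exists F.
(* Each summand serves one way of being bad later on: [S / p.2] makes a small cube S times smaller
   than the present one, [S * p.2] a large one S times larger, and together with the norm of the
   center and the shift to the companion it puts a far one at distance at least S times the present
   radius. *)
pose Phi (L : R) (p : E * R) := L + S / p.2 + S * p.2 + wnorm p.1 + p.2 * wnorm z0 + p.2.
pose Ls := fix Ls (k : nat) : R := if k is k'.+1 then Phi (Ls k') (h (Ls k')) else 1.
have S0 : 0 < S by rewrite (lt_le_trans _ S1).
have w0 := wnorm_ge0 s z0.
have LsP k : 0 < Ls k /\ (forall i, (i < k)%N -> Phi (Ls i) (h (Ls i)) <= Ls k).
  elim: k => [|k [k1 IH]]; first by split.
  have [p0 _ _] := hh (Ls k) k1.
  have inc : Ls k <= Ls k.+1.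
    rewrite /= /Phi -!addrA lerDl !addr_ge0 ?wnorm_ge0 ?divr_ge0 ?mulr_ge0// ltW//.
  split; first exact: lt_le_trans k1 inc.
  move=> i; rewrite ltnS leq_eqVlt => /predU1P[->//|ik].
  exact: le_trans (IH i ik) inc.
pose p k := h (Ls k).
have pP k : [/\ 0 < (p k).2, (p k).2 < (Ls k)^-1 \/ Ls k < (p k).2 \/ Ls k < wnorm (p k).1
    & gamma <= osc b (p k).1 (p k).2] by apply: hh; have [] := LsP k.
pose f k := test_fun (p k).1 (p k).2 (Fs (p k)).
have f1 k : (X (f k) <= 1)%E.
  have [p0 _ _] := pP k; have [mF sF _] := hFs _ p0.
  exact: (test_fun_le1 bX gk mF sF p0).
have [i [j [ij close]]] := compact_operator_pigeonhole cT e0 f1.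
have [ri0 _ oi] := pP i; have [rj0 bad oj] := pP j.
have [mi si ti] := hFs _ ri0; have [mj sj tj] := hFs _ rj0.
have [Lj0 /(_ i ij) LL] := LsP j; have [Li0 _] := LsP i.
rewrite /f in close; rewrite -/(p i) /Phi in LL.
move: ri0 oi mi si ti rj0 bad oj mj sj tj LL close.
move: (p i) (p j) => [xi ri] [xj rj] /=.
move: (Ls i) (Ls j) Li0 Lj0 => Li Lj Li0 Lj0.
move=> ri0 oi mi si ti rj0 bad oj mj sj tj LL close.
have Sr0 : 0 < S / ri by rewrite divr_gt0.
have Srr0 : 0 < S * ri by rewrite mulr_gt0.
have wi0 := wnorm_ge0 s xi; have rw0 : 0 <= ri * wnorm z0 by rewrite mulr_ge0// ltW.
have [SL SriL riL SwL] := decay_bounds Li0 (ltW Sr0) (ltW Srr0) wi0 rw0 (ltW ri0) LL.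
have small : rj < Lj^-1 -> S * rj < ri.
  move=> rl.
  rewrite ltr_pdivrMr// in SL.
  have : rj * Lj < 1 by rewrite -ltr_pdivlMr// div1r.
  move=> h1; have := ltr_pM2l ri0 (rj * Lj) 1; rewrite h1 mulr1 => h2.
  have h3 : S * rj < Lj * ri * rj by rewrite ltr_pM2r.
  by apply: (lt_trans h3); rewrite -mulrA mulrC -mulrA.
(* [separation] takes the smaller cube first, whatever the order in the sequence. *)
have [rji|rij] := leP rj ri.
  have Lr : S * rj <= wnorm (companion xj rj - xi) + ri; last first.
    exact: (sep xj rj xi ri _ _ rj0 rji Lr oi mj sj mi si ti close).
  case: bad => [/small/ltW h1|[h1|h1]].
  - by apply: (le_trans h1); rewrite lerDr wnorm_ge0.
  - by have := lt_trans riL (lt_le_trans h1 rji); rewrite ltxx.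
  have t1 := wnorm_triangle s_gt0 (companion xj rj) xj 0.
  have t2 := wnorm_triangle s_gt0 xi (companion xj rj) 0.
  have t3 := companion_norm gk xj (ltW rj0).
  rewrite !subr0 in t1 t2.
  have t4 : rj * wnorm z0 <= ri * wnorm z0 by rewrite ler_wpM2r.
  have t5 : S * rj <= S * ri by rewrite ler_pM2l.
  exact: (decay_arith (le_trans t1 (lerD (lexx _) t2)) (le_trans t3 t4) t5 SwL h1 ri0).
have sf : (X (T (test_fun xj rj (Fs (xj, rj))) \- T (test_fun xi ri (Fs (xi, ri))))%R < e%:E)%E.
  by rewrite -fnorm_distC// (lt_trans close)// ltry.
have Lr : S * ri <= wnorm (companion xi ri - xj) + rj; last first.
  exact: (sep xi ri xj rj _ _ ri0 (ltW rij) Lr oj mi si mj sj tj sf).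
case: bad => [/small h1|[h1|h1]].
- exfalso; have : ri <= S * ri by rewrite ler_peMl// ltW.
  have : S * ri <= S * rj by rewrite ler_pM2l// ltW.
  by move=> h2 h3; have := le_lt_trans (le_trans h3 h2) h1; rewrite ltxx.
- by rewrite (le_trans (ltW (lt_trans SriL h1)))// lerDr wnorm_ge0.
have t1 := wnorm_triangle s_gt0 (companion xi ri) xj 0.
have t2 := wnorm_triangle s_gt0 xi (companion xi ri) 0.
have t3 := companion_norm gk xi (ltW ri0).
rewrite !subr0 in t1 t2; rewrite wnormB in t1; rewrite wnormB in t3.
have t4 := le_trans t1 (lerD (lexx _) t2); rewrite addrCA in t4.
exact: (decay_arith t4 t3 (lexx _) SwL h1 rj0).
Qed.

End oscillation_decay.

(** * Approximation by smooth functions *)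

Section cutoff.
Variables (R : realType) (n : nat) (s : 'rV[R]_n.+1).
Local Notation E := 'rV[R]_n.+1.
Local Notation mu := (@leb R n).
Hypothesis s_gt0 : forall i, 0 < s 0 i.
Implicit Types (x y z : E) (r t a c d K l lam : R) (f g u chi : E -> R).
Local Notation cube := (cube s).
Local Notation cvol := (cvol s).
Local Notation wnorm := (wnorm s).
Local Notation osc := (osc s).
Local Notation dev := (dev s).
Local Notation mean := (mean s).
Local Notation locint := (locint s).

Lemma dev_le_add f g c d K x r : locint f -> locint g -> 0 < r -> 0 <= K ->
  (forall y, cube x r y -> `|f y - c| <= `|g y - d| + K) ->
  dev f c x r <= dev g d x r + K.
Proof.
move=> fl gl r0 K0 h.
have l1 : locint (fun y => `|g y - d|) by exact: locint_dist.
have l2 : locint (fun y => K) by exact: locint_cst.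
have e1 : dev f c x r <= dev (fun y => `|g y - d| + K) (0 + 0) x r.
  apply: (le_dev_fun s_gt0) => //; first exact: locintD.
  by move=> y /h hy; rewrite addr0 subr0 [leRHS]ger0_norm// addr_ge0.
have e2 := dev_add s_gt0 0 0 x l1 l2 r0.
have e3 : dev (fun y => `|g y - d|) 0 x r <= dev g d x r.
  by apply: (le_dev_fun s_gt0) => // y _; rewrite subr0 normr_id.
have e4 : dev (fun=> K) 0 x r = K by rewrite dev_cst// subr0 ger0_norm.
by rewrite e4 in e2; exact: (le_trans (le_trans e1 e2) (lerD e3 (lexx _))).
Qed.

Lemma dev_add_const f c d x r : dev (fun y => f y + d) (c + d) x r = dev f c x r.
Proof.
by rewrite !devE; congr (_ * _); apply: eq_Rintegral => y _; rewrite opprD addrACA subrr addr0.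
Qed.

Lemma mean_add_const f d x r : locint f -> 0 < r ->
  mean (fun y => f y + d) x r = mean f x r + d.
Proof.
move=> fl r0; rewrite !meanE RintegralD; last 3 first.
- exact: measurable_cube.
- exact: fl.
- exact: locint_cst.
rewrite Rintegral_cube_cst// mulrDr; congr (_ + _).
by rewrite mulrC mulfK// gt_eqF// cvol_gt0.
Qed.

Lemma osc_add_const f d x r : locint f -> 0 < r ->
  osc (fun y => f y + d) x r = osc f x r.
Proof.
by move=> fl r0; rewrite !oscE mean_add_const// dev_add_const.
Qed.

Lemma osc_add f g x r : locint f -> locint g -> 0 < r ->
  osc (fun y => f y + g y) x r <= 2 * (osc f x r + osc g x r).
Proof.
move=> fl gl r0.
apply: (le_trans (osc_le s_gt0 (mean f x r + mean g x r) x (locintD fl gl) r0)).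
by rewrite ler_pM2l// dev_add.
Qed.

Lemma osc_local f g x r : locint f -> locint g -> 0 < r ->
  (forall y, cube x r y -> f y = g y) -> osc f x r = osc g x r.
Proof.
move=> fl gl r0 fg; rewrite !oscE !meanE.
have -> : \int[mu]_(y in cube x r) f y = \int[mu]_(y in cube x r) g y.
  by apply: eq_Rintegral => y /set_mem/fg.
by rewrite !devE; congr (_ * _); apply: eq_Rintegral => y /set_mem/fg ->.
Qed.

Lemma dyadic_scale r l : 0 < r -> r <= l -> exists k, l / 2 < 2 ^+ k * r <= l.
Proof.
move=> r0 rl; have ex : exists k, l / 2 < 2 ^+ k * r.
  exists (Num.truncn (l / r)).+1; rewrite -ltr_pdivrMr//.
  have : l / r < (Num.truncn (l / r)).+1%:R := truncnS_gt _.
  have : l / 2 / r <= l / r by rewrite ler_pM2r ?invr_gt0//; lra.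
  move=> /le_lt_trans h /h /lt_le_trans; apply.
  by rewrite -natrX ler_nat ltnW// ltn_expl.
case: (ex_minnP ex) => k hk kmin; exists k; rewrite hk/= leNgt; apply/negP => kl.
case: k hk kmin kl => [|k] hk kmin; first by rewrite mul1r ltNge rl.
rewrite exprS -mulrA => kl; have := kmin k; rewrite ltnn => h; apply: notF; apply: h.
by rewrite ltr_pdivrMr// mulrC.
Qed.

(* The loss [k] of the chain of [k] doublings from [r] to [l] is absorbed by the
   factor [r / l <= 2 ^- k] that the Lipschitz bound of [chi] supplies. *)
Lemma osc_product u chi x r l lam K : locint u -> measurable_fun setT chi ->
  (forall y, `|chi y| <= 1) -> 0 <= lam ->
  (forall y z, `|chi y - chi z| <= lam / l * wnorm (y - z)) -> 0 < r -> r <= l ->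
  (forall t, r <= t -> t <= l -> osc u x t <= K) ->
  (forall t, l / 2 < t -> t <= l -> `|mean u x t| <= K) ->
  osc (fun y => chi y * u y) x r <= 2 * ((1 + lam * (1 + 2 ^+ n.+1)) * K).
Proof.
move=> ul mchi chi1 lam0 lip r0 rl hosc hmean.
have l0 := lt_le_trans r0 rl.
have [k /andP[k1 k2]] := dyadic_scale r0 rl.
set m := mean u x r.
have K0 : 0 <= K by rewrite (le_trans _ (hosc r (lexx _) rl))// dev_ge0.
have mu_ : `|m| <= (1 + k%:R * 2 ^+ n.+1) * K.
  have h1 : `|m - mean u x (2 ^+ k * r)| <= k%:R * 2 ^+ n.+1 * K.
    apply: (mean_chain s_gt0 ul r0) => i /andP[i0 ik].
    apply: hosc; first by rewrite ler_peMl ?(ltW r0)// exprn_ege1// ler1n.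
    apply: le_trans k2; rewrite ler_pM2r// -!natrX ler_nat.
    by rewrite leq_pexp2l.
  have h2 := hmean _ k1 k2.
  have := ler_normD (m - mean u x (2 ^+ k * r)) (mean u x (2 ^+ k * r)).
  rewrite subrK => h; apply: (le_trans h); rewrite mulrDl mul1r addrC.
  exact: lerD.
have pl : locint (fun y => chi y * u y).
  apply: (locint_le ul) => [|y].
    exact: (measurable_funM mchi (locint_measurable s_gt0 ul)).
  by rewrite normrM ler_piMl.
have rlk : r / l * (1 + k%:R * 2 ^+ n.+1) <= 1 + 2 ^+ n.+1.
  have r1 : r / l <= 1 by rewrite ler_pdivrMr// mul1r.
  have r2 : r / l * k%:R <= 1.
    rewrite mulrAC ler_pdivrMr// mul1r; apply: le_trans k2.
    by rewrite mulrC ler_pM2r// -natrX ler_nat ltnW// ltn_expl.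
  rewrite mulrDr mulr1 mulrA; apply: lerD => //.
  by rewrite ler_piMl ?exprn_ge0.
apply: (le_trans (osc_le s_gt0 (chi x * m) x pl r0)); rewrite ler_pM2l//.
have C0 : 0 <= lam / l * r * `|m|.
  by rewrite mulr_ge0 ?normr_ge0// mulr_ge0 ?(ltW r0)// divr_ge0// ltW.
have := dev_le_add pl ul r0 C0 (c := chi x * m) (d := m) (x := x).
move=> /(_ _)/le_trans; apply=> [y xy|].
  have -> : chi y * u y - chi x * m = chi y * (u y - m) + (chi y - chi x) * m by ring.
  apply: (le_trans (ler_normD _ _)); rewrite !normrM; apply: lerD.
    by rewrite ler_piMl.
  rewrite ler_wpM2r//; apply: (le_trans (lip _ _)); rewrite ler_wpM2l//.
    by rewrite divr_ge0// ltW.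
  exact: (cube_wnorm s_gt0 (ltW r0)).
rewrite mulrDl mul1r; apply: lerD; first exact: hosc.
apply: (@le_trans _ _ (lam / l * r * ((1 + k%:R * 2 ^+ n.+1) * K))).
  by rewrite ler_wpM2l// mulr_ge0 ?(ltW r0)// divr_ge0// ltW.
move: rlk; move: (1 + k%:R * 2 ^+ n.+1) (1 + 2 ^+ n.+1) => p q pq.
have -> : lam / l * r * (p * K) = lam * (r / l * p) * K by ring.
by rewrite ler_wpM2r// ler_wpM2l.
Qed.

Lemma Rintegral_bigsetU_le (I : Type) (q : seq I) (A : I -> set E) (D : set E) f :
  measurable D -> mu.-integrable D (EFin \o f) -> (forall i, measurable (A i)) ->
  (forall i, A i `<=` D) -> (forall x, 0 <= f x) ->
  \int[mu]_(x in \big[setU/set0]_(i <- q) A i) f x <=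
  \sum_(i <- q) \int[mu]_(x in A i) f x.
Proof.
move=> mD fD mA AD f0; elim: q => [|i q IH]; first by rewrite !big_nil Rintegral_set0.
rewrite !big_cons.
have mU : measurable (\big[setU/set0]_(j <- q) A j) by exact: bigsetU_measurable.
have UD : A i `|` \big[setU/set0]_(j <- q) A j `<=` D.
  move=> y [/AD//|]; elim/big_rec: _ => // j B _ BD [/AD//|]; exact: BD.
apply: le_trans (Rintegral_setU_le _ _ _ f0) _ => //; last by rewrite lerD2l.
by apply: (integrableS mD) fD => //; exact: measurableU.
Qed.

(** The doubled cube is tiled by [2 ^+ n.+1] cubes of radius [r], so its mean is a mean of means. No
    constant is lost, and the doubling can be iterated to all scales. *)
Lemma dev0_double u r K : locint u -> 0 < r -> (forall z, dev u 0 z r <= K) ->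
  forall z, dev u 0 z (2 * r) <= K.
Proof.
move=> ul r0 h z; have rr0 : 0 < 2 * r by rewrite mulr_gt0.
pose v (sg : {ffun 'I_n.+1 -> bool}) : E :=
  \row_i (z 0 i + (if sg i then r else - r) * s 0 i).
have vz sg : cube (v sg) r `<=` cube z (2 * r).
  move=> y /cubeP yv; apply/cubeP => i; have := yv i; rewrite mxE.
  have := mulr_gt0 r0 (s_gt0 i); case: (sg i); rewrite -?mulrA ?mulNr;
    move: (r * s 0 i) => p p0 /andP[? ?]; apply/andP; split; lra.
have cover : \big[setU/set0]_(sg : {ffun 'I_n.+1 -> bool}) cube (v sg) r = cube z (2 * r).
  apply/seteqP; split => [y|y /cubeP yz].
    by elim/big_rec: _ => // j B _ BD [/vz//|]; exact: BD.
  (* The tile containing [y] is read off the side of the center on which each coordinate lies; the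
     half-open convention decides ties. *)
  pose sg : {ffun 'I_n.+1 -> bool} := [ffun i => z 0 i < y 0 i].
  have : cube (v sg) r y.
    apply/cubeP => i; have := yz i; rewrite mxE ffunE.
    have := mulr_gt0 r0 (s_gt0 i); rewrite -!mulrA.
    by case: (ltP (z 0 i) (y 0 i)); rewrite ?mulNr; move: (r * s 0 i) => p ? p0 /andP[? ?]; apply/andP; split; lra.
  by move=> ysg; rewrite (bigD1 sg)//=; left.
rewrite -(ler_pM2l (cvol_gt0 s_gt0 rr0)) -dev_eq//.
rewrite -cover.
have l0 := locint_dist 0 ul.
have mz := measurable_cube s z (2 * r).
have := Rintegral_bigsetU_le (index_enum {ffun 'I_n.+1 -> bool}) mz (l0 z (2 * r))
  (fun sg => measurable_cube s (v sg) r) vz (fun y => normr_ge0 _).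
move=> /le_trans; apply.
apply: (@le_trans _ _ (\sum_(sg : {ffun 'I_n.+1 -> bool}) cvol r * K)).
  by apply: ler_sum => sg _; rewrite dev_eq// ler_pM2l// cvol_gt0.
rewrite sumr_const card_ffun card_bool card_ord -[leLHS]mulr_natl cvolM mulrA natrX.
by [].
Qed.

(** Up to scale [a], [osc_product] applies near the support and the product vanishes elsewhere.
    Beyond [a], the mean of its modulus is small at scales in ]a / 2, a], hence at every larger
    scale by [dev0_double]. *)
Lemma osc_cutoff u chi rho a lam K : locint u -> measurable_fun setT chi ->
  (forall y, `|chi y| <= 1) -> 0 <= lam -> 0 < a -> 0 <= K ->
  (forall y z, `|chi y - chi z| <= lam / a * wnorm (y - z)) ->
  (forall y, rho < wnorm y -> chi y = 0) ->
  (forall x t, wnorm x <= rho + a -> 0 < t -> t <= a -> osc u x t <= K) ->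
  (forall x t, wnorm x <= rho + a -> a / 2 < t -> t <= a -> dev u 0 x t <= K) ->
  forall x r, 0 < r ->
  osc (fun y => chi y * u y) x r <= 2 * ((1 + lam * (1 + 2 ^+ n.+1)) * K).
Proof.
move=> ul mchi chi1 lam0 a0 K0 lip supp hosc hdev x r r0.
have C0 : 0 <= lam * (1 + 2 ^+ n.+1) by rewrite mulr_ge0// addr_ge0// exprn_ge0.
have pl : locint (fun y => chi y * u y).
  apply: (locint_le ul) => [|y].
    exact: (measurable_funM mchi (locint_measurable s_gt0 ul)).
  by rewrite normrM ler_piMl.
have far z t : 0 < t -> t <= a -> rho + a < wnorm z -> dev (fun y => chi y * u y) 0 z t <= 0.
  move=> t0 ta zr; apply: (dev_le_bound s_gt0) => // y zy; rewrite subr0.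
  rewrite supp ?mul0r ?normr0//.
  have := cube_wnorm s_gt0 (ltW t0) zy; rewrite wnormB => w1.
  have := wnorm_triangle s_gt0 y z 0; rewrite !subr0 => w2.
  by move: w1 w2; move: (wnorm (z - y)) => q w1 w2; lra.
have [ra|ar] := leP r a.
  have [xr|xr] := leP (wnorm x) (rho + a); last first.
    apply: (le_trans (osc_le s_gt0 0 x pl r0)).
    rewrite ler_pM2l//; apply: (le_trans (far x r r0 ra xr)).
    by rewrite mulr_ge0// addr_ge0.
  apply: (@osc_product u chi x r a) => //.
    by move=> t rt ta; apply: hosc => //; exact: lt_le_trans rt.
  move=> t t1 t2; have t0 : 0 < t by apply: lt_trans t1; rewrite divr_gt0.
  have := mean_dev s_gt0 0 x ul t0; rewrite subr0 => /le_trans; apply.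
  exact: hdev.
have base z t : a / 2 < t -> t <= a -> dev (fun y => chi y * u y) 0 z t <= K.
  move=> t1 t2; have t0 : 0 < t by apply: lt_trans t1; rewrite divr_gt0.
  have [zr|zr] := leP (wnorm z) (rho + a); last exact: le_trans (far _ _ t0 t2 zr) K0.
  apply: le_trans (hdev z t zr t1 t2); apply: (le_dev_fun s_gt0) => // y _.
  by rewrite !subr0 normrM ler_piMl.
have large k : forall t z, a / 2 < t -> t <= a ->
    dev (fun y => chi y * u y) 0 z (2 ^+ k * t) <= K.
  elim: k => [|k IH] t z t1 t2; first by rewrite mul1r base.
  rewrite exprS -mulrA; apply: dev0_double => // [|w]; last exact: IH.
  by rewrite mulr_gt0 ?exprn_gt0// (lt_trans _ t1)// divr_gt0.
have [k /andP[k1 k2]] : exists k, a / 2 < 2 ^- k * r <= a.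
  have ex : exists k, 2 ^- k * r <= a.
    exists (Num.truncn (r / a)).+1; rewrite ler_pdivrMl ?exprn_gt0// -ler_pdivrMr//.
    apply: (le_trans (ltW (truncnS_gt _))).
    by rewrite -natrX ler_nat ltnW// ltn_expl.
  case: (ex_minnP ex) => k hk kmin; exists k; rewrite hk andbT ltNge; apply/negP => kl.
  case: k hk kmin kl => [|k] hk kmin kl.
    by move: hk; rewrite invr1 mul1r leNgt ar.
  have := kmin k; rewrite ltnn => h; apply: notF; apply: h.
  move: kl; rewrite exprS invfM -mulrA; move: (2 ^- k * r) => p p0.
  by lra.
have := large k _ x k1 k2; rewrite mulVKf ?gt_eqF ?exprn_gt0// => e.
apply: (le_trans (osc_le s_gt0 0 x pl r0)); rewrite ler_pM2l//.
by apply: (le_trans e); rewrite mulrDl mul1r lerDl mulr_ge0.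
Qed.

End cutoff.

(** * The two error terms of the approximation *)

Section approximation.
Variables (R : realType) (n : nat) (s : 'rV[R]_n.+1).
Local Notation E := 'rV[R]_n.+1.
Local Notation mu := (@leb R n).
Hypothesis s_gt0 : forall i, 0 < s 0 i.
Implicit Types (x y z : E) (r t a c d K l lam rho gamma : R) (b f g u chi ba : E -> R).
Local Notation cube := (cube s).
Local Notation cvol := (cvol s).
Local Notation wnorm := (wnorm s).
Local Notation osc := (osc s).
Local Notation dev := (dev s).
Local Notation mean := (mean s).
Local Notation locint := (locint s).

Lemma osc_const f c x r : locint f -> 0 < r -> (forall y, cube x r y -> f y = c) ->
  osc f x r <= 0.
Proof.
move=> fl r0 h; apply: (le_trans (osc_le s_gt0 c x fl r0)).
rewrite pmulr_rle0//; apply: (dev_le_bound s_gt0) => // y /h ->.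
by rewrite subrr normr0.
Qed.

Lemma dev0_supported f g rho x r K : locint f -> locint g ->
  (forall y, `|f y| <= `|g y|) -> 0 < rho ->
  (forall y, ~ cube 0 rho y -> f y = 0) -> 0 < r -> rho <= K * r ->
  dev f 0 x r <= K ^+ n.+1 * dev g 0 0 rho.
Proof.
move=> fl gl fg rho0 f0 r0 rK.
have K0 : 0 < K by rewrite -(pmulr_lgt0 _ r0) (lt_le_trans rho0).
rewrite -(ler_pM2l (cvol_gt0 s_gt0 r0)) -dev_eq// mulrA [_ * _ ^+ _]mulrC -cvolM.
have mQ := measurable_cube s x r; have mA := measurable_cube s 0 rho.
have lf := locint_dist 0 fl; have lg := locint_dist 0 gl.
have mQA : measurable (cube x r `\` cube 0 rho) by exact: measurableD.
have mQI : measurable (cube x r `&` cube 0 rho) by exact: measurableI.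
have QE : (cube x r `&` cube 0 rho) `|` (cube x r `\` cube 0 rho) = cube x r.
  exact: setUIDK.
have e1 := Rintegral_setU_le (f := fun y => `|f y - 0|) mQI mQA.
rewrite QE in e1; have {}e1 := e1 _ (lf x r) (fun y => normr_ge0 _); apply: (le_trans e1).
have -> : \int[mu]_(y in cube x r `\` cube 0 rho) `|f y - 0| = 0.
  rewrite (@eq_Rintegral _ _ _ mu _ (cst 0)) => [|y /set_mem[_ /f0 ->]]; last by rewrite subrr normr0.
  by rewrite Rintegral_cst// mul0r.
rewrite addr0; apply: (@le_trans _ _ (\int[mu]_(y in cube 0 rho) `|f y - 0|)).
  by apply: Rintegral_subset => // y [].
apply: (@le_trans _ _ (\int[mu]_(y in cube 0 rho) `|g y - 0|)).
  by apply: le_Rintegral => // y _; rewrite !subr0.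
rewrite dev_eq// ler_wpM2r ?dev_ge0//.
rewrite !cvolE ler_wpM2l//; first by apply: prodr_ge0 => i _; rewrite mulr_ge0 ?ltW.
by rewrite lerXn2r// ?nnegrE ltW// mulr_gt0.
Qed.

(** [lam] is the Lipschitz constant after rescaling to radius 1; the estimates need it to be the
    same for all [rho]. *)
Definition cutoff chi rho lam := [/\ measurable_fun setT chi,
  forall y, 0 <= chi y <= 1,
  forall y z, `|chi y - chi z| <= lam / rho * wnorm (y - z),
  forall y, wnorm y <= rho -> chi y = 1 &
  forall y, 2 * rho <= wnorm y -> chi y = 0].

(** At scales up to rho / 4 the function vanishes near the origin, is b minus a constant far out,
    and is handled by [osc_product] on the intermediate shell. At larger scales chi (b - c) is
    subtracted from b, and its mean is controlled through its bounded support. *)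
Lemma osc_outside b gamma rho lam chi : locint b -> cutoff chi rho lam ->
  0 <= lam -> 0 < rho -> 0 <= gamma ->
  (forall x t, rho / 8 <= t -> osc b x t <= gamma) ->
  (forall x t, rho / 2 < wnorm x -> 0 < t -> osc b x t <= gamma) ->
  forall x r, 0 < r ->
  osc (fun y => (1 - chi y) * (b y + - mean b 0 rho)) x r <=
  gamma + 2 * ((1 + lam / 4 * (1 + 2 ^+ n.+1)) * ((32 ^+ n.+1 + 4 ^+ n.+1) * gamma)) +
  2 * (gamma + 2 * (12 ^+ n.+1 * ((1 + 3 ^+ n.+1) * gamma))).
Proof.
move=> bl [mchi chi01 lip chi1 chi0] lam0 rho0 g0 big out x r r0.
set c0 := mean b 0 rho.
have chiN y : `|chi y| <= 1 by have /andP[? ?] := chi01 y; rewrite ger0_norm.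
have chiN' y : `|1 - chi y| <= 1.
  by have /andP[? ?] := chi01 y; rewrite ger0_norm ?subr_ge0// gerBl.
have lc : locint (fun y => b y + - c0) by apply: locintD => //; exact: locint_cst.
have mlc : measurable_fun setT (fun y => b y + - c0) := locint_measurable s_gt0 lc.
have m1 : measurable_fun setT (fun y => 1 - chi y).
  by apply: measurable_funB => //; exact: measurable_cst.
have l1 : locint (fun y => (1 - chi y) * (b y + - c0)).
  apply: (locint_le lc); first exact: (measurable_funM m1 mlc).
  by move=> y; rewrite normrM ler_piMl.
have m2 : measurable_fun setT (fun y => - chi y) by exact: measurable_funN.
have l2 : locint (fun y => - chi y * (b y + - c0)).
  apply: (locint_le lc); first exact: (measurable_funM m2 mlc).
  by move=> y; rewrite normrM normrN ler_piMl.
have p2 : 0 <= 2 ^+ n.+1 :> R by rewrite exprn_ge0.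
have p3 : 0 <= 3 ^+ n.+1 :> R by rewrite exprn_ge0.
have p4 : 0 <= 4 ^+ n.+1 :> R by rewrite exprn_ge0.
have p12 : 0 <= 12 ^+ n.+1 :> R by rewrite exprn_ge0.
have p32 : 1 <= 32 ^+ n.+1 :> R by rewrite exprn_ege1// ler1n.
have mean_near y t K : 0 < t -> wnorm y + t <= 4 * rho -> 4 * rho <= K * t ->
    `|mean b y t - mean b 0 (4 * rho)| <= K ^+ n.+1 * gamma.
  move=> t0 yt tK; have r4 : 0 < 4 * rho by rewrite mulr_gt0.
  have sub : cube y t `<=` cube 0 (4 * rho) by apply: cube_sub => //; rewrite subr0.
  apply: (le_trans (mean_sub s_gt0 bl t0 sub r4 tK)).
  rewrite ler_wpM2l//; last by apply: big; lra.
  by rewrite exprn_ge0// -(pmulr_lge0 _ t0) (le_trans (ltW r4)).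
set A1 := 2 * (_ * (_ * gamma)); set A2 := 2 * (gamma + _).
have p32' := le_trans ler01 p32.
have lam4 : 0 <= lam / 4 by rewrite divr_ge0.
have A10 : 0 <= A1.
  apply: (mulr_ge0 (ler0n _ 2)); apply: (mulr_ge0 _ (mulr_ge0 (addr_ge0 p32' p4) g0)).
  exact: (addr_ge0 ler01 (mulr_ge0 lam4 (addr_ge0 ler01 p2))).
have A20 : 0 <= A2.
  apply: (mulr_ge0 (ler0n _ 2)); apply: (addr_ge0 g0); apply: (mulr_ge0 (ler0n _ 2)).
  exact: (mulr_ge0 p12 (mulr_ge0 (addr_ge0 ler01 p3) g0)).
(* Since r > rho / 4, the support radius 3 rho is at most 12 r, hence the powers of 12. *)
have [rr|rr] := leP r (rho / 4); last first.
  have l3 : locint (fun y => b y + (- chi y * (b y + - c0))) by exact: locintD.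
  have -> : (fun y => (1 - chi y) * (b y + - c0)) =
      (fun y => (b y + (- chi y * (b y + - c0))) + - c0) by apply/funext => y; ring.
  rewrite osc_add_const//; apply: (le_trans (osc_add s_gt0 x bl l2 r0)).
  apply: (@le_trans _ _ A2); last by rewrite lerDr addr_ge0.
  rewrite /A2 ler_pM2l//; apply: lerD; first by apply: big; lra.
  apply: (le_trans (osc_le s_gt0 0 x l2 r0)); rewrite ler_pM2l//.
  have r3 : 0 < 3 * rho by rewrite mulr_gt0.
  apply: (le_trans (dev0_supported (g := fun y => b y + - c0) (rho := 3 * rho) (K := 12) x
     l2 lc _ r3 _ r0 _)).
  - by move=> y; rewrite normrM normrN ler_piMl.
  - move=> y ny; rewrite chi0 ?oppr0 ?mul0r//; rewrite leNgt; apply/negP => yl.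
    by apply: ny; apply: wnorm_cube => //; rewrite subr0 (lt_trans yl)// ltr_pM2r// ltr_nat.
  - by lra.
  rewrite ler_wpM2l//.
  have -> : dev (fun y => b y + - c0) 0 0 (3 * rho) = dev b c0 0 (3 * rho).
    by rewrite -(dev_add_const s b c0 (- c0)) subrr.
  apply: (le_trans (dev_shift s_gt0 (mean b 0 (3 * rho)) c0 0 bl r3)).
  rewrite [leRHS]mulrDl mul1r; apply: (@lerD _ _ gamma); first by apply: big; lra.
  rewrite distrC.
  have sub : cube 0 rho `<=` cube 0 (3 * rho).
    by apply: cube_sub => //; rewrite subrr wnorm0// add0r ler_peMl ?(ltW rho0) ?ler1n.
  apply: (le_trans (mean_sub s_gt0 bl rho0 sub r3 (lexx _))).
  by rewrite ler_wpM2l//; apply: big; lra.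
apply: (@le_trans _ _ (gamma + A1)); last by rewrite lerDl.
have [x1|x1] := leP (wnorm x) (3 / 4 * rho).
  apply: (@le_trans _ _ 0); last by rewrite addr_ge0.
  apply: (osc_const l1 r0 (c := 0)) => y /(cube_wnorm s_gt0 (ltW r0)) yx.
  rewrite chi1 ?subrr ?mul0r//.
  have := wnorm_triangle s_gt0 x y 0; rewrite !subr0.
  by move: yx; move: (wnorm (y - x)) => q *; lra.
have [x2|x2] := leP (wnorm x) (3 * rho); last first.
  apply: (@le_trans _ _ gamma); last by rewrite lerDl.
  rewrite (osc_local l1 lc r0).
    by rewrite osc_add_const//; apply: out => //; lra.
  move=> y /(cube_wnorm s_gt0 (ltW r0)) yx; rewrite chi0 ?subr0 ?mul1r//.
  have := wnorm_triangle s_gt0 y x 0; rewrite !subr0 wnormB.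
  by move: yx; rewrite wnormB; move: (wnorm (x - y)) => q *; lra.
apply: (@le_trans _ _ A1); last by rewrite lerDr.
(* The product rule is used at scale rho / 4, hence [lam / 4]; its means, at scales above rho / 8,
   are compared in the cube of radius 4 rho, hence 32. *)
apply: (osc_product s_gt0 lc m1 chiN' lam4 _ r0 rr).
- move=> y z; have -> : 1 - chi y - (1 - chi z) = chi z - chi y by ring.
  rewrite wnormB; have -> : lam / 4 / (rho / 4) = lam / rho by field; rewrite gt_eqF.
  exact: lip.
- move=> t rt tl; have t0 := lt_le_trans r0 rt; rewrite osc_add_const//.
  apply: (@le_trans _ _ gamma); first by apply: out => //; lra.
  by rewrite ler_peMl// (le_trans p32)// lerDl.
move=> t t1 t2; have t0 : 0 < t by lra.
rewrite mean_add_const// mulrDl.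
apply: (le_trans (ler_distD (mean b 0 (4 * rho)) _ _)); apply: lerD.
  by apply: mean_near => //; lra.
by rewrite distrC; apply: mean_near => //; rewrite ?wnorm0//; lra.
Qed.

(** At scale [a], [ba] is close to the means of [b], so b - ba is small in mean there and
    [osc_cutoff] applies. Its support radius 2 rho plus [a] stays below 3 rho, the range where [ba]
    is controlled. *)
Lemma osc_inside b gamma rho a lam chi ba : locint b -> cutoff chi rho lam ->
  0 <= lam -> 0 < a -> a <= rho -> 0 <= gamma -> locint ba ->
  (forall x t, 0 < t -> t <= 4 * a -> osc b x t <= gamma) ->
  (forall x y, wnorm x <= 3 * rho -> wnorm (y - x) <= a ->
     `|ba y - mean b x (4 * a)| <= 4 ^+ n.+1 * gamma) ->
  forall x r, 0 < r ->
  osc (fun y => chi y * (b y - ba y)) x r <=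
  2 * ((1 + lam * (1 + 2 ^+ n.+1)) * (6 * 8 ^+ n.+1 * gamma)).
Proof.
move=> bl [mchi chi01 lip chi1 chi0] lam0 a0 arho g0 bal small near.
have rho0 := lt_le_trans a0 arho.
have chiN y : `|chi y| <= 1 by have /andP[? ?] := chi01 y; rewrite ger0_norm.
have ul : locint (fun y => b y - ba y) by exact: locintB.
have p4 : 0 <= 4 ^+ n.+1 :> R by rewrite exprn_ge0.
have p48 : 4 ^+ n.+1 <= 8 ^+ n.+1 :> R by rewrite lerXn2r ?nnegrE// ler_nat.
have p8 : 1 <= 8 ^+ n.+1 :> R by rewrite exprn_ege1// ler1n.
have nb : locint (fun y => - ba y).
  apply: (locint_le bal); last by move=> y; rewrite normrN.
  exact: (measurable_funN (locint_measurable s_gt0 bal)).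
(* One constant covers the oscillation at small scales and the mean at scale [a], where 8 is the
   ratio of 4 a to a / 2. *)
have fin p q : 0 <= p -> p <= q -> 1 <= q ->
    2 * (gamma + 2 * (p * gamma)) <= 6 * q * gamma /\ q * gamma + p * gamma <= 6 * q * gamma.
  move=> p0 pq q1.
  have h1 : 0 <= (q - p) * gamma by rewrite mulr_ge0// subr_ge0.
  have h2 : 0 <= (q - 1) * gamma by rewrite mulr_ge0// subr_ge0.
  have h3 : 0 <= p * gamma by rewrite mulr_ge0.
  rewrite mulrBl in h1; rewrite mulrBl mul1r in h2; rewrite -mulrA.
  by move: h1 h2 h3; move: (q * gamma) (p * gamma) => *; split; lra.
have [fin1 fin2] := fin _ _ p4 p48 p8.
apply: (osc_cutoff s_gt0 ul mchi chiN lam0 a0 (rho := 2 * rho)).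
- by rewrite !mulr_ge0// (le_trans _ p8).
- move=> y z; apply: (le_trans (lip y z)); rewrite ler_wpM2r ?wnorm_ge0//.
  by rewrite ler_wpM2l// lef_pV2// posrE.
- by move=> y /ltW/chi0.
- move=> x t xr t0 ta; apply: le_trans fin1.
  apply: (le_trans (osc_add s_gt0 x bl nb t0)); rewrite ler_pM2l//; apply: lerD.
    by apply: small => //; lra.
  apply: (le_trans (osc_le s_gt0 (- mean b x (4 * a)) x nb t0)); rewrite ler_pM2l//.
  apply: (dev_le_bound s_gt0) => // y yx; rewrite -opprD normrN; apply: near.
    by lra.
  exact: le_trans (cube_wnorm s_gt0 (ltW t0) yx) ta.
move=> x t xr t1 ta; have t0 : 0 < t by lra.
apply: le_trans fin2.
have d0 : 0 <= 4 ^+ n.+1 * gamma by rewrite mulr_ge0.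
have := dev_le_add s_gt0 ul bl t0 d0 (c := 0) (d := mean b x (4 * a)) (x := x).
move=> /(_ _)/le_trans; apply=> [y yx|].
  rewrite subr0 -[b y - ba y](subrKA (mean b x (4 * a))).
  apply: (le_trans (ler_normD _ _)); rewrite lerD2l distrC; apply: near; first by lra.
  exact: le_trans (cube_wnorm s_gt0 (ltW t0) yx) ta.
rewrite lerD2r; have a4 : 0 < 4 * a by rewrite mulr_gt0.
have sub : cube x t `<=` cube x (4 * a) by apply: cube_sub => //; rewrite subrr wnorm0//; lra.
have h : 4 * a <= 8 * t by lra.
apply: (le_trans (le_dev s_gt0 _ bl t0 sub a4 h)).
rewrite ler_wpM2l//.
by apply: small.
Qed.

Lemma osc_approximation lam : 0 <= lam -> exists2 C : R, 0 < C &
  forall b gamma rho a chi ba, locint b -> cutoff chi rho lam ->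
  0 < a -> a <= rho -> 0 <= gamma -> locint ba ->
  (forall x t, 0 < t -> t <= 4 * a -> osc b x t <= gamma) ->
  (forall x t, rho / 8 <= t -> osc b x t <= gamma) ->
  (forall x t, rho / 2 < wnorm x -> 0 < t -> osc b x t <= gamma) ->
  (forall x y, wnorm x <= 3 * rho -> wnorm (y - x) <= a ->
     `|ba y - mean b x (4 * a)| <= 4 ^+ n.+1 * gamma) ->
  forall x r, 0 < r ->
  osc (fun y => b y - chi y * (ba y - mean b 0 rho)) x r <= C * gamma.
Proof.
move=> lam0.
pose C1 : R := 1 + 2 * ((1 + lam / 4 * (1 + 2 ^+ n.+1)) * (32 ^+ n.+1 + 4 ^+ n.+1)) +
  2 * (1 + 2 * (12 ^+ n.+1 * (1 + 3 ^+ n.+1))).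
pose C2 : R := 2 * ((1 + lam * (1 + 2 ^+ n.+1)) * (6 * 8 ^+ n.+1)).
have pp (k : R) : 0 <= k -> 0 <= k ^+ n.+1 by exact: exprn_ge0.
have C10 : 0 < C1.
  have h1 : 0 <= 2 * ((1 + lam / 4 * (1 + 2 ^+ n.+1)) * (32 ^+ n.+1 + 4 ^+ n.+1)).
    by rewrite mulr_ge0// mulr_ge0// addr_ge0 ?pp// mulr_ge0 ?divr_ge0// addr_ge0 ?pp.
  have h2 : 0 <= 2 * (1 + 2 * (12 ^+ n.+1 * (1 + 3 ^+ n.+1))) :> R.
    by rewrite mulr_ge0// addr_ge0// mulr_ge0// mulr_ge0 ?pp// addr_ge0 ?pp.
  by rewrite /C1 ltr_pwDl// ltr_pwDl.
have C20 : 0 <= C2.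
  rewrite /C2 mulr_ge0// mulr_ge0 ?mulr_ge0 ?pp// addr_ge0// mulr_ge0// addr_ge0 ?pp//.
exists (2 * (C1 + C2)); first by rewrite mulr_gt0// ltr_pwDl.
move=> b gamma rho a chi ba bl cut a0 arho g0 bal small big out near x r r0.
have rho0 := lt_le_trans a0 arho.
have e1 := osc_outside bl cut lam0 rho0 g0 big out x r0.
have e2 := osc_inside bl cut lam0 a0 arho g0 bal small near x r0.
have [mchi chi01 _ _ _] := cut.
have chiN y : `|chi y| <= 1 by have /andP[? ?] := chi01 y; rewrite ger0_norm.
have chiN' y : `|1 - chi y| <= 1.
  by have /andP[? ?] := chi01 y; rewrite ger0_norm ?subr_ge0// gerBl.
set c0 := mean b 0 rho in e1 *.
have lc : locint (fun y => b y + - c0) by apply: locintD => //; exact: locint_cst.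
have ul : locint (fun y => b y - ba y) by exact: locintB.
have m1 : measurable_fun setT (fun y => 1 - chi y).
  by apply: measurable_funB => //; exact: measurable_cst.
have l1 : locint (fun y => (1 - chi y) * (b y + - c0)).
  apply: (locint_le lc).
    exact: (measurable_funM m1 (locint_measurable s_gt0 lc)).
  by move=> y; rewrite normrM ler_piMl.
have l2 : locint (fun y => chi y * (b y - ba y)).
  apply: (locint_le ul).
    exact: (measurable_funM mchi (locint_measurable s_gt0 ul)).
  by move=> y; rewrite normrM ler_piMl.
have -> : (fun y => b y - chi y * (ba y - c0)) =
    (fun y => ((1 - chi y) * (b y + - c0) + chi y * (b y - ba y)) + c0).
  by apply/funext => y; ring.
rewrite osc_add_const//; last exact: locintD.
apply: (le_trans (osc_add s_gt0 x l1 l2 r0)); rewrite -mulrA ler_pM2l// mulrDl.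
apply: lerD; first apply: (le_trans e1); last apply: (le_trans e2).
  rewrite /C1; move: (2 ^+ n.+1) (32 ^+ n.+1 + 4 ^+ n.+1) (12 ^+ n.+1) (3 ^+ n.+1) => q1 q2 q3 q4.
  by rewrite le_eqVlt; apply/orP; left; apply/eqP; ring.
rewrite /C2; move: (2 ^+ n.+1) (8 ^+ n.+1) => q1 q2.
by rewrite le_eqVlt; apply/orP; left; apply/eqP; ring.
Qed.

End approximation.

(** * Smooth functions built from exp(-1/t) *)

Section smooth_functions.
Variables (R : realType) (n : nat).
Local Notation E := 'rV[R]_n.+1.
Implicit Types (t u h c a : R) (k : nat) (i : 'I_n.+1) (x v : E) (f g : E -> R).

(** The functions t^(-k) exp(-1/t) on the positive axis: a family whose derivatives are combinations
    of its members. *)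
Definition flat k t : R := if 0 < t then t^-1 ^+ k * expR (- t^-1) else 0.

Lemma flat_ge0 k t : 0 <= flat k t.
Proof.
by rewrite /flat; case: ifP => // t0; rewrite mulr_ge0 ?expR_ge0// exprn_ge0// invr_ge0 ltW.
Qed.

Lemma flat_le0 k t : t <= 0 -> flat k t = 0.
Proof. by rewrite /flat => t0; rewrite ltNge t0. Qed.

(** The exponential at 1/t is at least one term of its series. *)
Lemma flat_bound k t : 0 < t -> t^-1 ^+ k.+1 * expR (- t^-1) <= k.+1`!%:R.
Proof.
move=> t0; rewrite expRN ler_pdivrMr ?expR_gt0// -ler_pdivrMl ?ltr0n ?fact_gt0//.
rewrite mulrC; apply: le_trans (expR_ge1Dxn k _); last by rewrite invr_ge0 ltW.
by rewrite lerDr.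
Qed.

Lemma flat_le_sqr k t : flat k t <= k.+2`!%:R * t ^+ 2.
Proof.
have [t0|t0] := ltP 0 t; last by rewrite flat_le0// mulr_ge0// sqr_ge0.
rewrite /flat t0 -ler_pdivrMr ?exprn_gt0//; apply: le_trans (flat_bound k.+1 t0).
by rewrite -exprVn mulrAC -exprD addn2.
Qed.

Lemma flat2_le2 t : flat 2 t <= 2.
Proof. by have [t0|t0] := ltP 0 t; [rewrite /flat t0 flat_bound|rewrite flat_le0]. Qed.

Lemma flat0_le1 t : flat 0 t <= 1.
Proof.
have [t0|t0] := ltP 0 t; last by rewrite flat_le0.
by rewrite /flat t0 expr0 mul1r -expR0 ler_expR oppr_le0 invr_ge0 ltW.
Qed.

Lemma is_derive_flat k t :
  is_derive t 1 (flat k) (flat k.+2 t - k%:R * flat k.+1 t).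
Proof.
have [t0|t0|<-] := ltgtP 0 t.
- apply: (@near_eq_is_derive _ _ _ (fun u => u^-1 ^+ k * expR (- u^-1))).
    by near=> u; rewrite /flat (_ : 0 < u)//; near: u; exact: lt_nbhsr.
  have tn0 : t != 0 by rewrite gt_eqF.
  have dV : is_derive t 1 (fun u : R => u^-1) (- t ^- 2 *: 1) by exact: is_deriveV.
  have dN : is_derive t 1 (fun u : R => - u^-1) (- (- t ^- 2 *: 1)) by exact: is_deriveN.
  have dE : is_derive t 1 (fun u : R => expR (- u^-1)) (expR (- t^-1) * - (- t ^- 2 *: 1)).
    exact: (@is_derive1_comp R expR (fun u => - u^-1) t _ _ (is_derive_expR (- t^-1)) dN).
  have dX := is_deriveX k dV.
  have -> : (fun u => u^-1 ^+ k * expR (- u^-1)) =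
      (fun u => u^-1) ^+ k * (fun u : R => expR (- u^-1)).
    by apply/funext => u; rewrite -[RHS]/(((fun u => u^-1) ^+ k) u * _) exprfctE.
  apply: (is_derive_eq (is_deriveM dX dE)); rewrite exprfctE.
  rewrite /flat t0 /GRing.scale/= !mulr1 -[t ^- 2]exprVn.
  case: k {dX} => [|k] /=; first by rewrite expr0 mul0r; ring.
  by rewrite !exprS; move: (expR (- t^-1)) (k.+1%:R) => q m; move: (t^-1) => r; move: (r ^+ k) => p; ring.
- apply: (@near_eq_is_derive _ _ _ (cst 0)).
    by near=> u; rewrite flat_le0//; apply: ltW; near: u; exact: lt_nbhsl.
  by rewrite !flat_le0 ?ltW// mulr0 subr0; exact: is_derive_cst.
rewrite !flat_le0// mulr0 subr0.
(* At the origin the difference quotient is at most a multiple of |h|, by [flat_le_sqr]. *)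
have cv : h^-1 *: ((flat k \o shift 0) (h *: 1) - flat k 0) @[h --> 0^'] --> (0 : R).
  apply/cvgrPdist_le => e e0; near=> h.
  rewrite sub0r normrN (flat_le0 k (lexx 0)) subr0 /= addr0 [h *: 1]mulr1.
  have hn0 : h != 0 by near: h; exact: nbhs_dnbhs_neq.
  rewrite /GRing.scale/= normrM normfV (ger0_norm (flat_ge0 _ _)).
  rewrite ler_pdivrMl ?normr_gt0//; apply: (le_trans (flat_le_sqr k h)).
  rewrite -(real_normK (num_real h)) expr2 mulrCA ler_wpM2l//.
  rewrite -ler_pdivlMl ?ltr0n ?fact_gt0//.
  near: h; apply: dnbhs0_le; rewrite mulr_gt0// invr_gt0 ltr0n fact_gt0//.
by apply: DeriveDef; [apply/cvg_ex; exists 0|exact: cvg_lim cv].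
Unshelve. all: by end_near. Qed.

Lemma flat_continuous k : continuous (flat k).
Proof.
by move=> t; apply/differentiable_continuous/derivable1_diffP; have [] := is_derive_flat k t.
Qed.

(** A class stable under partial derivatives: smoothness, which concerns all iterated derivatives,
    becomes an induction on the list of directions. All indices [k] are included because
    differentiation raises them. *)
Inductive elementary : (E -> R) -> Prop :=
| elementary_cst c : elementary (cst c)
| elementary_flat k a i c : elementary (fun x => flat k (a * x 0 i + c))
| elementary_add f g : elementary f -> elementary g -> elementary (f + g)
| elementary_mul f g : elementary f -> elementary g -> elementary (f * g)
| elementary_inv f : (forall x, f x != 0) -> elementary f ->
    elementary (fun x => (f x)^-1).

Lemma is_derive_line f x v d :
  is_derive (0 : R) 1 (fun h : R => f (h *: v + x)) d -> is_derive x v f d.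
Proof.
move=> [d1 d2]; apply: (@DeriveDef _ _ _ x v f); first exact/derivable1P.
rewrite -d2 /derive; set F := fun h => h^-1 *: _; set G := fun h => h^-1 *: _.
suff -> : F = G by [].
by apply/funext => h; rewrite /F /G /= addr0 scale0r add0r [_%:A]mulr1.
Qed.

Lemma elementary_continuous f : elementary f -> continuous f.
Proof.
elim=> [c|k a i c|{}f g _ fc _ gc|{}f g _ fc _ gc|{}f f0 _ fc] x.
- exact: (@cst_continuous _ _ c).
- apply: (@continuous_comp _ _ _ (fun y : E => a * y 0 i + c) (flat k)).
    have h0 : {for x, continuous (fun y : E => y 0 i : R)} by exact: coord_continuous.
    have h1 := continuousM (@cst_continuous E R a x) h0.
    exact: (continuousD h1 (@cst_continuous E R c x)).
  exact: flat_continuous.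
- exact: (continuousD (fc x) (gc x)).
- exact: (continuousM (fc x) (gc x)).
- exact: (continuousV (f0 x) (fc x)).
Qed.

Lemma elementary_derive i f : elementary f -> exists2 g, elementary g &
  forall x, is_derive x (delta_mx 0 i) f (g x).
Proof.
elim=> [c|k a j c|{}f g _ [f' ef f'P] _ [g' eg g'P]|
    {}f g ef0 [f' ef f'P] eg0 [g' eg g'P]|{}f f0 ef0 [f' ef f'P]].
- by exists (cst 0) => [|x]; [exact: elementary_cst|exact: is_derive_cst].
- pose d : R := (j == i)%:R.
  exists ((cst (a * d) : E -> R) * ((fun x => flat k.+2 (a * x 0 j + c)) +
     (cst (- k%:R) : E -> R) * (fun x => flat k.+1 (a * x 0 j + c)))).
    apply: elementary_mul; first exact: elementary_cst.
    apply: elementary_add; first exact: elementary_flat.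
    by apply: elementary_mul; [exact: elementary_cst|exact: elementary_flat].
  move=> x; apply: is_derive_line.
  have -> : (fun h : R => flat k (a * (h *: delta_mx 0 i + x) 0 j + c)) =
      flat k \o (fun h : R => h * (a * d) + (a * x 0 j + c)).
    by apply/funext => h /=; rewrite !mxE eqxx/= -/d; congr flat; ring.
  have dL : is_derive (0 : R) 1 (fun h : R => h * (a * d) + (a * x 0 j + c)) (a * d).
    have dM := is_deriveM (is_derive_id (0 : R) 1) (is_derive_cst (a * d) (0 : R) 1).
    apply: (is_derive_eq (is_deriveD dM (is_derive_cst (a * x 0 j + c) (0 : R) 1))).
    by rewrite addr0 scaler0 add0r /GRing.scale/= mulr1.
  have dF := is_derive_flat k (0 * (a * d) + (a * x 0 j + c)).
  apply: (is_derive_eq (@is_derive1_comp R (flat k)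
    (fun h => h * (a * d) + (a * x 0 j + c)) 0 _ _ dF dL)).
  by rewrite mul0r add0r -[RHS]/(a * d * (_ + - k%:R * _)); ring.
- exists (f' + g') => [|x]; first exact: elementary_add.
  exact: (is_deriveD (f'P x) (g'P x)).
- exists (f * g' + g * f') => [|x]; last exact: (is_deriveM (f'P x) (g'P x)).
  by apply: elementary_add; apply: elementary_mul.
exists ((cst (-1) : E -> R) * ((fun x => (f x)^-1) * (fun x => (f x)^-1)) * f').
  apply: elementary_mul => //; apply: elementary_mul; first exact: elementary_cst.
  by apply: elementary_mul; exact: elementary_inv.
move=> x; have [d1 d2] := f'P x.
apply: DeriveDef; first exact: derivableV.
rewrite deriveV// d2 -[RHS]/(-1 * ((f x)^-1 * (f x)^-1) * f' x).
by rewrite /GRing.scale/= expr2 invfM mulN1r.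
Qed.

Lemma elementary_smooth f : elementary f -> smooth f.
Proof.
move=> ef l; suff el : elementary (iter_partial l f).
  split; first exact: elementary_continuous.
  by move=> i x; have [g _ /(_ x)[]] := elementary_derive i el.
elim: l => //= i l /(elementary_derive i)[g eg gP].
suff -> : 'D_(delta_mx 0 i) (iter_partial l f) = g by [].
by apply/funext => x; have [] := gP x.
Qed.

Lemma elementary_sum (I : Type) (q : seq I) (F : I -> E -> R) :
  (forall j, elementary (F j)) -> elementary (fun x => \sum_(j <- q) F j x).
Proof.
move=> eF; elim: q => [|j q IH].
  by under eq_fun do rewrite big_nil; exact: elementary_cst.
by under eq_fun do rewrite big_cons; exact: elementary_add.
Qed.

Lemma elementary_prod (I : Type) (q : seq I) (F : I -> E -> R) :
  (forall j, elementary (F j)) -> elementary (fun x => \prod_(j <- q) F j x).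
Proof.
move=> eF; elim: q => [|j q IH].
  by under eq_fun do rewrite big_nil; exact: elementary_cst.
by under eq_fun do rewrite big_cons; exact: elementary_mul.
Qed.

Definition step t : R := flat 0 t / (flat 0 t + flat 0 (1 - t)).

Lemma flat_sum_ge t : expR (- 2) <= flat 0 t + flat 0 (1 - t).
Proof.
have half u : 2^-1 <= u -> expR (- 2) <= flat 0 u.
  move=> u2; have u0 : 0 < u by lra.
  rewrite /flat u0 expr0 mul1r ler_expR lerN2 -[leRHS]invrK.
  by rewrite lef_pV2// posrE// invr_gt0.
have [t2|t2] := leP 2^-1 t; first by rewrite (le_trans (half _ t2))// lerDl flat_ge0.
rewrite (le_trans (half (1 - t) _)) ?lerDr ?flat_ge0//.
by lra.
Qed.

Lemma flat_sum_gt0 t : 0 < flat 0 t + flat 0 (1 - t).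
Proof. exact: lt_le_trans (expR_gt0 _) (flat_sum_ge t). Qed.

Lemma step_ge0 t : 0 <= step t.
Proof. by rewrite divr_ge0 ?flat_ge0// ltW// flat_sum_gt0. Qed.

Lemma step_le1 t : step t <= 1.
Proof. by rewrite ler_pdivrMr ?flat_sum_gt0// mul1r lerDl flat_ge0. Qed.

Lemma step0 t : t <= 0 -> step t = 0.
Proof. by move=> t0; rewrite /step flat_le0// mul0r. Qed.

Lemma step1 t : 1 <= t -> step t = 1.
Proof.
move=> t1; have := flat_sum_gt0 t.
rewrite /step (@flat_le0 0 (1 - t)) ?subr_le0// addr0 => t0.
by rewrite divff// gt_eqF.
Qed.

Lemma flat0_lipschitz t u : `|flat 0 t - flat 0 u| <= 2 * `|t - u|.
Proof.
wlog tu : t u / t <= u.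
  move=> h; have [tu|/ltW ut] := leP t u; first exact: h.
  by rewrite distrC (distrC t); exact: h.
have [] := @MVT_segment _ (flat 0) (flat 2) t u tu.
- move=> x _; apply: (is_derive_eq (is_derive_flat 0 x)).
  by rewrite mul0r subr0.
- by apply: continuous_subspaceT; exact: flat_continuous.
move=> c _ e; rewrite distrC e normrM (distrC t).
by rewrite ler_wpM2r// ger0_norm ?flat_ge0// flat2_le2.
Qed.

(** [flat 0] is Lipschitz since its derivative [flat 2] is at most 2, and the denominators are at
    least exp(-2), because one of t and 1 - t is at least 1/2. *)
Lemma step_lipschitz : exists2 L : R, 0 < L & forall t u, `|step t - step u| <= L * `|t - u|.
Proof.
pose d : R := expR (- 2); have d0 : 0 < d := expR_gt0 _.
exists (4 / (d * d)) => [|t u]; first by rewrite divr_gt0// mulr_gt0.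
have := flat0_lipschitz t u; have := flat0_lipschitz (1 - u) (1 - t).
have -> : 1 - u - (1 - t) = t - u by ring.
have := flat_sum_ge t; have := flat_sum_ge u; have := flat_sum_gt0 t; have := flat_sum_gt0 u.
rewrite /step -/d.
have := flat_ge0 0 u; have := flat_ge0 0 (1 - u); have := flat0_le1 u; have := flat0_le1 (1 - u).
move: (flat 0 t) (flat 0 (1 - t)) (flat 0 u) (flat 0 (1 - u)) (t - u).
move=> a b p q m q1 p1 q0 p0 pq0 ab0 dpq dab h1 h2.
have -> : a / (a + b) - p / (p + q) = ((a - p) * q + p * (q - b)) / ((a + b) * (p + q)).
  by field; rewrite !gt_eqF.
have D0 : 0 < (a + b) * (p + q) by rewrite mulr_gt0.
rewrite normrM normfV (gtr0_norm D0) ler_pdivrMr//.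
apply: (@le_trans _ _ (4 * `|m|)).
  apply: (le_trans (ler_normD _ _)); rewrite !normrM (ger0_norm q0) (ger0_norm p0).
  have e1 : `|a - p| * q <= 2 * `|m| by apply: le_trans h2; rewrite ler_piMr.
  have e2 : p * `|q - b| <= 2 * `|m| by apply: le_trans h1; rewrite ler_piMl.
  by move: e1 e2; move: (`|a - p| * q) (p * `|q - b|) `|m| => *; lra.
have dD : d * d <= (a + b) * (p + q) by apply: ler_pM; rewrite // ltW.
move: dD; move: ((a + b) * (p + q)) => D dD.
have -> : 4 / (d * d) * `|m| * D = 4 * `|m| * (D / (d * d)) by field; rewrite gt_eqF.
by rewrite ler_peMr ?mulr_ge0// ler_pdivlMr ?mulr_gt0// mul1r.
Qed.

Lemma elementary_step a i c : elementary (fun x => step (a * x 0 i + c)).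
Proof.
have ef : elementary (fun x => flat 0 (a * x 0 i + c)) by exact: elementary_flat.
have eg : elementary (fun x => flat 0 (1 - (a * x 0 i + c))).
  have -> : (fun x => flat 0 (1 - (a * x 0 i + c))) =
      (fun x : E => flat 0 (- a * x 0 i + (1 - c))).
    by apply/funext => x; congr flat; ring.
  exact: elementary_flat.
apply: (elementary_mul ef); apply: elementary_inv.
  by move=> x; rewrite gt_eqF// flat_sum_gt0.
exact: (elementary_add ef eg).
Qed.

End smooth_functions.

(** * Cutoffs and the smoothed function *)

Section partition_of_unity.
Variables (R : realType) (n : nat) (s : 'rV[R]_n.+1).
Local Notation E := 'rV[R]_n.+1.
Hypothesis s_gt0 : forall i, 0 < s 0 i.
Implicit Types (x y z : E) (r t u a c K rho lam gamma : R) (b f g chi ba : E -> R).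
Local Notation cube := (cube s).
Local Notation wnorm := (wnorm s).
Local Notation osc := (osc s).
Local Notation mean := (mean s).
Local Notation locint := (locint s).

Lemma prodr_dist (I : Type) (q : seq I) (F G : I -> R) :
  (forall i, 0 <= F i <= 1) -> (forall i, 0 <= G i <= 1) ->
  `|\prod_(i <- q) F i - \prod_(i <- q) G i| <= \sum_(i <- q) `|F i - G i|.
Proof.
move=> F01 G01; elim: q => [|i q IH]; first by rewrite !big_nil subrr normr0.
have P01 : 0 <= \prod_(j <- q) F j <= 1.
  rewrite prodr_ge0 => [|j _]; last by have /andP[] := F01 j.
  by apply: prodr_ile1 => j _; exact: F01.
rewrite !big_cons; move: IH P01 (F01 i) (G01 i).
move: (\prod_(j <- q) F j) (\prod_(j <- q) G j) (\sum_(j <- q) _) (F i) (G i).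
move=> p p' S a a' IH /andP[p0 p1] _ /andP[a0 a1].
have -> : a * p - a' * p' = (a - a') * p + a' * (p - p') by ring.
apply: (le_trans (ler_normD _ _)); rewrite !normrM (ger0_norm p0) (ger0_norm a0).
by apply: lerD; [rewrite ler_piMr|apply: le_trans IH; rewrite ler_piMl].
Qed.

(** Equal to 1 on [-1, 1] and to 0 outside ]-2, 2[. *)
Definition plateau t : R := step (2 - t) * step (2 + t).

Lemma plateau01 t : 0 <= plateau t <= 1.
Proof.
by rewrite /plateau mulr_ge0 ?step_ge0//= mulr_ile1 ?step_ge0 ?step_le1.
Qed.

(** A product of one plateau per coordinate is smooth, unlike a function of [wnorm]; rescaling each
    coordinate by [rho * s 0 i] leaves a Lipschitz constant independent of [rho]. *)
Lemma cutoff_exists : exists2 lam, 0 <= lam &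
  forall rho, 0 < rho -> exists2 chi, elementary chi & cutoff s chi rho lam.
Proof.
have [L L0 lip] := @step_lipschitz R.
exists (n.+1%:R * (2 * L)); first by rewrite !mulr_ge0// ltW.
move=> rho rho0; pose c i : R := rho * s 0 i.
have c0 i : 0 < c i by rewrite mulr_gt0.
pose chi x : R := \prod_i plateau (x 0 i / c i).
have echi : elementary chi.
  apply: elementary_prod => i; apply: elementary_mul.
    have -> : (fun x : E => step (2 - x 0 i / c i)) =
        (fun x : E => step (- (c i)^-1 * x 0 i + 2)).
      by apply/funext => x; congr step; rewrite mulNr addrC [_ * x 0 i]mulrC.
    exact: elementary_step.
  have -> : (fun x : E => step (2 + x 0 i / c i)) =
      (fun x : E => step ((c i)^-1 * x 0 i + 2)).
    by apply/funext => x; congr step; rewrite addrC [_^-1 * x 0 i]mulrC.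
  exact: elementary_step.
exists chi => //; split.
- by apply: continuous_measurable_rV; exact: elementary_continuous.
- move=> x; rewrite /chi prodr_ge0 => [|i _]; last by have /andP[] := plateau01 (x 0 i / c i).
  by apply: prodr_ile1 => i _; exact: plateau01.
- move=> x y; apply: (le_trans (prodr_dist _ _ _)) => [i|i|]; [exact: plateau01..|].
  apply: (@le_trans _ _ (\sum_(i : 'I_n.+1) 2 * L / rho * wnorm (x - y))).
    apply: ler_sum => i _.
    have h : `|x 0 i / c i - y 0 i / c i| <= wnorm (x - y) / rho.
      rewrite -mulrBl normrM normfV (gtr0_norm (c0 i)) ler_pdivrMr//.
      have := normr_le_wnorm s_gt0 (x - y) i; rewrite !mxE => /le_trans; apply.
      by rewrite /c mulrA divfK// gt_eqF.
    have : `|plateau (x 0 i / c i) - plateau (y 0 i / c i)| <=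
        2 * L * `|x 0 i / c i - y 0 i / c i|.
      move: (x 0 i / c i) (y 0 i / c i) => t u; rewrite /plateau.
      have := lip (2 - t) (2 - u); have := lip (2 + t) (2 + u).
      have -> : 2 + t - (2 + u) = t - u by ring.
      have -> : 2 - t - (2 - u) = - (t - u) by ring.
      rewrite normrN.
      move: (step_ge0 (2 - u)) (step_le1 (2 - u)) (step_ge0 (2 + t)) (step_le1 (2 + t)).
      move: (step (2 - t)) (step (2 + t)) (step (2 - u)) (step (2 + u)) (t - u).
      move=> p q p' q' m p0 p1 q0 q1 h1 h2.
      have -> : p * q - p' * q' = (p - p') * q + p' * (q - q') by ring.
      apply: (le_trans (ler_normD _ _)); rewrite !normrM (ger0_norm p0) (ger0_norm q0).
      have e1 : `|p - p'| * q <= L * `|m| by apply: le_trans h2; rewrite ler_piMr.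
      have e2 : p' * `|q - q'| <= L * `|m| by apply: le_trans h1; rewrite ler_piMl.
      rewrite -mulrA; move: e1 e2; move: (`|p - p'| * q) (p' * `|q - q'|) (L * `|m|) => *; lra.
    move=> /le_trans; apply; rewrite -[2 * L / rho * _]mulrA ler_wpM2l ?mulr_ge0 ?(ltW L0)//.
    by rewrite [leRHS]mulrC.
  by rewrite sumr_const card_ord -[leLHS]mulr_natl !mulrA.
- move=> x xr; rewrite /chi big1// => i _.
  have := normr_le_wnorm s_gt0 x i => h.
  have {}h : `|x 0 i| <= c i by apply: (le_trans h); rewrite ler_wpM2r// ltW.
  have : `|x 0 i / c i| <= 1 by rewrite normrM normfV (gtr0_norm (c0 i)) ler_pdivrMr// mul1r.
  rewrite ler_norml => /andP[t0 t1]; rewrite /plateau !step1 ?mulr1//; lra.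
move=> x xr.
have [i hi] : exists i, 2 * rho <= `|x 0 i| / s 0 i.
  apply: contrapT => no; move: xr; rewrite leNgt => /negP; apply.
  rewrite wnormE; apply/bigmax_ltP; split; first by rewrite mulr_gt0.
  by move=> i _; rewrite ltNge; apply/negP => h; apply: no; exists i.
rewrite /chi (bigD1 i)//= (_ : plateau _ = 0) ?mul0r//.
have {}hi : 2 <= `|x 0 i / c i|.
  rewrite normrM normfV (gtr0_norm (c0 i)) ler_pdivlMr// /c mulrA -ler_pdivlMr//.
move: hi; move: (x 0 i / c i) => t; rewrite /plateau ler_normr => /orP[t2|t2].
  by rewrite step0 ?mul0r//; lra.
by rewrite [step (2 + t)]step0 ?mulr0//; lra.
Qed.

(** A bump supported in [-1, 1], written as a difference of shifted steps so that the sum of its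
    integer translates telescopes to 1. *)
Definition hat t : R := step (t + 1) - step t.

Lemma hat01 t : 0 <= hat t <= 1.
Proof.
rewrite /hat; have := step_ge0 t; have := step_le1 t.
have := step_ge0 (t + 1); have := step_le1 (t + 1).
have [t0|t0] := leP t 0.
  by rewrite (step0 t0) => *; apply/andP; split; lra.
by rewrite (@step1 _ (t + 1)); [move=> *; apply/andP; split; lra|lra].
Qed.

Lemma hat0 t : 1 <= `|t| -> hat t = 0.
Proof.
rewrite ler_normr /hat => /orP[t1|t1].
  by rewrite !step1 ?subrr//; lra.
by rewrite !step0 ?subrr//; lra.
Qed.

Lemma sum_hat N t : 0 <= t -> t + 1 <= N%:R -> \sum_(j < N) hat (t - j%:R) = 1.
Proof.
move=> t0 tN.
rewrite (eq_bigr (fun j : 'I_N => - (step (t + 1 - j.+1%:R) - step (t + 1 - j%:R)))); last first.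
  by move=> j _; rewrite /hat opprB -natr1; congr (step _ - step _); ring.
rewrite sumrN -(big_mkord xpredT (fun j => step (t + 1 - j.+1%:R) - step (t + 1 - j%:R))).
rewrite (telescope_sumr (fun j => step (t + 1 - j%:R)))// opprB subr0.
by rewrite step1 ?step0 ?subr0//; lra.
Qed.

(** [ba] averages means of [b] over cubes centered at grid points. Those with nonzero weight at [y]
    are within [a] of [y], so their cubes lie in [cube x (4 * a)] and [mean_sub] applies. *)
Lemma smoothing_exists b a rho gamma : locint b -> 0 < a -> a <= rho -> 0 <= gamma ->
  (forall x, osc b x (4 * a) <= gamma) ->
  exists ba, [/\ elementary ba, locint ba & forall x y, wnorm x <= 3 * rho ->
    wnorm (y - x) <= a -> `|ba y - mean b x (4 * a)| <= 4 ^+ n.+1 * gamma].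
Proof.
move=> bl a0 arho g0 small.
(* [M] steps reach 4 rho, which bounds the norm of [y]. Indices are shifted by [M] to be natural
   numbers, and the final successor in [N] accounts for the endpoint 2 M. *)
pose M := (Num.truncn (4 * rho / a)).+1; pose N := (M + M).+1.
pose c i : R := a * s 0 i; have c0 i : 0 < c i by rewrite mulr_gt0.
pose J : finType := {ffun 'I_n.+1 -> 'I_N}.
pose p (j : J) : E := \row_i (c i * ((j i)%:R - M%:R)).
pose psi (j : J) y := \prod_i hat (y 0 i / c i + M%:R - (j i)%:R).
have psi01 j y : 0 <= psi j y <= 1.
  rewrite /psi prodr_ge0 => [|i _]; last by have /andP[] := hat01 (y 0 i / c i + M%:R - (j i)%:R).
  by apply: prodr_ile1 => i _; exact: hat01.
have epsi j : elementary (psi j).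
  apply: elementary_prod => i.
  have -> : (fun y : E => hat (y 0 i / c i + M%:R - (j i)%:R)) =
      (fun y : E => step ((c i)^-1 * y 0 i + (M%:R - (j i)%:R + 1))) +
      ((cst (-1) : E -> R) * (fun y : E => step ((c i)^-1 * y 0 i + (M%:R - (j i)%:R)))).
    apply/funext => y.
    rewrite -[RHS]/(step ((c i)^-1 * y 0 i + (M%:R - (j i)%:R + 1)) +
      -1 * step ((c i)^-1 * y 0 i + (M%:R - (j i)%:R))) mulN1r /hat.
    by congr (step _ - step _); ring.
  apply: elementary_add; first exact: elementary_step.
  by apply: elementary_mul; [exact: elementary_cst|exact: elementary_step].
pose ba y := \sum_j psi j y * mean b (p j) a.
have eba : elementary ba.
  apply: elementary_sum => j; apply: elementary_mul; first exact: epsi.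
  exact: (elementary_cst _ (mean b (p j) a)).
exists ba; split => //.
  apply: (locint_le (locint_cst s (\sum_j `|mean b (p j) a|))).
    by apply: continuous_measurable_rV; exact: elementary_continuous.
  move=> y; rewrite [leRHS]ger0_norm; last by apply: sumr_ge0 => j _.
  apply: (le_trans (ler_norm_sum _ _ _)); apply: ler_sum => j _.
  have /andP[q0 q1] := psi01 j y.
  by rewrite normrM (ger0_norm q0) ler_piMl.
move=> x y xr yx.
have sum1 : \sum_j psi j y = 1.
  (* The sum over grid points of products over coordinates is the product of one-dimensional sums,
     each equal to 1. *)
  rewrite /psi -(bigA_distr_bigA (fun i (k : 'I_N) => hat (y 0 i / c i + M%:R - k%:R))).
  apply: big1 => i _.
  have yr : wnorm y <= 4 * rho.
    have := wnorm_triangle s_gt0 x y 0; rewrite !subr0.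
    by move: yx; move: (wnorm (y - x)) => q *; lra.
  have yM : `|y 0 i / c i| <= M%:R.
    rewrite normrM normfV (gtr0_norm (c0 i)) ler_pdivrMr//.
    apply: (le_trans (normr_le_wnorm s_gt0 y i)); rewrite /c mulrA ler_wpM2r ?(ltW (s_gt0 i))//.
    apply: (le_trans yr); rewrite -ler_pdivrMr//; apply: ltW; exact: truncnS_gt.
  move: yM; rewrite ler_norml => /andP[y0 y1]; apply: sum_hat; first by lra.
  have -> : N%:R = (M + M)%:R + 1 :> R by rewrite natr1.
  by rewrite natrD; lra.
have sumE w : w = \sum_j psi j y * w by rewrite -mulr_suml sum1 mul1r.
have -> : ba y - mean b x (4 * a) = \sum_j psi j y * (mean b (p j) a - mean b x (4 * a)).
  rewrite /ba [X in _ - X]sumE -sumrB.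
  by apply: eq_bigr => j _; rewrite mulrBr.
rewrite [leRHS]sumE.
apply: (le_trans (ler_norm_sum _ _ _)); apply: ler_sum => j _.
have /andP[q0 q1] := psi01 j y.
rewrite normrM (ger0_norm q0).
have [->|psi0] := eqVneq (psi j y) 0; first by rewrite !mul0r.
rewrite ler_wpM2l//.
have yp : wnorm (p j - y) <= a.
  apply/wnormP => //; first exact: ltW.
  move=> i; rewrite !mxE distrC -/(c i).
  have : `|y 0 i / c i + M%:R - (j i)%:R| <= 1.
    rewrite leNgt; apply/negP => /ltW/hat0 h0; move/negP: psi0; apply.
    by rewrite /psi (bigD1 i)//= h0 mul0r.
  have -> : y 0 i - c i * ((j i)%:R - M%:R) = (y 0 i / c i + M%:R - (j i)%:R) * c i.
    by field; rewrite gt_eqF.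
  by rewrite normrM (gtr0_norm (c0 i)) => h; rewrite -[leRHS]mul1r ler_wpM2r// ltW.
have a4 : 0 < 4 * a by rewrite mulr_gt0.
have sub : cube (p j) a `<=` cube x (4 * a).
  apply: cube_sub => //; have := wnorm_triangle s_gt0 y (p j) x.
  by move: yp yx; move: (wnorm (p j - y)) (wnorm (y - x)) => *; lra.
apply: (le_trans (mean_sub s_gt0 bl a0 sub a4 (lexx _))).
by rewrite ler_wpM2l// exprn_ge0.
Qed.

End partition_of_unity.

(** * Back to Euclidean balls *)

Section mean_oscillation_cubes.
Variables (R : realType) (n : nat) (s : 'rV[R]_n.+1).
Local Notation E := 'rV[R]_n.+1.
Local Notation mu := (@leb R n).
Hypothesis s_gt0 : forall i, 0 < s 0 i.
Implicit Types (x y z : E) (r t u a c K rho lam gamma : R) (b f g chi ba : E -> R).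
Local Notation cube := (cube s).
Local Notation cvol := (cvol s).
Local Notation wnorm := (wnorm s).
Local Notation osc := (osc s).
Local Notation mean := (mean s).
Local Notation locint := (locint s).

(** The ball lies in a cube of comparable volume; the factor 2 replaces the mean over this cube by
    the mean over the ball. *)
Lemma mean_oscillation_le : exists2 C : R, 0 < C & forall f K, locint f ->
  (forall x r, 0 < r -> osc f x r <= K) ->
  forall x r, 0 < r -> (mean_oscillation f x r <= (C * K)%:E)%E.
Proof.
have [k1 k10 h1] := cube_sub_eball s_gt0; have [k2 k20 h2] := eball_sub_cube s_gt0.
exists (2 * (k2 * k1) ^+ n.+1); first by rewrite mulr_gt0// exprn_gt0// mulr_gt0.
move=> f K fl oK x r r0.
have kr : 0 < k2 * r by rewrite mulr_gt0.
have kr1 : 0 < r / k1 by rewrite divr_gt0.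
have K0 : 0 <= K by rewrite (le_trans _ (oK x r r0))// dev_ge0.
have mB : measurable (eball x r) by exact: measurable_eball.
have mQ := measurable_cube s x (k2 * r).
have Boo : (mu (eball x r) < +oo)%E.
  by apply: le_lt_trans (leb_cube_lty s x (k2 * r)); apply: le_measure; rewrite ?inE//; exact: h2.
have Bfin : mu (eball x r) \is a fin_num by rewrite ge0_fin_numE.
set v := fine (mu (eball x r)).
have vge : cvol (r / k1) <= v.
  rewrite -lee_fin /v fineK// -(leb_cube s_gt0 x (ltW kr1)).
  apply: le_measure; rewrite ?inE//; first exact: measurable_cube.
  by have := h1 x _ kr1; rewrite [k1 * _]mulrC divfK// gt_eqF.
have v0 : 0 < v := lt_le_trans (cvol_gt0 s_gt0 kr1) vge.
set m := mean f x (k2 * r); set J := \int[mu]_(y in eball x r) `|f y - m|.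
have fB : mu.-integrable (eball x r) (EFin \o f).
  by apply: (integrableS mQ) (fl x (k2 * r)) => //; exact: h2.
have cB c : mu.-integrable (eball x r) (EFin \o (fun=> c)) by exact: integrable_const.
have dB c : mu.-integrable (eball x r) (EFin \o (fun y => `|f y - c|)).
  by have := integrable_norm (integrable_subf mB fB (cB c)).
have JK : J <= cvol (k2 * r) * K.
  apply: (@le_trans _ _ (cvol (k2 * r) * osc f x (k2 * r))).
    rewrite oscE -dev_eq//; apply: Rintegral_subset => //; first exact: locint_dist.
    exact: h2.
  by rewrite ler_pM2l ?cvol_gt0// oK.
have mJ : `|m - ball_mean f x r| <= v^-1 * J.
  have -> : m - ball_mean f x r = - (v^-1 * \int[mu]_(y in eball x r) (f y - m)).
    rewrite RintegralB// Rintegral_cst// -/v /ball_mean -/v mulrBr opprB.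
    by rewrite [m * v]mulrC mulKf// gt_eqF.
  rewrite normrN normrM gtr0_norm ?invr_gt0// ler_wpM2l ?invr_ge0 ?(ltW v0)//.
  by apply: le_normr_Rintegral => //; exact: integrable_subf.
rewrite /mean_oscillation -/v -(fineK (integrable_fin_num mB (dB (ball_mean f x r)))).
rewrite -EFinM lee_fin.
have step1 : \int[mu]_(y in eball x r) `|f y - ball_mean f x r| <= J + J.
  apply: (@le_trans _ _ (\int[mu]_(y in eball x r) (`|f y - m| + `|m - ball_mean f x r|))).
    apply: le_Rintegral => //; first exact: integrable_addf.
    by move=> y _; exact: ler_distD.
  rewrite RintegralD// lerD2l Rintegral_cst// -/v mulrC.
  by rewrite -ler_pdivlMl.
rewrite ler_pdivrMl//; apply: (le_trans step1).
apply: (@le_trans _ _ (2 * (cvol (k2 * r) * K))); first by rewrite mulrDl mul1r lerD.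
have -> : k2 * r = (k2 * k1) * (r / k1) by field; rewrite gt_eqF.
rewrite cvolM; move: vge; move: ((k2 * k1) ^+ n.+1) (exprn_ge0 n.+1 (ltW (mulr_gt0 k20 k10))).
move: (cvol (r / k1)) => w q q0 wv.
have -> : 2 * (q * w * K) = w * (2 * q * K) by ring.
by rewrite ler_wpM2r// mulr_ge0// mulr_ge0.
Qed.

Lemma compact_support chi rho : (forall y, rho <= wnorm y -> chi y = 0) ->
  compact (closure [set y | chi y != 0]).
Proof.
move=> supp.
pose K : set E := [set y | forall i, (y ord0 i) \in `[- (rho * s 0 i), rho * s 0 i]].
have cK : compact K.
  apply: (@rV_compact _ _ (fun i => `[- (rho * s 0 i), rho * s 0 i]%classic)) => i.
  exact: segment_compact.
have clK : closed K by apply: compact_closed cK; exact: norm_hausdorff.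
have clE := (closure_id K).1 clK.
suff sub : [set y | chi y != 0] `<=` K.
  apply: (subclosed_compact (@closed_closure _ _) cK).
  by rewrite clE; exact: closureS.
move=> y /= yn i.
have yr : wnorm y <= rho.
  by rewrite leNgt; apply/negP => /ltW/supp y0; move: yn; rewrite y0 eqxx.
rewrite in_itv/= -ler_norml; apply: (le_trans (normr_le_wnorm s_gt0 y i)).
by rewrite ler_wpM2r// ltW.
Qed.

Lemma vanishing_oscillation_CMO b : locally_integrable_rV b ->
  (exists B, forall x r, 0 < r -> osc b x r <= B) ->
  (forall gamma, 0 < gamma -> exists2 L : R, 0 < L & forall x r, 0 < r ->
     r < L^-1 \/ L < r \/ L < wnorm x -> osc b x r < gamma) ->
  CMO b.
Proof.
move=> bL [B oB] decay; have bl := locally_integrable_locint s bL.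
have [Ct Ct0 hCt] := mean_oscillation_le.
split.
  split => //; apply: (@le_lt_trans _ _ (Ct * B)%:E); last exact: ltry.
  by apply: ge_ereal_sup => _ [[x r] /= r0 <-]; exact: hCt.
move=> e e0.
have [lam lam0 hchi] := cutoff_exists s_gt0.
have [C C0 hC] := osc_approximation s_gt0 lam0.
pose gamma := e / 2 / (Ct * C).
have g0 : 0 < gamma by rewrite !divr_gt0// mulr_gt0.
have [L L0 hL] := decay _ g0.
(* All scales up to 4 a are then below [L^-1]. *)
pose a := (8 * L)^-1; have a0 : 0 < a by rewrite invr_gt0 mulr_gt0.
(* Both rho / 8 and rho / 2 exceed [L], which covers large and far cubes; the summand [a] ensures a
   <= rho. *)
pose rho := 16 * L + a.
have arho : a <= rho by rewrite lerDr mulr_ge0// ltW.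
have aL : 4 * a < L^-1.
  rewrite /a invfM mulrA -[ltRHS]mul1r ltr_pM2r ?invr_gt0//.
  by lra.
have rhoL : 16 * L < rho by rewrite ltrDl.
have rho0 : 0 < rho := lt_le_trans a0 arho.
have small x t : 0 < t -> t <= 4 * a -> osc b x t <= gamma.
  by move=> t0 ta; apply/ltW/hL => //; left; exact: le_lt_trans aL.
have big x t : rho / 8 <= t -> osc b x t <= gamma.
  move=> tr; have Lt : L < t.
    by apply: lt_le_trans tr; rewrite ltr_pdivlMr//; apply: le_lt_trans rhoL; lra.
  by apply/ltW/hL; [exact: lt_trans Lt|right; left].
have out x t : rho / 2 < wnorm x -> 0 < t -> osc b x t <= gamma.
  move=> xr t0; apply/ltW/hL => //; right; right; apply: lt_trans xr.
  by rewrite ltr_pdivlMr//; apply: le_lt_trans rhoL; lra.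
have small4 x : osc b x (4 * a) <= gamma by apply: small; rewrite ?mulr_gt0.
have [ba [eba lba hba]] := smoothing_exists s_gt0 bl a0 arho (ltW g0) small4.
have [chi echi cchi] := hchi _ rho0.
have hosc := hC b gamma rho a chi ba bl cchi a0 arho (ltW g0) lba small big out hba.
have [mchi chi01 _ _ chi0] := cchi.
pose g : E -> R := chi * (ba + cst (- mean b 0 rho)).
have eg : elementary g.
  apply: elementary_mul => //; apply: elementary_add => //; exact: elementary_cst.
have gE y : g y = chi y * (ba y - mean b 0 rho) by [].
exists g.
  split; first exact: elementary_smooth.
  apply: (@compact_support _ (2 * rho)) => y /chi0 y0.
  by rewrite gE y0 mul0r.
have lb : locint (b \- g).
  have lc : locint (fun y => ba y - mean b 0 rho) by apply: locintB => //; exact: locint_cst.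
  apply: locintB => //; apply: (locint_le lc).
    by apply: continuous_measurable_rV; exact: elementary_continuous.
  move=> y; rewrite gE normrM ler_piMl//.
  by have /andP[? ?] := chi01 y; rewrite ger0_norm.
apply: (@le_lt_trans _ _ (Ct * (C * gamma))%:E).
  by apply: ge_ereal_sup => _ [[x r] /= r0 <-]; apply: hCt.
rewrite lte_fin mulrA /gamma mulrC divfK ?gt_eqF ?mulr_gt0//.
by lra.
Qed.

End mean_oscillation_cubes.

Theorem theorem3p2 (R : realType) (n : nat) (X : normedFunctionSpace R n)
    (b Omega : 'rV[R]_n.+1 -> R) :
  is_ball_banach X ->
  maximal_bounded X ->
  maximal_bounded (associate_norm X) ->
  locally_integrable_rV b ->
  homogeneous0 Omega ->
  sphere_Linfty Omega ->
  \int[@surface R n]_(x in @sphere R n) Omega x = 0 ->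
  (exists Lambda : set 'rV[R]_n.+1,
     [/\ open_in_sphere Lambda, no_sign_change Omega Lambda
       & ~ ae_zero_on_sphere Omega Lambda]) ->
  compact_operator X (commutator_dom b Omega) (commutator b Omega) ->
  CMO b.
Proof.
move=> bX maxX _ bL hom OL _ [Lam [oL sgn nz]] cT.
have TX f : (X f < +oo)%E -> {ae @leb R n, forall x, T_Omega_exists Omega f x}.
  by move=> /(cT.1)[+ _]; apply: filterS => x [].
have [s [z0 [sg [M [c [dlt gk]]]]]] :=
  good_kernel_exists hom OL (kernel_measurable bX TX) oL sgn nz.
have bl := locally_integrable_locint s bL.
have [B _ hB] := osc_bounded bX maxX gk bl cT.
apply: (vanishing_oscillation_CMO (gk_s gk) bL); first by exists B.
exact: (osc_decay bX maxX gk bl cT).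
Qed.
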